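(* Let $r,n$ be positive integers and suppose $c_0=\ell/n$ for a positive integer $\ell$ coprime to $n$. Then for the rational Cherednik algebra of $G(r,1,n)$ with parameters $(c_0,d_0,\dots,d_{r-1})$, the set of $f_\alpha$, $\alpha\in\mathbf{Z}_{\ge0}^n$, such that (a) $\alpha_n^--\alpha_1^-\le \ell r$ with equality implying $w_\alpha^{-1}(n)>w_\alpha^{-1}(1)$, and (b) for each pair of integers $k$ and $m$ with $0\le m\le n-1$ and $k>0$ such that $d_0-d_{-k}+rm\ell/n=k$, we have $\alpha^-_{m+1}<k$, is a homogeneous basis of $L_c(\mathrm{Triv})$ (that is, the images of these $f_\alpha$ in $L_c(\mathrm{Triv})$ form a basis). In particular, for every $n\ge1$, the graded dimension of $L=L_c(\mathrm{Triv})$ for $G(2,2,2n)$ with $c=1/2n$ is $$\sum_d\dim_{\mathbf{C}}(L^d)q^d=\sum_{\substack{0\le\ell\le n-1\\ n-1-\ell\in2\mathbf{Z}}}\binom{2n}{\ell}q^{n-1}+\sum_{d=0}^{n-2}\Big(\sum_{\substack{0\le\ell\le d\\ d-\ell\in2\mathbf{Z}}}\binom{2n}{\ell}\Big)\big(q^d+q^{2(n-1)-d}\big),$$ and the graded dimension of $L=L_c(\mathrm{Triv})$ for $G(2,1,2n)$ with $c=1/2n$ is $$\sum_d\dim_{\mathbf{C}}(L^d)q^d=\sum_{\substack{0\le\ell\le n\\ n-\ell\in2\mathbf{Z}}}\binom{2n}{\ell}q^{n}+\sum_{d=0}^{n-1}\Big(\sum_{\substack{0\le\ell\le d\\ d-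\ell\in2\mathbf{Z}}}\binom{2n}{\ell}\Big)\big(q^d+q^{2n-d}\big).$$
   Context: $W=G(r,1,n)$ is the group of $n\times n$ matrices with one nonzero entry in each row and column, these being $r$-th roots of $1$, acting on $V=\mathbf{C}^n$ with standard basis $y_i$ and dual basis $x_i$. Put $\zeta=e^{2\pi i/r}$, $s_{ij}$ the transposition matrix, $\zeta_i$ the diagonal matrix with $i$-th entry $\zeta$ and others $1$, $e_{ij}=\frac1r\sum_{0\le\ell\le r-1}\zeta^{-\ell j}\zeta_i^\ell$. Parameters: $c_0,d_0,\dots,d_{r-1}\in\mathbf{C}$ (indices of $d$ modulo $r$; only differences of $d_j$'s matter). $H_c$ is the quotient of $T(V\oplus V^* )\rtimes W$ by $[x_i,x_j]=0=[y_i,y_j]$, $y_ix_j=x_jy_i+c_0\sum_{0\le\ell\le r-1}\zeta^{-\ell}\zeta_i^\ell s_{ij}\zeta_i^{-\ell}$ for $i\ne j$, and $y_ix_i=x_iy_i+1-\sum_{0\le j\le r-1}(d_j-d_{j-1})e_{ij}-c_0\sum_{j\ne i,0\le\ell\le r-1}\zeta_i^\ell s_{ij}\zeta_i^{-\ell}$. $\Delta_c(\mathrm{Triv})=\mathrm{Ind}_{\mathbf{C}[V^*]\rtimes W}^{H_c}\mathrm{Triv}$ is identified with $\mathbf{C}[x_1,\dots,x_n]$, and $L_c(\mathrm{Triv})$ is its unique irreducible quotient, graded by polynomial degree; $L^d$ is the degree $d$ part. For $\alpha\in\mathbf{Z}^n_{\ge0}$, $\alpha^-=(\alpha_1^-\le\cdots\le\alpha_n^-)$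 is its nondecreasing rearrangement and $w_\alpha\in S_n$ is the longest element (Bruhat order) among those $w$ with $w\cdot\alpha=(\alpha_{w^{-1}(1)},\dots,\alpha_{w^{-1}(n)})$ nondecreasing. Write $\beta<\alpha$ if $\beta,\alpha$ have the same sum and the partition obtained by sorting $\beta$ is strictly smaller in dominance order than that of $\alpha$, or if they have the same sorting and $w_\beta<w_\alpha$ in Bruhat order. Let $z_i=y_ix_i+c_0\sum_{1\le j<i,\,0\le\ell\le r-1}\zeta_i^\ell s_{ij}\zeta_i^{-\ell}$. The $z_i$ and $\zeta_i$ commute; when $c_0=\ell/n$ for a positive integer $\ell$ coprime to $n$ they act diagonalizably on $\Delta_c(\mathrm{Triv})$, and $f_\alpha$ is the unique simultaneous eigenvector of all $z_i$, $\zeta_i$ in $\Delta_c(\mathrm{Triv})$ of the form $x^\alpha+$ (linear combination of $x^\beta$ with $\beta<\alpha$). $G(2,1,2n)$ is the group of signed permutation matrices and $G(2,2,2n)$ its subgroup of matrices with an even number of $-1$'s. ''With $c=1/2n$'' means that the Cherednik parameter equals $1/2n$ on every reflection, where the Cherednik algebra of $W$ with constant parameter $c$ is generated by $W$, $\mathbf{C}[V]$ and the Dunkl operators $y(f)=\partial_yf-\sum_sc\langle\alpha_s,y\rangle\frac{f-s(f)}{\alpha_s}$ ($s$ over reflections of $W$, $\alpha_s$ a linear form defining the fixed hyperplane). In the notation above, for $G(2,1,2n)$ this is $c_0=d_0=-d_1=1/2n$. *)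

(* Defs.v *)
From HB Require Import structures.
From mathcomp Require Import all_boot all_order fingroup perm all_algebra generic_quotient.
From mathcomp Require Import boolp classical_sets cardinality fsbigop reals trigo.
From mathcomp Require Import complex.
From mathcomp Require Import mpoly.

Set Implicit Arguments.
Unset Strict Implicit.
Unset Printing Implicit Defensive.

Import Order.TTheory GRing.Theory Num.Theory.
Local Open Scope ring_scope.
Local Open Scope quotient_scope.
Local Open Scope complex_scope.

(* [(b i)_(i in P)] is a basis of the subspace [S]. *)
Definition is_basis (K : fieldType) (V : lmodType K) (I : choiceType)
    (P : set I) (b : I -> V) (S : set V) : Prop :=
  [/\ forall i, P i -> S (b i),
      forall (s : seq I) (a : I -> K), uniq s -> (forall i, i \in s -> P i) ->
        \sum_(i <- s) a i *: b i = 0 -> forall i, i \in s -> a i = 0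
    & forall v, S v -> exists (s : seq I) (a : I -> K),
        (forall i, i \in s -> P i) /\ v = \sum_(i <- s) a i *: b i].

Definition has_dim (K : fieldType) (V : lmodType K) (S : set V) (k : nat) : Prop :=
  exists b : 'I_k -> V, is_basis setT b S.

Definition irreducible_module (A : pzRingType) (L : lmodType A) : Prop :=
  (exists v : L, v != 0) /\
  forall U : {pred L}, submod_closed U -> U =i pred1 0 \/ U =i predT.

Section QuotientModule.
Variables (A : pzRingType) (M : lmodType A) (U : M -> bool).
Hypothesis clU : submod_closed (U : {pred M}).

Definition quotmod_zmodClosed : zmodClosed M :=
  HB.pack_for (zmodClosed M) U
    (GRing.isZmodClosed.Build M U (GRing.submod_closedB clU)).

Definition quotmod : Type := @Quotient.quot M quotmod_zmodClosed.
HB.instance Definition _ := GRing.Zmodule.on quotmod.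
HB.instance Definition _ := EqQuotient.on quotmod.

Definition quotmod_pi (x : M) : quotmod := \pi_(@Quotient.quot M quotmod_zmodClosed) x.
Definition quotmod_scale (a : A) (x : quotmod) : quotmod :=
  quotmod_pi (a *: (repr x : M)).

Lemma quotmod_eqP x y : reflect (quotmod_pi x = quotmod_pi y) (U (x - y)).
Proof. by apply: (iffP idP) => [h|/eqmodP]; [apply/eqmodP|]. Qed.

Lemma quotmod_piD x y : quotmod_pi (x + y) = quotmod_pi x + quotmod_pi y.
Proof. exact: Quotient.pi_add. Qed.

Lemma quotmod_piK x : quotmod_pi (repr x) = x. Proof. exact: reprK. Qed.

Lemma quotmod_piZ a x : quotmod_pi (a *: x) = quotmod_scale a (quotmod_pi x).
Proof.
apply/quotmod_eqP; rewrite -scalerBr -[_ *: _]addr0.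
by apply: clU.2; [apply/quotmod_eqP; rewrite quotmod_piK | exact: clU.1].
Qed.

Lemma quotmod_scaleA a b x :
  quotmod_scale a (quotmod_scale b x) = quotmod_scale (a * b) x.
Proof. by rewrite -[x]quotmod_piK -!quotmod_piZ scalerA. Qed.
Lemma quotmod_scale1 : left_id 1 quotmod_scale.
Proof. by move=> x; rewrite -[x]quotmod_piK -!quotmod_piZ scale1r. Qed.
Lemma quotmod_scaleDr : right_distributive quotmod_scale +%R.
Proof.
move=> a x y; rewrite -[x]quotmod_piK -[y]quotmod_piK.
by rewrite -quotmod_piD -!quotmod_piZ scalerDr quotmod_piD.
Qed.
Lemma quotmod_scaleDl x : {morph quotmod_scale^~ x : a b / a + b}.
Proof.
by move=> a b; rewrite -[x]quotmod_piK -!quotmod_piZ scalerDl quotmod_piD.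
Qed.

HB.instance Definition _ := GRing.Zmodule_isLmodule.Build A quotmod
  quotmod_scaleA quotmod_scale1 quotmod_scaleDr quotmod_scaleDl.
End QuotientModule.

Inductive fexp (K G : Type) : Type :=
  | FScal of K
  | FGen of G
  | FAdd of fexp K G & fexp K G
  | FMul of fexp K G & fexp K G.

HB.instance Definition _ (K G : Type) := gen_eqMixin (fexp K G).
HB.instance Definition _ (K G : Type) := gen_choiceMixin (fexp K G).

Declare Scope fexp_scope.
Delimit Scope fexp_scope with F.
Bind Scope fexp_scope with fexp.
Infix "+" := (@FAdd _ _) : fexp_scope.
Infix "*" := (@FMul _ _) : fexp_scope.
Notation "a %:S" := (@FScal _ _ a) (at level 1, format "a %:S") : fexp_scope.

Section Presented.
Variables (K : fieldType) (G : Type) (R : fexp K G -> fexp K G -> Prop).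
Local Notation E := (fexp K G).

Inductive pcong : E -> E -> Prop :=
  | pc_rel x y : R x y -> pcong x y
  | pc_refl x : pcong x x
  | pc_sym x y : pcong x y -> pcong y x
  | pc_trans y x z : pcong x y -> pcong y z -> pcong x z
  | pc_add x x' y y' : pcong x x' -> pcong y y' -> pcong (x + y)%F (x' + y')%F
  | pc_mul x x' y y' : pcong x x' -> pcong y y' -> pcong (x * y)%F (x' * y')%F
  | pc_addA x y z : pcong (x + (y + z))%F (x + y + z)%F
  | pc_addC x y : pcong (x + y)%F (y + x)%F
  | pc_add0 x : pcong (0%:S + x)%F x
  | pc_addN x : pcong ((- 1)%:S * x + x)%F (0%:S)%F
  | pc_mulA x y z : pcong (x * (y * z))%F (x * y * z)%F
  | pc_mul1l x : pcong (1%:S * x)%F x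
  | pc_mul1r x : pcong (x * 1%:S)%F x
  | pc_mulDl x y z : pcong ((x + y) * z)%F (x * z + y * z)%F
  | pc_mulDr x y z : pcong (x * (y + z))%F (x * y + x * z)%F
  | pc_scalD a b : pcong ((a + b)%R%:S)%F (a%:S + b%:S)%F
  | pc_scalM a b : pcong ((a * b)%R%:S)%F (a%:S * b%:S)%F
  | pc_scalC a x : pcong (a%:S * x)%F (x * a%:S)%F.

Definition pcongb (x y : E) : bool := `[< pcong x y >].

Lemma pcongb_refl : reflexive pcongb.
Proof. by move=> x; apply/asboolP/pc_refl. Qed.
Lemma pcongb_sym : ssrbool.symmetric pcongb.
Proof. by move=> x y; apply/asboolP/asboolP; apply: pc_sym. Qed.
Lemma pcongb_trans : transitive pcongb.
Proof.
by move=> y x z /asboolP xy /asboolP yz; apply/asboolP; apply: pc_trans xy yz.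
Qed.
Canonical pcongb_equiv := EquivRel pcongb pcongb_refl pcongb_sym pcongb_trans.

Definition presented : Type := {eq_quot pcongb}.
HB.instance Definition _ : EqQuotient _ pcongb presented := EqQuotient.on presented.
HB.instance Definition _ := Choice.on presented.

Definition pr (x : E) : presented := \pi_presented x.

Lemma prP x y : pr x = pr y <-> pcong x y.
Proof. by split=> [/eqmodP/asboolP|xy]//; apply/eqmodP/asboolP. Qed.
Lemma repr_pr x : pcong (repr (pr x)) x.
Proof. by apply/prP; rewrite /pr reprK. Qed.
Lemma prK x : pr (repr x) = x. Proof. exact: reprK. Qed.

Definition pr_add (x y : presented) := pr (repr x + repr y)%F.
Definition pr_opp (x : presented) := pr ((- 1)%:S * repr x)%F.
Definition pr_mul (x y : presented) := pr (repr x * repr y)%F.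

Lemma pr_addE x y : pr_add (pr x) (pr y) = pr (x + y)%F.
Proof. by apply/prP/pc_add; apply: repr_pr. Qed.
Lemma pr_oppE x : pr_opp (pr x) = pr ((- 1)%:S * x)%F.
Proof. by apply/prP/pc_mul; [apply: pc_refl | apply: repr_pr]. Qed.
Lemma pr_mulE x y : pr_mul (pr x) (pr y) = pr (x * y)%F.
Proof. by apply/prP/pc_mul; apply: repr_pr. Qed.

Lemma pr_addA : associative pr_add.
Proof.
move=> x y z; rewrite -[x]prK -[y]prK -[z]prK !pr_addE.
exact/prP/pc_addA.
Qed.
Lemma pr_addC : commutative pr_add.
Proof. by move=> x y; rewrite -[x]prK -[y]prK !pr_addE; apply/prP/pc_addC. Qed.
Lemma pr_add0 : left_id (pr 0%:S) pr_add.
Proof. by move=> x; rewrite -[x]prK !pr_addE; apply/prP/pc_add0. Qed.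
Lemma pr_addN : left_inverse (pr 0%:S) pr_opp pr_add.
Proof. by move=> x; rewrite -[x]prK pr_oppE pr_addE; apply/prP/pc_addN. Qed.
Lemma pr_mulA : associative pr_mul.
Proof.
move=> x y z; rewrite -[x]prK -[y]prK -[z]prK !pr_mulE.
exact/prP/pc_mulA.
Qed.
Lemma pr_mul1l : left_id (pr 1%:S) pr_mul.
Proof. by move=> x; rewrite -[x]prK !pr_mulE; apply/prP/pc_mul1l. Qed.
Lemma pr_mul1r : right_id (pr 1%:S) pr_mul.
Proof. by move=> x; rewrite -[x]prK !pr_mulE; apply/prP/pc_mul1r. Qed.
Lemma pr_mulDl : left_distributive pr_mul pr_add.
Proof.
move=> x y z; rewrite -[x]prK -[y]prK -[z]prK !(pr_addE, pr_mulE).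
exact/prP/pc_mulDl.
Qed.
Lemma pr_mulDr : right_distributive pr_mul pr_add.
Proof.
move=> x y z; rewrite -[x]prK -[y]prK -[z]prK !(pr_addE, pr_mulE).
exact/prP/pc_mulDr.
Qed.

HB.instance Definition _ := GRing.isZmodule.Build presented
  pr_addA pr_addC pr_add0 pr_addN.
HB.instance Definition _ := GRing.Zmodule_isPzRing.Build presented
  pr_mulA pr_mul1l pr_mul1r pr_mulDl pr_mulDr.

Definition pr_scal (a : K) : presented := pr a%:S.

(* A module over [presented], viewed as a vector space over [K]. *)
Definition over_scalars (M : lmodType presented) : Type := M.

Section OverScalars.
Variable M : lmodType presented.
HB.instance Definition _ := GRing.Zmodule.on (over_scalars M).
Definition os_scale (a : K) (x : over_scalars M) : over_scalars M :=
  pr_scal a *: (x : M).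

Lemma os_scaleA a b x : os_scale a (os_scale b x) = os_scale (a * b) x.
Proof.
rewrite /os_scale scalerA; congr (_ *: _).
by rewrite [LHS]pr_mulE; apply/esym/prP/pc_scalM.
Qed.
Lemma os_scale1 : left_id 1 os_scale.
Proof. by move=> x; rewrite /os_scale [X in X *: _](_ : _ = 1) ?scale1r. Qed.
Lemma os_scaleDr : right_distributive os_scale +%R.
Proof. by move=> a x y; rewrite /os_scale scalerDr. Qed.
Lemma os_scaleDl x : {morph os_scale^~ x : a b / a + b}.
Proof.
move=> a b; rewrite /os_scale -scalerDl; congr (_ *: _).
by rewrite [RHS]pr_addE; apply/prP/pc_scalD.
Qed.
HB.instance Definition _ := GRing.Zmodule_isLmodule.Build K (over_scalars M)
  os_scaleA os_scale1 os_scaleDr os_scaleDl.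
End OverScalars.
End Presented.

Section Exponents.
Variable n : nat.
Local Notation expo := {ffun 'I_n -> nat}.
Implicit Types (a b : expo) (u v w : 'S_n).

Definition expo_sum a : nat := (\sum_(i < n) a i)%N.
Definition expo_act w a : expo := [ffun i => a ((w^-1)%g i)].

(* [aminus a k] is the entry with (1-based) index k of the nondecreasing
   rearrangement of a. *)
Definition aminus a (k : nat) : nat := nth 0%N (sort leq (codom a)) k.-1.
Definition apart a : seq nat := sort geq (codom a).

Definition dominance_le (p q : seq nat) : Prop :=
  forall k, (sumn (take k p) <= sumn (take k q))%N.

Definition perm_len w : nat :=
  #|[set p : 'I_n * 'I_n | (p.1 < p.2)%N && (w p.2 < w p.1)%N]|.
Definition bruhat_le : rel 'S_n :=
  connect (fun u v : 'S_n =>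
    [exists i, exists j, v == (u * tperm i j)%g] && (perm_len u < perm_len v)%N).

Definition nondecr a : bool := [forall i : 'I_n, forall j : 'I_n, (i <= j)%N ==> (a i <= a j)%N].

(* The default value is never used: the permutations sorting [a] form a coset
   of a parabolic subgroup, which has a Bruhat-greatest element. *)
Definition walpha a : 'S_n :=
  odflt 1%g [pick w | nondecr (expo_act w a) &&
    [forall v, nondecr (expo_act v a) ==> bruhat_le v w]].

Definition expo_lt b a : Prop :=
  expo_sum b = expo_sum a /\
  ((apart b <> apart a /\ dominance_le (apart b) (apart a)) \/
   [/\ apart b = apart a, walpha b <> walpha a & bruhat_le (walpha b) (walpha a)]).

Section Conditions.
Variables (K : fieldType) (r l : nat) (d : int -> K).

Definition condition_a a : Prop :=
  (aminus a n - aminus a 1 <= l * r)%N /\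
  ((aminus a n - aminus a 1)%N = (l * r)%N ->
   forall i1 im : 'I_n, val i1 = 0%N -> val im = n.-1 ->
     ((walpha a)^-1%g i1 < (walpha a)^-1%g im)%N).

Definition condition_b a : Prop :=
  forall k m : nat, (m <= n.-1)%N -> (0 < k)%N ->
    d 0 - d (- k%:Z) + r%:R * m%:R * l%:R / n%:R = k%:R ->
    (aminus a m.+1 < k)%N.
End Conditions.
End Exponents.

Definition Gr1n (K : fieldType) (r n : nat) : pred 'M[K]_n := fun w =>
  [&& [forall i, #|[set j | w i j != 0]| == 1%N],
      [forall j, #|[set i | w i j != 0]| == 1%N]
    & [forall i, forall j, (w i j != 0) ==> (w i j ^+ r == 1)]].

(* T(V (+) V^* ) x| W is generated by the vectors of V (columns), those of V^*
   (rows) and the elements of W. *)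
Variant cgen (K : fieldType) (r n : nat) : Type :=
  | GY of 'cV[K]_n
  | GX of 'rV[K]_n
  | GW of {w : 'M[K]_n | Gr1n r w}.

Section Cherednik.
Variables (K : fieldType) (zeta : K) (r n : nat) (c0 : K) (d : int -> K).
Local Notation E := (fexp K (cgen K r n)).
Local Notation "\esum_ ( i | P ) F" := (\big[@FAdd _ _/FScal _ 0]_(i | P) F)
  (at level 41, F at level 41, i, P at level 50).
Local Notation "\esum_ ( i < m ) F" := (\big[@FAdd _ _/FScal _ 0]_(i < m) F)
  (at level 41, F at level 41, i, m at level 50).

Definition EY (v : 'cV[K]_n) : E := FGen K (GY r v).
Definition EX (x : 'rV[K]_n) : E := FGen K (GX r x).
Definition Ey (i : 'I_n) : E := EY (delta_mx i 0).
Definition Ex (i : 'I_n) : E := EX (delta_mx 0 i).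
(* Only used for [w] in G(r,1,n). *)
Definition EW (w : 'M[K]_n) : E :=
  if insub w is Some g then FGen K (GW g) else FScal _ 0.

Definition zeta_mx (i : 'I_n) : 'M[K]_n :=
  diag_mx (\row_j (if j == i then zeta else 1)).
Definition refl_mx (i j : 'I_n) (l : nat) : 'M[K]_n :=
  zeta_mx i ^+ l *m tperm_mx i j *m invmx (zeta_mx i ^+ l).
Definition Ee (i : 'I_n) (j : nat) : E :=
  ((r%:R^-1)%R%:S *
   (\esum_(l < r) ((zeta ^- (l * j))%R%:S * EW (zeta_mx i ^+ l))))%F.

Variant crel : E -> E -> Prop :=
  | CR_linY a u v : crel (EY (a *: u + v)) (a%:S * EY u + EY v)%F
  | CR_linX a u v : crel (EX (a *: u + v)) (a%:S * EX u + EX v)%F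
  | CR_W1 : crel (EW 1%:M) (1%:S)%F
  | CR_WM w w' : Gr1n r w -> Gr1n r w' -> crel (EW (w *m w')) (EW w * EW w')%F
  | CR_WY w v : Gr1n r w -> crel (EW w * EY v)%F (EY (w *m v) * EW w)%F
  | CR_WX w x : Gr1n r w -> crel (EW w * EX x)%F (EX (x *m invmx w) * EW w)%F
  | CR_XX i j : crel (Ex i * Ex j)%F (Ex j * Ex i)%F
  | CR_YY i j : crel (Ey i * Ey j)%F (Ey j * Ey i)%F
  | CR_YX i j : i != j ->
      crel (Ey i * Ex j)%F
           (Ex j * Ey i
            + c0%:S * (\esum_(l < r) ((zeta ^- l)%R%:S * EW (refl_mx i j l))))%F
  | CR_YXii i :
      crel (Ey i * Ex i)%F
           (Ex i * Ey i + 1%:S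
            + (- 1)%R%:S * (\esum_(j < r) ((d j%:Z - d (j%:Z - 1))%R%:S * Ee i j))
            + (- c0)%R%:S * (\esum_(j | j != i) \esum_(l < r) EW (refl_mx i j l)))%F.

Definition Hc : Type := presented crel.
HB.instance Definition _ := GRing.PzRing.on Hc.

Definition hy (i : 'I_n) : Hc := pr crel (Ey i).
Definition hx (i : 'I_n) : Hc := pr crel (Ex i).
Definition hw (w : 'M[K]_n) : Hc := pr crel (EW w).
Definition hscal (a : K) : Hc := pr_scal crel a.

(* Ind_{C[V^*] x| W}^{H_c} Triv = H_c / J, where J is the left ideal generated
   by V and by the w - 1 for w in W. *)

Inductive triv_ideal : Hc -> Prop :=
  | TI_0 : triv_ideal 0
  | TI_Y h i k : triv_ideal k -> triv_ideal (h * hy i + k)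
  | TI_W h w k : Gr1n r w -> triv_ideal k -> triv_ideal (h * (hw w - 1) + k).

Definition triv_pred : Hc^o -> bool := fun h => `[< triv_ideal h >].

Lemma triv_closed : submod_closed (triv_pred : {pred Hc^o}).
Proof.
split=> [|a x y]; first by apply/asboolP; constructor.
move=> /asboolP ix /asboolP iy; apply/asboolP.
elim: ix => [|h i k _ IH|h w k hw _ IH]; first by rewrite scaler0 add0r.
  by rewrite scalerDr -addrA /GRing.scale /= mulrA; apply: TI_Y.
by rewrite scalerDr -addrA /GRing.scale /= mulrA; apply: TI_W.
Qed.
Definition Delta_triv : Type := quotmod triv_closed.
HB.instance Definition _ := GRing.Lmodule.on Delta_triv.

Definition Delta_one : Delta_triv := quotmod_pi triv_closed 1.

(* Under the identification of [Delta_triv] with C[x_1, ..., x_n], this is the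
   monomial x^a. *)
Definition xmon (a : {ffun 'I_n -> nat}) : Delta_triv :=
  (\prod_(i < n) hx i ^+ a i) *: Delta_one.

Definition Delta_deg (k : nat) (v : Delta_triv) : Prop :=
  exists (s : seq {ffun 'I_n -> nat}) (a : {ffun 'I_n -> nat} -> K),
    (forall b, b \in s -> expo_sum b = k) /\
    v = \sum_(b <- s) hscal (a b) *: xmon b.

Definition hz (i : 'I_n) : Hc :=
  hy i * hx i + hscal c0 * \sum_(j < n | (j < i)%N) \sum_(l < r) hw (refl_mx i j l).

Definition is_f (a : {ffun 'I_n -> nat}) (f : Delta_triv) : Prop :=
  [/\ forall i, exists e : K, hz i *: f = hscal e *: f,
      forall i, exists e : K, hw (zeta_mx i) *: f = hscal e *: f
    & exists (s : seq {ffun 'I_n -> nat}) (q : {ffun 'I_n -> nat} -> K),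
        (forall b, b \in s -> expo_lt b a) /\
        f = xmon a + \sum_(b <- s) hscal (q b) *: xmon b].

Definition f_alpha (a : {ffun 'I_n -> nat}) : Delta_triv := xget 0 (is_f a).

Definition is_Ltriv (L : lmodType Hc) (p : {linear Delta_triv -> L}) : Prop :=
  irreducible_module L /\ forall v : L, exists u, p u = v.

Definition Ltriv_deg (L : lmodType Hc) (p : {linear Delta_triv -> L}) (k : nat) :
    set (over_scalars L) :=
  fun v => exists2 u, Delta_deg k u & p u = v.
End Cherednik.

Section Dunkl.
Variables (K : fieldType) (N : nat) (W : set 'M[K]_N) (c : K).
Local Notation P := {mpoly K[N]}.

Definition linform (a : 'rV[K]_N) : P := \sum_(j < N) a 0 j *: 'X_j.

(* (w f)(v) = f (w^-1 v). *)
Definition poly_act (w : 'M[K]_N) (f : P) : P :=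
  f \mPo [tuple linform (row i (invmx w)) | i < N].

Definition dir_deriv (y : 'cV[K]_N) (f : P) : P := \sum_(i < N) y i 0 *: f^`M(i).

Definition reflections : set 'M[K]_N :=
  fun s => W s /\ \rank (s - 1%:M) = 1%N.

Definition alpha_form (s : 'M[K]_N) : 'rV[K]_N :=
  xget 0 (fun a => forall v : 'cV[K]_N, s *m v = v <-> a *m v = 0).

(* Only meaningful when g is nonzero and divides f. *)
Definition mpoly_quo (f g : P) : P := xget 0 (fun h => f = h * g).

Definition dunkl (y : 'cV[K]_N) (f : P) : P :=
  dir_deriv y f -
  \sum_(s \in reflections)
     (c * (alpha_form s *m y) 0 0) *:
       mpoly_quo (f - poly_act s f) (linform (alpha_form s)).

Inductive dunkl_algebra : (P -> P) -> Prop :=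
  | DA_W w : W w -> dunkl_algebra (poly_act w)
  | DA_mul g : dunkl_algebra (fun f => g * f)
  | DA_dunkl y : dunkl_algebra (dunkl y)
  | DA_scale a h : dunkl_algebra h -> dunkl_algebra (fun f => a *: h f)
  | DA_add h k : dunkl_algebra h -> dunkl_algebra k -> dunkl_algebra (fun f => h f + k f)
  | DA_comp h k : dunkl_algebra h -> dunkl_algebra k -> dunkl_algebra (h \o k).

Definition dunkl_submodule (U : {pred P}) : Prop :=
  submod_closed U /\ forall h, dunkl_algebra h -> forall f, f \in U -> h f \in U.

(* The kernel of [p] is a maximal proper submodule, i.e. [L] is an irreducible
   quotient of the polynomial module. *)
Definition is_dunkl_Ltriv (L : lmodType K) (p : {linear P -> L}) : Prop :=
  [/\ forall v : L, exists f, p f = v,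
      dunkl_submodule (fun f => p f == 0),
      exists f, p f != 0
    & forall U : {pred P}, dunkl_submodule U -> (forall f, p f = 0 -> f \in U) ->
        (forall f, f \in U -> p f = 0) \/ (forall f, f \in U)].

Definition dunkl_Ltriv_deg (L : lmodType K) (p : {linear P -> L}) (k : nat) : set L :=
  fun v => exists2 f, f \is k.-homog & p f = v.
End Dunkl.

Definition G21 (K : fieldType) (N : nat) : set 'M[K]_N := fun w => Gr1n 2 w.
Definition G22 (K : fieldType) (N : nat) : set 'M[K]_N :=
  fun w => Gr1n 2 w /\ ~~ odd #|[set ij : 'I_N * 'I_N | w ij.1 ij.2 == -1]|.

Definition zeta_root (R : realType) (r : nat) : R[i] :=
  cos (2 * pi / r%:R) +i* sin (2 * pi / r%:R).

Definition parity_binsum (n d : nat) : nat :=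
  (\sum_(0 <= l < d.+1 | ~~ odd (d - l)) 'C(2 * n, l))%N.

(* Main.v *)
Require Import Defs.
From HB Require Import structures.
From mathcomp Require Import all_boot all_order all_fingroup all_algebra.
From mathcomp Require Import boolp classical_sets cardinality fsbigop reals trigo complex.
From mathcomp Require Import zify ring lra.
From mathcomp Require Import mpoly.

Set Implicit Arguments.
Unset Strict Implicit.
Unset Printing Implicit Defensive.

Import Order.TTheory GRing.Theory Num.Theory.
Local Open Scope ring_scope.
Local Open Scope complex_scope.

(** On the basis of monomials x^a the elements y_i, z_i and the group act on
    C[x_1, ..., x_n] by explicit operators ([Y], [Z], [S], [mono]). The z_i are
    triangular for [expo_lt], with diagonal entries [ev i a]. Since c_0 = l/n
    with l coprime to n, the residues of the a_i modulo r, which the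
    eigenvalues of the zeta_i record, together with the [ev i a] determine a
    ([ev_sep]). Hence a joint eigenvector is determined up to a scalar by its
    leading monomial, and [F a], the polynomial f_a, is unique. Two
    intertwining operators construct it: the affine rotation [Phi], which is
    multiplication by x_n after a cyclic permutation of the variables, and
    [sig i j], attached to an adjacent transposition. They lead from 1 to every
    [F a] ([expo_phi_swap_ind]).

    Let [Bad] be the span of the [F a] for which (a) or (b) fails. It is a
    submodule: each of the operators that generate the algebra sends [F a] to a
    combination of neighbouring eigenvectors, and the coefficient vanishes
    whenever [a] is bad and the neighbour is good ([sig_bad_good],
    [bad_phi_ev]). Conversely, from a good exponent one descends to 1 inside
    the good exponents and with nonzero coefficients only ([st_descend]). As
    the eigenvalues separate the [F a], a submodule that is not inside [Bad]
    contains some good [F a], hence 1 ([stable_dichotomy]). So [Bad] is the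
    largest proper submodule, and the good [F a] give a basis of the quotient
    ([quotient_basis]).

    To apply this to the algebra given by generators and relations, one checks
    the relations for the operators above ([eval_crel]; the commutation of the
    y_i follows from the Jacobi identity, [Y_comm]) and identifies the standard
    module with the polynomials ([hact_tau], [tau_surj], [tau_eq0]). The Dunkl
    operators of G(2,1,N) and G(2,2,N) kill 1 and have the same commutators
    with the variables as the operators [Y] for r = 2 and d_0 = -d_1 = c,
    respectively d = 0, so they agree with them ([dunklE]). A submodule [U] for
    G(2,2,N) need not be stable under the sign changes in G(2,1,N), but its sum
    with its image under one sign change is; this sum does not contain 1,
    because by the Euler operator the elements of a proper submodule have no
    constant term ([euler_const], [N_Bad]).

    For r = 2 and l = 1 a good exponent has entries 0, 1 and 2, with all zeros
    before all twos, and at most n (for G(2,1,2n)) or n - 1 (for G(2,2,2n))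
    nonzero entries. It is determined by the set of positions of its ones and
    by its degree, and counting these sets gives the binomial sums
    ([card_admissible], [series_coef]). *)

(** * The order on exponents *)

Section ExpoOrder.
Local Open Scope nat_scope.
Variable n : nat.
Local Notation expo := {ffun 'I_n -> nat}.
Implicit Types (a b c : expo) (u v w : 'S_n) (i j k : 'I_n).

(** Ties are broken against the order of the positions, which makes the sorting
    permutation the longest one. *)
Definition before a : rel 'I_n :=
  fun j i => (a j < a i) || ((a j == a i) && (i < j)).

Lemma before_irr a i : before a i i = false.
Proof. by rewrite /before !ltnn eqxx. Qed.

Lemma before_trans a : transitive (before a).
Proof. by move=> j i k; rewrite /before; lia. Qed.

Lemma before_total a i j : i != j -> before a i j || before a j i.
Proof. by rewrite /before -val_eqE /=; lia. Qed.

Definition rk a i : nat := #|[set j | before a j i]|.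

Lemma rk_lt a i j : before a i j -> rk a i < rk a j.
Proof.
move=> bij; apply: proper_card; apply/fintype.properP; split.
  by apply/fintype.subsetP => k; rewrite !inE => /before_trans; apply.
by exists i; rewrite !inE ?before_irr.
Qed.

Lemma rk_ltE a i j : (rk a i < rk a j) = before a i j.
Proof.
apply/idP/idP => [lij|/rk_lt//].
have [eij|/(before_total a)/orP[]//] := eqVneq i j.
  by rewrite eij ltnn in lij.
by move=> /rk_lt; lia.
Qed.

Lemma rk_bound a i : rk a i < n.
Proof.
rewrite -[X in _ < X]card_ord -cardsT; apply: proper_card.
by apply/fintype.properP; split; [apply/fintype.subsetP => k; rewrite inE | exists i; rewrite !inE ?before_irr].
Qed.

Lemma rk_inj a : injective (rk a).
Proof.
move=> i j eij; apply/eqP; apply: contraT => /(before_total a).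
by rewrite -!rk_ltE eij ltnn.
Qed.

Definition rko a i : 'I_n := Ordinal (rk_bound a i).

Lemma rko_inj a : injective (rko a).
Proof. by move=> i j /(congr1 val)/= /rk_inj. Qed.

Definition rkp a : 'S_n := perm (@rko_inj a).

Lemma rkpE a i : rkp a i = rk a i :> nat.
Proof. by rewrite permE. Qed.

Definition sorting a w := forall i j, a i < a j -> w i < w j.

Lemma sortingP a w : reflect (sorting a w) (nondecr (expo_act w a)).
Proof.
apply: (iffP idP) => [/forallP h i j lij|h].
  rewrite ltnNge; apply/negP => le.
  move/forallP: (h (w j)) => /(_ (w i)); rewrite !ffunE !permK le /=; lia.
apply/forallP => x; apply/forallP => y; apply/implyP => le; rewrite !ffunE.
rewrite leqNgt; apply/negP => /h; rewrite !permKV; lia.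
Qed.

Lemma sorting_rkp a : sorting a (rkp a).
Proof. by move=> i j lij; rewrite !rkpE rk_ltE /before lij. Qed.

Lemma top_sorting_rkp a w : sorting a w ->
  (forall i j, i < j -> a i = a j -> w j < w i) -> w = rkp a.
Proof.
move=> sw tw; apply/permP => i; apply: ord_inj; rewrite rkpE /rk.
have key j : before a j i = (w j < w i).
  rewrite /before; have [eji|nji] := eqVneq j i; first by rewrite eji !ltnn eqxx.
  have nw : (w j : nat) <> w i by move/val_inj/perm_inj; apply/eqP.
  have nv : (j : nat) <> i by move/val_inj; apply/eqP.
  have := sw i j; have := sw j i; have := tw i j; have := tw j i; lia.
rewrite (eq_card (B := w @^-1: [set k : 'I_n | k < w i])); last first.
  by move=> j; rewrite !inE key.
rewrite card_preimset; last exact: perm_inj.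
rewrite cardsE -sum1_card; have lei : w i <= n by apply: ltnW.
rewrite (eq_bigl (fun k : 'I_n => true && (k < w i))) //.
by rewrite (big_ord_narrow_cond lei) sum1_card card_ord.
Qed.

(** The inversions of [v] inject into those of the product: a pair is moved by
    the transposition if this keeps its order, and fixed otherwise. The pair
    (i, j) is a new inversion. *)
Lemma perm_len_raise v i j : i < j -> v i < v j ->
  perm_len v < perm_len (tperm i j * v)%g.
Proof.
move=> ij vij; pose t := tperm i j.
pose A := [set p : 'I_n * 'I_n | (p.1 < p.2) && (v p.2 < v p.1)].
pose f (p : 'I_n * 'I_n) := if t p.1 < t p.2 then (t p.1, t p.2) else p.
have fT p : t (f p).1 < t (f p).2 = ~~ ((t p.1 < t p.2) && ~~ (p.1 < p.2)) &&
   ((t p.1 < t p.2) ==> (p.1 < p.2)) && (t p.1 < t p.2).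
  by rewrite /f; case: ifP => //= h; rewrite ?tpermK; case: (p.1 < p.2); rewrite ?andbT ?andbF.
have finj : {in A &, injective f}.
  move=> [p q] [p' q']; rewrite !inE /= => /andP[pq _] /andP[pq' _].
  rewrite /f /=; case: ifP => h; case: ifP => h'.
  - by move=> [/perm_inj -> /perm_inj ->].
  - by move=> [e1 e2]; rewrite -e1 -e2 !tpermK pq in h'.
  - by move=> [e1 e2]; rewrite e1 e2 !tpermK pq' in h.
  - by [].
rewrite /perm_len -/A -(card_in_imset finj); apply: proper_card; apply/fintype.properP; split.
  apply/fintype.subsetP => _ /imsetP[[p q] + ->]; rewrite !inE /= => /andP[pq vqp].
  rewrite /f /=; case: ifP => h /=; rewrite ?permM ?tpermK ?h //= pq /=.
  move: h; rewrite /t; case: tpermP => [ep|ep|/eqP np /eqP np'];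
    case: tpermP => [eq|eq|/eqP nq /eqP nq']; subst => //=; try lia.
exists (i, j); first by rewrite inE /= ij !permM tpermL tpermR vij.
apply/imsetP => -[[p q]]; rewrite inE /= => /andP[pq vqp].
rewrite /f /=; case: ifP => h [e1 e2].
  have := pq; rewrite -(tpermK i j p) -(tpermK i j q) -/t -e1 -e2 /t tpermL tpermR; lia.
by subst; lia.
Qed.

Lemma bruhat_len u v : bruhat_le u v -> u = v \/ perm_len u < perm_len v.
Proof.
move=> /connectP[p + ->] {v}; elim: p u => [|x p IH] u /=; first by left.
move=> /andP[/andP[_ lt] /IH[<-|lt']]; right=> //; apply: ltn_trans lt lt'.
Qed.

Lemma bruhat_le_trans v u w : bruhat_le u v -> bruhat_le v w -> bruhat_le u w.
Proof. exact: connect_trans. Qed.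

Lemma bruhat_anti u v : bruhat_le u v -> bruhat_le v u -> u = v.
Proof. by move=> /bruhat_len[//|lt] /bruhat_len[//|lt']; have := ltn_trans lt lt'; rewrite ltnn. Qed.

Lemma bruhat_raise v i j : i < j -> v i < v j -> bruhat_le v (tperm i j * v)%g.
Proof.
move=> ij vij; apply: connect1; rewrite (perm_len_raise ij vij) andbT.
apply/existsP; exists (v i); apply/existsP; exists (v j); apply/eqP.
by rewrite -tpermJ /conjg !mulgA mulgV mul1g.
Qed.

Lemma perm_len_bound w : perm_len w <= n * n.
Proof. by rewrite /perm_len; apply: leq_trans (max_card _) _; rewrite card_prod !card_ord. Qed.

(** Inverting two positions with equal entries raises a sorting permutation in
    Bruhat order and keeps it sorting; only [rkp a] has no such pair left. *)
Lemma bruhat_rkp a w : sorting a w -> bruhat_le w (rkp a).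
Proof.
move: {2}(n * n - perm_len w) (leqnn (n * n - perm_len w)) => m.
elim: m w => [|m IH] w lem sw;
  (have [/existsP[i /existsP[j /and3P[ij /eqP aij wij]]]|nex] :=
     boolP [exists i : 'I_n, exists j : 'I_n, [&& i < j, a i == a j & w i < w j]];
  last by rewrite (top_sorting_rkp sw) ?/bruhat_le ?connect0 // => i j ij aij;
    move: nex; rewrite negb_exists => /forallP/(_ i);
    rewrite negb_exists => /forallP/(_ j); rewrite ij aij eqxx /=;
    rewrite -leqNgt leq_eqVlt => /orP[/eqP/ord_inj/perm_inj e|//];
    rewrite e ltnn in ij).
  have := perm_len_raise ij wij; have := perm_len_bound w.
  have := perm_len_bound (tperm i j * w)%g; lia.
apply: bruhat_le_trans (bruhat_raise ij wij) _; apply: IH.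
  by have := perm_len_raise ij wij; have := perm_len_bound w; lia.
move=> x y lxy; rewrite !permM; apply: sw.
by case: tpermP => [ex|ex|_ _]; case: tpermP => [ey|ey|_ _]; subst; rewrite ?aij; move: lxy; lia.
Qed.

Lemma walphaE a : walpha a = rkp a.
Proof.
rewrite /walpha; case: pickP => [w|/(_ (rkp a))].
  move=> /andP[/sortingP sw /forallP/(_ (rkp a))].
  have /sortingP sr := @sorting_rkp a; rewrite sr /= => le.
  by apply: bruhat_anti le; apply: bruhat_rkp.
have /sortingP sr := @sorting_rkp a; rewrite sr /=.
by move=> /forallP[] v; apply/implyP => /sortingP/bruhat_rkp.
Qed.

(** ** Dominance *)

(** For a decreasing sequence the bound is attained when [h] is the [k]-th
    entry. Hence dominance can be checked on the sums of the truncated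
    differences x - h, for which no sorting is needed. *)
Lemma sumn_take_le (s : seq nat) (k h : nat) :
  sumn (take k s) <= k * h + \sum_(x <- s) (x - h).
Proof.
elim: s k => [|x s IH] [|k] //=; rewrite big_cons; have := IH k; nia.
Qed.

Lemma sumn_take_eq (s : seq nat) (k : nat) : sorted geq s ->
  sumn (take k s) = k * nth 0 s k + \sum_(x <- s) (x - nth 0 s k).
Proof.
elim: s k => [|x s IH] k /=; first by rewrite big_nil nth_nil muln0.
move=> ps; have ss := path_sorted ps.
have /allP alls := order_path_min (fun p q t (pq : geq q p) (qt : geq p t) => leq_trans qt pq) ps.
case: k => [|k] /=; rewrite big_cons.
  rewrite subnn big_seq big1 // => y /alls /=; rewrite /geq /=; lia.
rewrite (IH k ss); have : nth 0 s k <= x.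
  have [lt|ge] := ltnP k (size s); last by rewrite nth_default.
  by apply: alls; rewrite mem_nth.
lia.
Qed.

Lemma apart_sorted a : sorted geq (apart a).
Proof. by apply: sort_sorted => x y; rewrite /geq /= leq_total. Qed.

Lemma apart_size a : size (apart a) = n.
Proof. by rewrite size_sort size_codom card_ord. Qed.

Lemma sum_apart (F : nat -> nat) a : \sum_(x <- apart a) F x = \sum_i F (a i).
Proof.
rewrite (perm_big (codom a)) /=; last by rewrite perm_sort.
by rewrite /codom big_map big_enum.
Qed.

Lemma perm_codom_act w a : perm_eq (codom (expo_act w a)) (codom a).
Proof.
have -> : codom (expo_act w a) = map a (map (w^-1)%g (enum 'I_n)).
  by rewrite -[RHS]map_comp; apply: eq_map => i; rewrite ffunE.
apply: perm_map; apply: uniq_perm; first by rewrite map_inj_uniq ?enum_uniq //; apply: perm_inj.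
  exact: enum_uniq.
by move=> i; rewrite mem_enum; apply/mapP; exists (w i); rewrite ?mem_enum ?permK.
Qed.

Lemma apart_act w a : apart (expo_act w a) = apart a.
Proof.
apply/perm_sortP; last exact: perm_codom_act.
- by move=> x y; rewrite /geq /= leq_total.
- by move=> x y z; rewrite /geq /= => h1 h2; apply: leq_trans h2 h1.
- by move=> x y; rewrite /geq /= andbC => /anti_leq.
Qed.

Lemma dominance_convex a b :
  (forall h, \sum_i (b i - h) <= \sum_i (a i - h)) -> dominance_le (apart b) (apart a).
Proof.
move=> le k; rewrite (sumn_take_eq k (apart_sorted a)).
apply: leq_trans (sumn_take_le _ _ (nth 0 (apart a) k)) _.
by rewrite leq_add2l (sum_apart (subn^~ _)) (sum_apart (subn^~ _)).
Qed.

Lemma sumn_take_inj (s t : seq nat) : size s = size t ->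
  (forall k : nat, sumn (take k s) = sumn (take k t)) -> s = t.
Proof.
elim: s t => [|x s IH] [|y t] //= [ss] e.
have exy : x = y by have := e 1; rewrite /= !take0 /=; lia.
by rewrite exy (IH t ss) // => k; have := e k.+1; rewrite /= exy; lia.
Qed.

Definition prefix_sums a := \sum_(k < n.+1) sumn (take k (apart a)).

Lemma prefix_sums_lt a b : apart b <> apart a -> dominance_le (apart b) (apart a) ->
  prefix_sums b < prefix_sums a.
Proof.
move=> ne dom; rewrite ltn_neqAle leq_sum ?andbT //; apply: contra_notN ne => /eqP eS.
apply: sumn_take_inj; first by rewrite !apart_size.
have eqk (k : 'I_n.+1) : sumn (take k (apart b)) = sumn (take k (apart a)).
  apply/eqP; rewrite eqn_leq dom /= leqNgt; apply/negP => lt.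
  have : prefix_sums b < prefix_sums a; last by rewrite eS ltnn.
  rewrite /prefix_sums (bigD1 k) //= [X in _ < X](bigD1 k) //=.
  by rewrite -addSn leq_add ?leq_sum.
move=> k; have [lek|ltk] := leqP k n; first by have := eqk (Ordinal (lek : k < n.+1)).
rewrite !take_oversize ?apart_size; try lia.
by have := eqk ord_max; rewrite /= !take_oversize ?apart_size.
Qed.

(** A measure that increases along [expo_lt]: a larger partition has larger
    prefix sums, and for equal partitions the Bruhat order increases the
    length, which is at most n * n. *)
Definition expo_height a := prefix_sums a * (n * n).+1 + perm_len (walpha a).

Lemma expo_height_lt a b : expo_lt b a -> expo_height b < expo_height a.
Proof.
rewrite /expo_height => -[_ [[ne dom]|[eab ne /bruhat_len[//|lt]]]].
  have := prefix_sums_lt ne dom; have := perm_len_bound (walpha b).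
  by move: (prefix_sums a) (prefix_sums b) => x y; nia.
by rewrite /prefix_sums eab ltn_add2l.
Qed.

Lemma expo_lt_irr a : ~ expo_lt a a.
Proof. by move=> /expo_height_lt; rewrite ltnn. Qed.

Lemma expo_lt_sum a b : expo_lt b a -> expo_sum b = expo_sum a.
Proof. by case. Qed.

Lemma expo_lt_trans b a c : expo_lt c b -> expo_lt b a -> expo_lt c a.
Proof.
move=> [s1 H1] [s2 H2]; split; first by rewrite s1.
have dom_trans (p q s : seq nat) : dominance_le p q -> dominance_le q s -> dominance_le p s.
  by move=> h1 h2 k; apply: leq_trans (h1 k) (h2 k).
have bruhat_ne u v w : bruhat_le u v -> bruhat_le v w -> v <> w -> u <> w.
  by move=> le1 le2 ne e; rewrite e in le1; apply: ne; apply: bruhat_anti.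
case: H1 H2 => [[n1 d1]|[e1 n1 b1]] [[n2 d2]|[e2 n2 b2]].
- left; split; last exact: dom_trans d1 d2.
  move=> e; have := prefix_sums_lt n1 d1; have := prefix_sums_lt n2 d2.
  by rewrite /prefix_sums e; lia.
- by left; rewrite -e2.
- by left; rewrite e1.
- right; split; [by rewrite e1 | exact: bruhat_ne b1 b2 n2 | exact: bruhat_le_trans b1 b2].
Qed.

Definition swap i j a : expo := [ffun k => a (tperm i j k)].

Lemma swap_act i j a : swap i j a = expo_act (tperm i j) a.
Proof. by apply/ffunP => k; rewrite !ffunE tpermV. Qed.

Lemma swapK i j : involutive (swap i j).
Proof. by move=> a; apply/ffunP => k; rewrite !ffunE tpermK. Qed.

Lemma expo_sum_act w a : expo_sum (expo_act w a) = expo_sum a.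
Proof.
rewrite /expo_sum (reindex_inj (@perm_inj _ w)) /=.
by apply: eq_bigr => i _; rewrite ffunE permK.
Qed.

Lemma expo_lt_swap i j a : i < j -> a j < a i -> expo_lt (swap i j a) a.
Proof.
move=> ij aij; split; first by rewrite swap_act expo_sum_act.
right; set b := swap i j a.
have up : rkp b i < rkp b j by rewrite !rkpE rk_ltE /before !ffunE tpermL tpermR aij.
have le1 := bruhat_raise ij up; have lt1 := perm_len_raise ij up.
have le2 : bruhat_le (tperm i j * rkp b)%g (rkp a).
  apply: bruhat_rkp => x y lxy; rewrite !permM; apply: sorting_rkp.
  by rewrite !ffunE !tpermK.
split.
- by rewrite /b swap_act apart_act.
- by rewrite !walphaE => e; have := bruhat_len le2; rewrite -e => -[e'|]; first (by rewrite e' ltnn in lt1); lia.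
- by rewrite !walphaE; apply: bruhat_le_trans le1 le2.
Qed.

Lemma sum_pair (F : 'I_n -> nat) i j : i != j ->
  \sum_k F k = F i + F j + \sum_(k | (k != i) && (k != j)) F k.
Proof.
move=> ij; rewrite (bigD1 i) //= (bigD1 j) /=; last by rewrite eq_sym.
by rewrite addnA.
Qed.

(** Moving weight between two entries so that both stay below the larger one
    flattens the exponent; it does so strictly, as the sum of the squares
    drops. *)
Lemma expo_lt_transfer i j a b : i != j -> (forall k, k != i -> k != j -> b k = a k) ->
  b i + b j = a i + a j -> b i < maxn (a i) (a j) -> b j < maxn (a i) (a j) ->
  expo_lt b a.
Proof.
move=> ij eqk es bi bj.
have sumF (F : nat -> nat) (c : expo) : \sum_k F (c k) = F (c i) + F (c j) + \sum_(k | (k != i) && (k != j)) F (c k).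
  exact: sum_pair ij.
have eF F : \sum_(k | (k != i) && (k != j)) F (b k) = \sum_(k | (k != i) && (k != j)) F (a k).
  by apply: eq_bigr => k /andP[ki kj]; rewrite eqk.
split; first by have := sumF id a; have := sumF id b; rewrite (eF id) es /expo_sum => -> ->.
left; split.
  pose sq x := x ^ 2 => e.
  have : \sum_(x <- apart b) sq x = \sum_(x <- apart a) sq x by rewrite e.
  rewrite !(sum_apart sq) !(sumF sq) (eF sq) /sq.
  move: es bi bj; move: (a i) (a j) (b i) (b j) => p q x y; rewrite !expnS !expn0; nia.
apply: dominance_convex => h; pose sb x := x - h.
have := sumF sb a; have := sumF sb b; rewrite (eF sb) /sb => -> ->.
rewrite leq_add2r; lia.
Qed.

End ExpoOrder.

(** * Monomials and linear maps *)

Section Monomials.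
Variables (K : numFieldType) (n : nat).
Local Notation expo := {ffun 'I_n -> nat}.
Local Notation P := {mpoly K[n]}.
Implicit Types (a b : expo) (i j k : 'I_n) (f g : P).

Definition mn a : 'X_{1..n} := [multinom a i | i < n].
Definition ex (m : 'X_{1..n}) : expo := [ffun i => m i].
Definition Xm a : P := 'X_[mn a].
Definition cf a f : K := f@_(mn a).

Lemma mnK : cancel mn ex.
Proof. by move=> a; apply/ffunP => i; rewrite ffunE mnmE. Qed.

Lemma exK : cancel ex mn.
Proof. by move=> m; apply/mnmP => i; rewrite mnmE ffunE. Qed.

Lemma cf_is_linear a : linear_for *%R (cf a).
Proof. by move=> c f g; rewrite /cf mcoeffD mcoeffZ. Qed.
HB.instance Definition _ a := @GRing.isLinear.Build K P K *%R (cf a) (cf_is_linear a).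

Lemma cfX a b : cf b (Xm a) = (a == b)%:R.
Proof. by rewrite /cf mcoeffX (can_eq mnK). Qed.

Lemma cfX_neq0 a b : cf b (Xm a) != 0 -> a = b.
Proof. by rewrite cfX; have [->|_] := eqVneq a b; rewrite ?eqxx. Qed.

Lemma cfP f g : (forall a, cf a f = cf a g) <-> f = g.
Proof. by split=> [h|->//]; apply/mpolyP => m; have := h (ex m); rewrite /cf exK. Qed.

Lemma mdeg_mn a : mdeg (mn a) = expo_sum a.
Proof. by rewrite mdegE; apply: eq_bigr => i _; rewrite mnmE. Qed.

Lemma expo_sum_ex m : expo_sum (ex m) = mdeg m.
Proof. by rewrite -mdeg_mn exK. Qed.

Lemma Xm_zero : Xm [ffun=> 0%N] = 1.
Proof. by rewrite -mpolyX0 /Xm; congr 'X_[_]; apply/mnmP => k; rewrite mnm0E mnmE ffunE. Qed.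

Definition lin (V : lmodType K) (F : expo -> V) f : V :=
  locked (\sum_(m <- msupp f) f@_m *: F (ex m)).

Lemma lin_widen (V : lmodType K) (F : expo -> V) f (k : nat) : (msize f <= k)%N ->
  lin F f = \sum_(m : 'X_{1..n < k}) f@_m *: F (ex m).
Proof.
move=> lek; rewrite -(big_map (fun m : 'X_{1..n < k} => val m) predT (fun m => f@_m *: F (ex m))).
rewrite /lin -lock [RHS](bigID (mem (msupp f))) /= [X in _ + X]big1 ?addr0; last first.
  by move=> m /memN_msupp_eq0 ->; rewrite scale0r.
rewrite -[RHS]big_filter; apply: perm_big; apply: uniq_perm; rewrite ?msupp_uniq //.
  by rewrite filter_uniq // map_inj_uniq ?index_enum_uniq //; apply: val_inj.
move=> m; rewrite mem_filter; case: (boolP (m \in msupp f)) => //= mf.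
have lt : (mdeg m < k)%N by apply: leq_trans (msize_mdeg_lt mf) lek.
by apply/esym/mapP; exists (BMultinom lt); rewrite ?mem_index_enum.
Qed.

Lemma lin_is_linear (V : lmodType K) (F : expo -> V) : linear (lin F).
Proof.
move=> c f g; pose k := maxn (msize (c *: f + g)) (maxn (msize f) (msize g)).
rewrite !(@lin_widen V F _ k); [|by rewrite /k; lia..].
rewrite scaler_sumr -big_split; apply: eq_bigr => m _ /=.
by rewrite mcoeffD mcoeffZ scalerDl scalerA.
Qed.
HB.instance Definition _ (V : lmodType K) (F : expo -> V) :=
  @GRing.isLinear.Build K P V *:%R (lin F) (lin_is_linear F).

Lemma linX (V : lmodType K) (F : expo -> V) a : lin F (Xm a) = F a.
Proof. by rewrite /lin -lock msuppX big_seq1 mcoeffX eqxx scale1r mnK. Qed.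

Lemma lin_id f : lin Xm f = f.
Proof. by rewrite /lin -lock {3}(mpolyE f); apply: eq_bigr => m _; rewrite /Xm exK. Qed.

Lemma mpoly_span_ind (Q : P -> Prop) : Q 0 ->
  (forall c f g, Q f -> Q g -> Q (c *: f + g)) -> (forall a, Q (Xm a)) ->
  forall f, Q f.
Proof.
move=> Q0 QD QX f; rewrite -(lin_id f) /lin -lock; elim: (msupp f) => [|m s IH].
  by rewrite big_nil.
by rewrite big_cons; apply: QD.
Qed.

Definition inc i a : expo := [ffun k => if k == i then (a k).+1 else a k].
Definition dec i a : expo := [ffun k => if k == i then (a k).-1 else a k].
Definition upd a i j p q : expo :=
  [ffun k => if k == i then p else if k == j then q else a k].

Lemma mulXX i a : 'X_i * Xm a = Xm (inc i a).
Proof.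
rewrite /Xm -mpolyXD; congr 'X_[_]; apply/mnmP => k.
by rewrite mnmDE mnm1E !mnmE ffunE eq_sym; case: eqVneq.
Qed.

Lemma incdec i a : (0 < a i)%N -> inc i (dec i a) = a.
Proof. by move=> h; apply/ffunP => k; rewrite !ffunE; case: eqVneq => // ->; rewrite prednK. Qed.

Lemma decinc i a : dec i (inc i a) = a.
Proof. by apply/ffunP => k; rewrite !ffunE; case: eqVneq => // ->. Qed.

Lemma decincC i k a : i != k -> dec i (inc k a) = inc k (dec i a).
Proof.
by move=> ik; apply/ffunP => x; rewrite !ffunE; case: eqVneq => // ->; rewrite (negPf ik).
Qed.

Lemma upd_swap i j a : i != j -> upd a i j (a j) (a i) = swap i j a.
Proof.
move=> ij; apply/ffunP => k; rewrite !ffunE; case: tpermP => [->|->|/eqP ki /eqP kj].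
- by rewrite eqxx.
- by rewrite eq_sym (negPf ij) eqxx.
- by rewrite (negPf ki) (negPf kj).
Qed.

Lemma upd_id i j a : upd a i j (a i) (a j) = a.
Proof. by apply/ffunP => k; rewrite !ffunE; case: eqVneq => [->//|_]; case: eqVneq => [->|]. Qed.

(** The substitution x_i -> la_i x_i multiplies x^a by this factor. *)
Definition chi (la : 'I_n -> K) a : K := \prod_k la k ^+ a k.

Lemma chi_inc la i a : chi la (inc i a) = la i * chi la a.
Proof.
rewrite /chi (bigD1 i) //= [in RHS](bigD1 i) //= ffunE eqxx exprS -mulrA.
congr (_ * (_ * _)); apply: eq_bigr => k ki; by rewrite ffunE (negPf ki).
Qed.

Lemma chi_upd la i j a p q : i != j ->
  chi la (upd a i j p q) * (la i ^+ a i * la j ^+ a j) = chi la a * (la i ^+ p * la j ^+ q).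
Proof.
move=> ij; rewrite /chi !(bigD1 i (P := predT)) //= !(bigD1 j (P := fun k => k != i)) /=; last first.
- by rewrite eq_sym.
- by rewrite eq_sym.
rewrite !ffunE eqxx eq_sym (negPf ij) eqxx.
rewrite (eq_bigr (fun k => la k ^+ a k)); last first.
  by move=> k /andP[ki kj]; rewrite ffunE (negPf ki) (negPf kj).
by ring.
Qed.

Lemma permV_eq (w : 'S_n) i k : ((w^-1)%g k == i) = (k == w i).
Proof. by rewrite -(inj_eq (@perm_inj _ w)) permKV. Qed.

Lemma upd_act w i j a p q :
  expo_act w (upd a i j p q) = upd (expo_act w a) (w i) (w j) p q.
Proof.
by apply/ffunP => k; rewrite !ffunE !permV_eq.
Qed.

Lemma inc_act w i a : expo_act w (inc i a) = inc (w i) (expo_act w a).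
Proof.
by apply/ffunP => k; rewrite !ffunE permV_eq.
Qed.

Lemma dec_act w i a : expo_act w (dec i a) = dec (w i) (expo_act w a).
Proof.
by apply/ffunP => k; rewrite !ffunE permV_eq.
Qed.

Lemma swap_expo_act w i j a :
  expo_act w (swap i j a) = swap (w i) (w j) (expo_act w a).
Proof.
apply/ffunP => k; rewrite !ffunE; congr (a _); apply: (@perm_inj _ w).
by rewrite permKV -[X in _ = tperm _ _ X](permKV w) -tpermJ permJ.
Qed.

Lemma act_val w i a : expo_act w a (w i) = a i.
Proof. by rewrite ffunE permK. Qed.

Definition subspace (U : P -> Prop) :=
  U 0 /\ forall c f g, U f -> U g -> U (c *: f + g).

Section Subspace.
Variable U : P -> Prop.
Hypothesis subU : subspace U.

Lemma sp_scale c f : U f -> U (c *: f).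
Proof. by move=> Uf; rewrite -[_ *: _]addr0; apply: subU.2 Uf subU.1. Qed.

Lemma sp_add f g : U f -> U g -> U (f + g).
Proof. by move=> Uf Ug; rewrite -[f]scale1r; apply: subU.2. Qed.

Lemma sp_sum (I : Type) (s : seq I) (Q : pred I) (A : I -> P) :
  (forall x, Q x -> U (A x)) -> U (\sum_(x <- s | Q x) A x).
Proof.
move=> UA; elim: s => [|x s IH]; first by rewrite big_nil; apply: subU.1.
by rewrite big_cons; case: ifP => // Qx; apply: sp_add => //; apply: UA.
Qed.

Lemma sp_one : (forall i f, U f -> U ('X_i * f)) -> U 1 -> forall f, U f.
Proof.
move=> UX U1 f; rewrite -(lin_id f) /lin -lock; apply: sp_sum => m _; apply: sp_scale.
rewrite /Xm exK mpolyXE_id; elim: (index_enum _) => [|i s IH]; first by rewrite big_nil.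
rewrite big_cons; elim: (m i) => [|k IHk]; first by rewrite expr0 mul1r.
by rewrite exprS -mulrA; apply: UX.
Qed.

End Subspace.

Lemma mpoly_mulX_ind (U : P -> Prop) : U 1 ->
  (forall c f g, U f -> U g -> U (c *: f + g)) ->
  (forall i f, U f -> U ('X_i * f)) -> forall f, U f.
Proof.
move=> U1 Ul UX; apply: sp_one => //; split=> //.
by have := Ul (-1) 1 1 U1 U1; rewrite scaleN1r addNr.
Qed.

End Monomials.

(** * Dunkl operators in coordinates *)

Section Dunkl_operators.
Variables (K : numFieldType) (n r : nat) (c0 : K) (d : int -> K).
Local Notation expo := {ffun 'I_n -> nat}.
Local Notation P := {mpoly K[n]}.
Implicit Types (a b : expo) (i j k : 'I_n) (f g : P) (w : 'S_n).
Local Notation Xm := (@Xm K n).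

(** The sum over [l] of the divided differences of x^a along the hyperplanes
    x_i = zeta^l x_j, divided by r: each of them is a geometric sum, and
    summing over [l] keeps the terms with [q] congruent to a_j modulo r. *)
Definition Tmon i j a : P :=
  \sum_(0 <= q < a i + a j | q == a j %[mod r])
    ((q < a i)%N%:R - (q < a j)%N%:R) *: Xm (upd a i j ((a i + a j).-1 - q) q).

Definition ycoef a i : K := (a i)%:R - d 0 + d (- (a i)%:Z).

(** The Dunkl operator y_i of G(r,1,n). *)
Definition Ymon i a : P :=
  ycoef a i *: Xm (dec i a) - (c0 * r%:R) *: \sum_(j | j != i) Tmon i j a.

(** The sum over [l] of the reflections zeta_i^l s_ij zeta_i^-l. *)
Definition Smon i j a : P :=
  (if a i == a j %[mod r] then r%:R else 0) *: Xm (swap i j a).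

(** The same sum, weighted by zeta^-l. *)
Definition Wmon i k a : P :=
  (if a i == (a k).+1 %[mod r] then r%:R else 0) *: Xm (swap i k a).

(** The sum over [j] of the (d_j - d_(j-1)) e_ij. *)
Definition Dmon i a : P := (d (- (a i)%:Z) - d (- (a i).+1%:Z)) *: Xm a.

Definition Y i : P -> P := lin (Ymon i).
Definition S i j : P -> P := lin (Smon i j).
Definition W i k : P -> P := lin (Wmon i k).
Definition Dg i : P -> P := lin (Dmon i).
Definition mono w (la : 'I_n -> K) : P -> P :=
  lin (fun a => chi la a *: Xm (expo_act w a)).
Definition pm w : P -> P := lin (fun a => Xm (expo_act w a)).

HB.instance Definition _ i := GRing.Linear.copy (Y i) (lin (Ymon i)).
HB.instance Definition _ i j := GRing.Linear.copy (S i j) (lin (Smon i j)).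
HB.instance Definition _ i j := GRing.Linear.copy (W i j) (lin (Wmon i j)).
HB.instance Definition _ i := GRing.Linear.copy (Dg i) (lin (Dmon i)).
HB.instance Definition _ w la := GRing.Linear.copy (mono w la)
  (lin (fun a => chi la a *: Xm (expo_act w a))).
HB.instance Definition _ w := GRing.Linear.copy (pm w)
  (lin (fun a => Xm (expo_act w a))).

Lemma YX i a : Y i (Xm a) = Ymon i a. Proof. exact: linX. Qed.
Lemma SX i j a : S i j (Xm a) = Smon i j a. Proof. exact: linX. Qed.
Lemma WX i j a : W i j (Xm a) = Wmon i j a. Proof. exact: linX. Qed.
Lemma DgX i a : Dg i (Xm a) = Dmon i a. Proof. exact: linX. Qed.
Lemma pmX w a : pm w (Xm a) = Xm (expo_act w a). Proof. exact: linX. Qed.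
Lemma monoX w la a : mono w la (Xm a) = chi la a *: Xm (expo_act w a).
Proof. exact: linX. Qed.

Lemma Tmon_widen i j a (N : nat) : (a i + a j <= N)%N ->
  Tmon i j a = \sum_(0 <= q < N | q == a j %[mod r])
    ((q < a i)%N%:R - (q < a j)%N%:R) *: Xm (upd a i j ((a i + a j).-1 - q) q).
Proof.
move=> le; rewrite /Tmon [RHS](@big_cat_nat _ _ _ (a i + a j)%N) //=.
rewrite [X in _ + X]big_nat_cond [X in _ + X]big1 ?addr0 // => q /andP[/andP[h _] _].
have -> : (q < a i)%N = false by lia.
have -> : (q < a j)%N = false by lia.
by rewrite subr0 scale0r.
Qed.

Lemma Tmon_inc_far i j k a : k != i -> k != j -> Tmon i j (inc k a) = 'X_k * Tmon i j a.
Proof.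
move=> ki kj; rewrite /Tmon mulr_sumr !ffunE eq_sym (negPf ki) eq_sym (negPf kj).
apply: eq_bigr => q _; rewrite -scalerAr mulXX; congr (_ *: Xm _).
apply/ffunP => x; rewrite !ffunE; have [->|xi] := eqVneq x i.
  by rewrite eq_sym (negPf ki).
by have [->|//] := eqVneq x j; rewrite eq_sym (negPf kj).
Qed.

(** A Leibniz rule: raising a_i adds the term with q = a_i, which is the
    reflected monomial. *)
Lemma Tmon_incl i j a : i != j -> Tmon i j (inc i a) =
  'X_i * Tmon i j a + (if a i == a j %[mod r] then 1 else 0) *: Xm (swap i j a).
Proof.
move=> ij; pose N := (a i + a j).+1.
rewrite (Tmon_widen (N := N)); last by rewrite !ffunE eqxx eq_sym (negPf ij).
rewrite (Tmon_widen (i := i) (a := a) (N := N)) ?leqnSn //.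
rewrite mulr_sumr !ffunE eqxx eq_sym (negPf ij).
have -> : (if a i == a j %[mod r] then 1 else 0) *: Xm (swap i j a) =
    \sum_(0 <= q < N | q == a j %[mod r]) (q == a i)%:R *: Xm (upd a i j (a i + a j - q) q).
  rewrite big_mkcond (bigD1_seq (a i)) ?mem_index_iota ?iota_uniq //=; last by rewrite /N; lia.
  rewrite eqxx scale1r [X in _ = _ + X]big1 ?addr0; last first.
    by move=> q /negPf ->; rewrite scale0r if_same.
  by rewrite addnC addnK upd_swap //; case: ifP; rewrite ?scale1r ?scale0r.
rewrite -big_split /= big_nat_cond [RHS]big_nat_cond; apply: eq_bigr => q /andP[/andP[_ qN] _].
rewrite -scalerAr mulXX; have [lt|ge] := ltnP q (a i + a j).
  have -> : inc i (upd a i j ((a i + a j).-1 - q) q) = upd a i j (a i + a j - q) q.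
    by apply/ffunP => x; rewrite !ffunE; case: eqVneq => // _; lia.
  have -> : upd (inc i a) i j (((a i).+1 + a j).-1 - q) q = upd a i j (a i + a j - q) q.
    by apply/ffunP => x; rewrite !ffunE addSn /=; case: eqVneq.
  rewrite -scalerDl ltnS leq_eqVlt; congr (_ *: _).
  have [->|ne] := eqVneq q (a i); rewrite ?ltnn /=; ring.
have eq : q = (a i + a j)%N by rewrite /N in qN; lia.
have -> : (q < a i)%N = false by lia.
have -> : (q < a j)%N = false by lia.
have -> : upd (inc i a) i j (((a i).+1 + a j).-1 - q) q = upd a i j (a i + a j - q) q.
  by apply/ffunP => x; rewrite !ffunE addSn /=; case: eqVneq.
rewrite !subr0 scale0r add0r; congr (_%:R *: _).
by rewrite ltnS eqn_leq; lia.
Qed.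

(** Multiplication by x_j shifts the summation index by one; the two sums then
    differ in the term with q = a_i. *)
Lemma Tmon_incr i j a : i != j -> Tmon i j (inc j a) =
  'X_j * Tmon i j a - (if a i == (a j).+1 %[mod r] then 1 else 0) *: Xm (swap i j a).
Proof.
move=> ij; pose N := (a i + a j).+1; have ji : (j == i) = false by rewrite eq_sym (negPf ij).
rewrite (Tmon_widen (N := N)); last by rewrite !ffunE eqxx (negPf ij) addnS.
rewrite mulr_sumr !ffunE eqxx (negPf ij) addnS /=.
have -> : (if a i == (a j).+1 %[mod r] then 1 else 0) *: Xm (swap i j a) =
    \sum_(0 <= q < N | q == (a j).+1 %[mod r]) (q == a i)%:R *: Xm (upd a i j (a i + a j - q) q).
  rewrite big_mkcond (bigD1_seq (a i)) ?mem_index_iota ?iota_uniq //=; last by rewrite /N; lia.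
  rewrite eqxx scale1r [X in _ = _ + X]big1 ?addr0; last first.
    by move=> q /negPf ->; rewrite scale0r if_same.
  by rewrite addnC addnK upd_swap //; case: ifP; rewrite ?scale1r ?scale0r.
have -> : \sum_(0 <= q < a i + a j | q == a j %[mod r])
    'X_j * (((q < a i)%N%:R - (q < a j)%N%:R) *: Xm (upd a i j ((a i + a j).-1 - q) q)) =
  \sum_(0 <= q < N | q == (a j).+1 %[mod r])
    ((q <= a i)%N%:R - (q <= a j)%N%:R) *: Xm (upd a i j (a i + a j - q) q).
  rewrite [RHS]big_mkcond /N big_nat_recl //= subrr scale0r if_same add0r.
  rewrite big_mkcond big_nat_cond [RHS]big_nat_cond; apply: eq_bigr => q /andP[/andP[_ qN] _].
  rewrite -(eqn_modDr 1 q) !addn1; case: ifP => // _; rewrite -scalerAr mulXX.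
  congr (_ *: Xm _); apply/ffunP => x; rewrite !ffunE.
  by have [->|xi] := eqVneq x i; [rewrite (negPf ij); lia|case: eqVneq].
rewrite -sumrB; apply: eq_bigr => q _.
rewrite -scalerBl; congr (_ *: Xm _); last first.
  by apply/ffunP => x; rewrite !ffunE; case: eqVneq => // _; case: eqVneq.
rewrite !ltnS [in RHS]leq_eqVlt.
have [->|ne] := eqVneq q (a i); rewrite ?ltnn /=; ring.
Qed.

(** Together with the vanishing on 1, the commutators with the variables
    determine the operator. *)
Lemma Y_mulX i k f : k != i ->
  Y i ('X_k * f) = 'X_k * Y i f + c0 *: W i k f.
Proof.
move=> ki; elim/mpoly_span_ind: f => [|c f g IHf IHg|a].
- by rewrite mulr0 !linear0 ?mulr0 ?scaler0 ?addr0.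
- by rewrite mulrDr -scalerAr !linearP /= IHf IHg -!mul_mpolyC; ring.
have ik : i != k by rewrite eq_sym.
rewrite mulXX !YX WX /Wmon /Ymon mulrBr -!scalerAr mulXX decincC //.
have -> : ycoef (inc k a) i = ycoef a i by rewrite /ycoef ffunE (negPf ik).
rewrite -addrA; congr (_ + _); rewrite (bigD1 k ki) /= [in RHS](bigD1 k ki) /=.
rewrite Tmon_incr // mulrDr.
rewrite (eq_bigr (fun j => 'X_k * Tmon i j a)); last first.
  by move=> j /andP[ji jk]; rewrite Tmon_inc_far // eq_sym.
rewrite -mulr_sumr !scalerDr !opprD scalerN opprK addrAC; congr (_ + _).
by rewrite !scalerA; congr (_ *: _); case: ifP => _; rewrite ?mulr1 ?mulr0.
Qed.

Lemma Y_mulXx i f : Y i ('X_i * f) =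
  'X_i * Y i f + f - Dg i f - c0 *: \sum_(j | j != i) S i j f.
Proof.
elim/mpoly_span_ind: f => [|c f g IHf IHg|a].
- by rewrite mulr0 !linear0 mulr0 big1 ?scaler0 ?addr0 ?subr0 // => j _; rewrite linear0.
- rewrite (eq_bigr (fun j => c *: S i j f + S i j g)) => [|j _]; last by rewrite linearP.
  rewrite big_split -scaler_sumr /= mulrDr -scalerAr !linearP /= IHf IHg.
  by rewrite -!mul_mpolyC; ring.
rewrite mulXX !YX DgX /Ymon /Dmon /ycoef mulrBr -!scalerAr mulXX decinc !ffunE eqxx.
rewrite (eq_bigr (fun j => 'X_i * Tmon i j a +
   (if a i == a j %[mod r] then 1 else 0) *: Xm (swap i j a))); last first.
  by move=> j ji; rewrite Tmon_incl 1?eq_sym.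
rewrite big_split /= -mulr_sumr scalerDr opprD.
have -> : (c0 * r%:R) *: (\sum_(j | j != i)
     (if a i == a j %[mod r] then 1 else 0) *: Xm (swap i j a)) =
   c0 *: \sum_(j | j != i) S i j (Xm a).
  rewrite -scalerA scaler_sumr; congr (_ *: _); apply: eq_bigr => j _.
  by rewrite SX /Smon scalerA; congr (_ *: _); case: ifP; rewrite ?mulr1 ?mulr0.
have -> : ((a i)%:R - d 0 + d (- (a i)%:Z)) *: Xm (inc i (dec i a)) =
   ((a i)%:R - d 0 + d (- (a i)%:Z)) *: Xm a.
  have [e|h] := posnP (a i); last by rewrite incdec.
  by rewrite e oppr0 add0r addNr !scale0r.
have -> : ((a i).+1%:R - d 0 + d (- (a i).+1%:Z)) *: Xm a =
  ((a i)%:R - d 0 + d (- (a i)%:Z)) *: Xm a + Xm a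
   - (d (- (a i)%:Z) - d (- (a i).+1%:Z)) *: Xm a.
  rewrite -{3}[Xm a]scale1r -scalerDl -scalerBl; congr (_ *: _).
  by rewrite -natr1; ring.
by rewrite -!mul_mpolyC; ring.
Qed.

(** ** Equivariance *)

Lemma mono_mulX w la i f : mono w la ('X_i * f) = la i *: ('X_(w i) * mono w la f).
Proof.
elim/mpoly_span_ind: f => [|c f g IHf IHg|a].
- by rewrite mulr0 !linear0 ?mulr0 ?scaler0.
- by rewrite mulrDr -scalerAr !linearP /= IHf IHg -!mul_mpolyC; ring.
by rewrite mulXX !monoX chi_inc -scalerAr mulXX inc_act scalerA.
Qed.

Lemma pm_mono w : pm w =1 mono w (fun _ => 1).
Proof.
move=> f; elim/mpoly_span_ind: f => [|c f g IHf IHg|a]; rewrite ?linear0 //.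
  by rewrite !linearP /= IHf IHg.
by rewrite pmX monoX /chi big1 ?scale1r // => k _; rewrite expr1n.
Qed.

Lemma mono_Tmon w la i j a : (0 < r)%N -> (forall k, la k ^+ r = 1) -> i != j ->
  mono w la (Tmon i j a) =
  (chi la a * (la i)^-1) *: Tmon (w i) (w j) (expo_act w a).
Proof.
move=> r0 la1 ij.
have nz k : la k != 0 by apply/eqP => e; move/eqP: (la1 k); rewrite e expr0n gtn_eqF // eq_sym oner_eq0.
rewrite /Tmon linear_sum scaler_sumr !act_val big_nat_cond [RHS]big_nat_cond.
apply: eq_bigr => q /andP[/andP[_ qN] /eqP qj].
rewrite linearZ /= monoX upd_act !scalerA; congr (_ *: _).
rewrite [RHS]mulrC; congr (_ * _).
have e k x y : x = y %[mod r] -> la k ^+ x = la k ^+ y.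
  by move=> exy; rewrite -(expr_mod x (la1 k)) exy expr_mod.
have ei : la i ^+ a i = la i * la i ^+ ((a i + a j).-1 - q).
  rewrite -exprS; apply: e; rewrite -subSn ?prednK; try lia.
  by apply/esym/eqP; rewrite -(eqn_modDr q) subnK ?eqn_modDl ?qj //; lia.
apply: (@mulIf _ (la i ^+ a i * la j ^+ a j)); first by rewrite mulf_neq0 ?expf_neq0.
rewrite chi_upd // (e j q (a j) qj) [in RHS]ei; field.
exact: nz.
Qed.

Lemma chi_dec (la : 'I_n -> K) i a : la i != 0 -> (0 < a i)%N -> chi la (dec i a) = chi la a * (la i)^-1.
Proof.
by move=> nz h; have := chi_inc la i (dec i a); rewrite incdec // => ->; rewrite mulrAC divff // mul1r.
Qed.

Lemma mono_Y w la i f : (0 < r)%N -> (forall k, la k ^+ r = 1) ->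
  mono w la (Y i f) = (la i)^-1 *: Y (w i) (mono w la f).
Proof.
move=> r0 la1; elim/mpoly_span_ind: f => [|c f g IHf IHg|a].
- by rewrite !linear0 ?scaler0.
- by rewrite !linearP /= IHf IHg -!mul_mpolyC; ring.
have nz : la i != 0.
  by apply/eqP => e; move/eqP: (la1 i); rewrite e expr0n gtn_eqF // eq_sym oner_eq0.
rewrite monoX [in RHS]linearZ /= !YX /Ymon.
rewrite linearB !(linearZ_LR (mono w la)) /= monoX linear_sum !scalerBr !scalerA; congr (_ - _).
  rewrite /ycoef act_val; have [e|h] := posnP (a i).
    by rewrite e oppr0 add0r addNr mul0r mulr0 !scale0r.
  by rewrite dec_act chi_dec //; congr (_ *: _); ring.
rewrite [in RHS](reindex_inj (@perm_inj _ w)) /= !scaler_sumr.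
apply: eq_big => j; first by rewrite (inj_eq (@perm_inj _ w)).
move=> ji; rewrite mono_Tmon 1?eq_sym // scalerA; congr (_ *: _).
by ring.
Qed.

Lemma mono_S w la i j f : (0 < r)%N -> (forall k, la k ^+ r = 1) ->
  mono w la (S i j f) = S (w i) (w j) (mono w la f).
Proof.
move=> r0 la1; elim/mpoly_span_ind: f => [|c f g IHf IHg|a].
- by rewrite !linear0.
- by rewrite !linearP /= IHf IHg.
rewrite SX monoX [in RHS]linearZ /= SX /Smon linearZ /= monoX !act_val -swap_expo_act !scalerA.
case: eqP => [e|_]; last by rewrite mul0r mulr0.
rewrite mulrC; congr ((_ * _) *: _); have [->|ij] := eqVneq i j.
  by congr chi; apply/ffunP => k; rewrite ffunE tperm1 perm1.
have nz k : la k != 0.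
  by apply/eqP => e'; move/eqP: (la1 k); rewrite e' expr0n gtn_eqF // eq_sym oner_eq0.
apply: (@mulIf _ (la i ^+ a i * la j ^+ a j)); first by rewrite mulf_neq0 ?expf_neq0.
have eq k x y : x = y %[mod r] -> la k ^+ x = la k ^+ y.
  by move=> exy; rewrite -(expr_mod x (la1 k)) exy expr_mod.
by rewrite -upd_swap // chi_upd // (eq i _ _ e) (eq j _ _ e).
Qed.

Lemma pm_mulX w i f : pm w ('X_i * f) = 'X_(w i) * pm w f.
Proof. by rewrite !pm_mono mono_mulX scale1r. Qed.

Lemma pm_Y w i f : (0 < r)%N -> pm w (Y i f) = Y (w i) (pm w f).
Proof. by move=> r0; rewrite !pm_mono mono_Y ?invr1 ?scale1r // => k; rewrite expr1n. Qed.

Lemma pm_S w i j f : (0 < r)%N -> pm w (S i j f) = S (w i) (w j) (pm w f).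
Proof. by move=> r0; rewrite !pm_mono mono_S // => k; rewrite expr1n. Qed.

Lemma S_sym i j f : S i j f = S j i f.
Proof.
elim/mpoly_span_ind: f => [|c f g IHf IHg|a]; rewrite ?linear0 //.
  by rewrite !linearP /= IHf IHg.
by rewrite !SX /Smon eq_sym /swap tpermC.
Qed.

(** ** The operators z *)

Definition Z i f : P := Y i ('X_i * f) + c0 *: \sum_(j < n | (j < i)%N) S i j f.

Lemma Z_is_linear i : linear (Z i).
Proof.
move=> c f g; rewrite /Z mulrDr -scalerAr linearP.
rewrite (eq_bigr (fun j => c *: S i j f + S i j g)) => [|j _]; last by rewrite linearP.
by rewrite big_split -scaler_sumr /= -!mul_mpolyC; ring.
Qed.
HB.instance Definition _ i := @GRing.isLinear.Build K P P *:%R (Z i) (Z_is_linear i).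

(** The diagonal entry at x^a of the triangular operator [Z i]. *)
Definition ev i a : K :=
  (a i).+1%:R - d 0 + d (- (a i).+1%:Z) - r%:R * c0 * (rk a i)%:R.

(** The reflections with j < i that occur in [Z i] cancel the reflected
    monomials of the divided differences; this is what remains. *)
Definition Umon i j a : P :=
  \sum_(0 <= q < (a i + a j).+1 | q == a j %[mod r])
    ((q < a i + (i < j)%N)%N%:R - (q < a j)%N%:R) *: Xm (upd a i j (a i + a j - q) q).

Lemma Tmon_inc_Umon i j a : j != i -> Tmon i j (inc i a) =
  Umon i j a + (if (j < i)%N then if a i == a j %[mod r] then 1 else 0 else 0) *: Xm (swap i j a).
Proof.
move=> ji; pose N := (a i + a j).+1.
rewrite (Tmon_widen (N := N)); last by rewrite !ffunE eqxx (negPf ji).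
rewrite !ffunE eqxx (negPf ji) /Umon -/N.
have -> : (if (j < i)%N then if a i == a j %[mod r] then 1 else 0 else 0) *: Xm (swap i j a) =
    \sum_(0 <= q < N | q == a j %[mod r]) ((j < i)%N && (q == a i))%:R *: Xm (upd a i j (a i + a j - q) q).
  case: (j < i)%N; last by rewrite scale0r big1 // => q _; rewrite scale0r.
  rewrite big_mkcond (bigD1_seq (a i)) ?mem_index_iota ?iota_uniq //=; last by rewrite /N; lia.
  rewrite eqxx scale1r [X in _ = _ + X]big1 ?addr0; last first.
    by move=> q /negPf ->; rewrite scale0r if_same.
  by rewrite addnC addnK upd_swap 1?eq_sym //; case: ifP; rewrite ?scale1r ?scale0r.
rewrite -big_split /=; apply: eq_bigr => q _; rewrite -scalerDl.
congr (_ *: Xm _); last first.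
  by apply/ffunP => x; rewrite !ffunE; case: eqVneq.
rewrite addrAC -natrD; congr (_%:R - _).
have : (j < i)%N = ~~ (i < j)%N by move: ji; rewrite -val_eqE /=; lia.
case: (i < j)%N => /= ->; rewrite /= ?addn1 ?addn0 //.
by rewrite ltnS leq_eqVlt; have [->|_] := eqVneq q (a i); rewrite ?ltnn ?addn0.
Qed.

Lemma ZX i a : Z i (Xm a) =
  ((a i).+1%:R - d 0 + d (- (a i).+1%:Z)) *: Xm a - (c0 * r%:R) *: \sum_(j | j != i) Umon i j a.
Proof.
rewrite /Z mulXX YX /Ymon decinc /ycoef !ffunE eqxx -addrA; congr (_ + _).
rewrite (eq_bigr (fun j => Umon i j a +
  (if (j < i)%N then if a i == a j %[mod r] then 1 else 0 else 0) *: Xm (swap i j a))); last first.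
  by move=> j /Tmon_inc_Umon.
rewrite big_split /= scalerDr opprD -addrA -[RHS]addr0; congr (_ + _).
apply/eqP; rewrite addrC subr_eq0; apply/eqP; rewrite -scalerA; congr (_ *: _).
rewrite big_mkcond [in RHS]big_mkcond scaler_sumr; apply: eq_bigr => j _.
case: ifP => ji.
  have -> : j != i by rewrite -val_eqE /=; lia.
  by rewrite SX /Smon scalerA; congr (_ *: _); case: ifP; rewrite ?mulr1 ?mulr0.
by case: ifP; rewrite ?scale0r scaler0.
Qed.

Lemma upd_eq i j a p q : i != j -> (p + q = a i + a j)%N ->
  (upd a i j p q == a) = (q == a j).
Proof.
move=> ij s; apply/eqP/eqP => [e|e].
  by have := congr1 (fun c : expo => c j) e; rewrite ffunE eqxx eq_sym (negPf ij).
by subst q; move/addIn: s => ->; rewrite upd_id.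
Qed.

Lemma cf_Umon_diag i j a : j != i -> cf a (Umon i j a) = (before a j i)%:R.
Proof.
move=> ji; rewrite linear_sum /=.
rewrite big_mkcond (bigD1_seq (a j)) ?mem_index_iota ?iota_uniq //=; last by lia.
rewrite eqxx linearZ /= cfX addnK upd_id eqxx mulr1 ltnn subr0 big_nat_cond big1 ?addr0.
  by congr (_%:R); rewrite /before; move: ji; rewrite -val_eqE /=; lia.
move=> q /andP[/andP[_ qN] /negPf qj]; case: ifP => // _.
rewrite linearZ /= cfX; have -> : (upd a i j (a i + a j - q) q == a) = false.
  by rewrite upd_eq ?qj ?subnK // eq_sym.
by rewrite mulr0.
Qed.

(** Apart from the reflected monomial, the exponents that occur have their
    entries at [i] and [j] strictly between those of [a]; the reflected
    monomial occurs only if it is smaller. *)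
Lemma cf_Umon_lt i j a b : j != i -> b != a -> cf b (Umon i j a) != 0 -> expo_lt b a.
Proof.
move=> ji ba nz; have ij : i != j by rewrite eq_sym.
have [q [qN qj qnz]] : exists q, [/\ (q <= a i + a j)%N, upd a i j (a i + a j - q) q = b &
    (q < a i + (i < j))%N%:R - (q < a j)%N%:R != 0 :> K].
  apply: contrapT => nex; move/eqP: nz; apply; rewrite linear_sum big_nat_cond big1 //.
  move=> q /andP[/andP[_ qN] _]; rewrite linearZ /= cfX.
  have [e|ne] := eqVneq (upd a i j (a i + a j - q) q) b; last by rewrite mulr0.
  rewrite mulr1; apply/eqP; apply: contraT => qnz; exfalso; apply: nex; exists q.
  by split.
have nqj : q != a j.
  by apply: contraNneq ba => e; rewrite -qj e addnK upd_id.
have bi : b i = (a i + a j - q)%N by rewrite -qj ffunE eqxx.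
have bj : b j = q by rewrite -qj ffunE (negPf ji) eqxx.
have bk k : k != i -> k != j -> b k = a k by move=> ki kj; rewrite -qj ffunE (negPf ki) (negPf kj).
have qcase : (q < a i + (i < j))%N <> (q < a j)%N by move=> e; rewrite e subrr eqxx in qnz.
have [qi|nqi] := eqVneq q (a i).
  have sb : b = swap i j a by rewrite -qj qi addKn upd_swap.
  rewrite sb; move: qcase; rewrite qi.
  have [lij|gij|/val_inj e] := ltngtP i j; last by rewrite e eqxx in ij.
    by rewrite addn1 ltnSn => h; apply: expo_lt_swap => //; move: h nqj; rewrite qi; lia.
  rewrite addn0 ltnn => h; have -> : swap i j a = swap j i a by rewrite /swap tpermC.
  by apply: expo_lt_swap => //; move: h; lia.
apply: (expo_lt_transfer (i := i) (j := j)) => //; rewrite ?bi ?bj; move: qcase nqj nqi qN;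
  case: (i < j)%N => /=; lia.
Qed.

Lemma cf_Z_diag i a : cf a (Z i (Xm a)) = ev i a.
Proof.
rewrite ZX linearB !linearZ /= cfX eqxx mulr1 linear_sum /= /ev; congr (_ - _).
rewrite [_ * c0]mulrC; congr (_ * _); rewrite /rk -sum1_card natr_sum.
rewrite [RHS](eq_bigl (fun j => (j != i) && before a j i)); last first.
  by move=> j; rewrite inE; have [->|] := eqVneq j i; rewrite ?before_irr.
rewrite big_mkcondr /=; apply: eq_bigr => j ji.
by rewrite cf_Umon_diag //; case: ifP.
Qed.

Lemma cf_Z_lt i a b : b != a -> cf b (Z i (Xm a)) != 0 -> expo_lt b a.
Proof.
move=> ba nz; apply: contrapT => nlt; move/eqP: nz; apply.
rewrite ZX linearB !linearZ /= cfX eq_sym (negPf ba) mulr0 sub0r linear_sum big1 ?mulr0 ?oppr0 //.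
move=> j ji; apply/eqP; apply: contraT => nz.
by case: nlt; apply: cf_Umon_lt ji ba nz.
Qed.

(** By triangularity no other monomial of the support contributes to a maximal
    one. *)
Lemma cf_Z_top i b f : (forall c, cf c f != 0 -> ~ expo_lt b c) ->
  cf b (Z i f) = ev i b * cf b f.
Proof.
move=> top; rewrite -{1}[f]lin_id /lin -lock !linear_sum /=.
have term m : m \in msupp f -> cf b (Z i (f@_m *: Xm (ex m))) = (m == mn b)%:R * (ev i b * cf b f).
  move=> mf; rewrite !linearZ /=; have [->|ne] := eqVneq m (mn b).
    by rewrite mnK cf_Z_diag mul1r mulrC.
  have [->|nz] := eqVneq (cf b (Z i (Xm (ex m)))) 0; first by rewrite mul0r mulr0.
  case: (top (ex m)); first by rewrite /cf exK -mcoeff_msupp.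
  by apply: cf_Z_lt nz; apply: contraNneq ne => ->; rewrite exK.
rewrite big_seq (eq_bigr _ term) -big_seq -mulr_suml.
have [bf|nbf] := boolP (mn b \in msupp f).
  rewrite (bigD1_seq (mn b)) ?msupp_uniq //= eqxx big1 ?addr0 ?mul1r //.
  by move=> m /negPf ->.
by rewrite /cf (memN_msupp_eq0 nbf) !mulr0.
Qed.

Lemma pm_tpermK i j : involutive (pm (tperm i j) : P -> P).
Proof.
move=> f; elim/mpoly_span_ind: f => [|c f g IHf IHg|a]; rewrite ?linear0 //.
  by rewrite !linearP /= IHf IHg.
by rewrite !pmX -!swap_act swapK.
Qed.

Lemma cf_pm_tperm i j a f : cf (swap i j a) (pm (tperm i j) f) = cf a f.
Proof.
elim/mpoly_span_ind: f => [|c f g IHf IHg|b].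
- by rewrite !linear0.
- by rewrite !linearP /= IHf IHg.
by rewrite pmX -swap_act !cfX (inj_eq (can_inj (swapK i j))).
Qed.

Definition rho i j a : K := if a i == a j %[mod r] then r%:R else 0.

(** When the residues modulo r of the exponents at [i] and [j] are fixed, the
    sum over [l] is a transposition times r or 0. *)
Lemma S_class i j f (ka : expo) :
  (forall b, cf b f != 0 -> b i = ka i %[mod r] /\ b j = ka j %[mod r]) ->
  S i j f = rho i j ka *: pm (tperm i j) f.
Proof.
move=> cl; rewrite -(lin_id f) /lin -lock (linear_sum (S i j)) (linear_sum (pm (tperm i j))) scaler_sumr /=.
rewrite big_seq [RHS]big_seq; apply: eq_bigr => m mf.
have -> : rho i j ka = rho i j (ex m).
  by rewrite /rho; have [|-> ->//] := cl (ex m); rewrite /cf exK -mcoeff_msupp.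
by rewrite !linearZ /= SX pmX -swap_act /Smon -/(rho i j (ex m)) -!mul_mpolyC; ring.
Qed.

Hypothesis d_per : forall j : int, d (j + r%:Z) = d j.

Lemma eqmodS (x y : nat) : x = y %[mod r] -> x.+1 = y.+1 %[mod r].
Proof. by move=> e; apply/eqP; rewrite -(addn1 x) -(addn1 y) eqn_modDr e. Qed.

Lemma d_mod (a b : nat) : a = b %[mod r] -> d (- a%:Z) = d (- b%:Z).
Proof.
wlog le : a b / (a <= b)%N => [W ab|/eqP].
  by have [le|/ltnW le] := leqP a b; [apply: W|apply/esym/W].
rewrite eq_sym eqn_mod_dvd // => /dvdnP[t et].
have -> : - a%:Z = - b%:Z + (t * r)%:Z by lia.
elim: t {et} => [|t IH]; first by rewrite addr0.
by rewrite mulSn PoszD [r%:Z + _]addrC addrA d_per.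
Qed.

Lemma Dg_class i f (q : nat) : (forall b, cf b f != 0 -> b i = q %[mod r]) ->
  Dg i f = (d (- q%:Z) - d (- q.+1%:Z)) *: f.
Proof.
move=> cl; apply/cfP => b; rewrite linearZ /=.
have -> : cf b (Dg i f) = (d (- (b i)%:Z) - d (- (b i).+1%:Z)) * cf b f.
  elim/mpoly_span_ind: f {cl} => [|c f g IHf IHg|a].
  - by rewrite !linear0 mulr0.
  - by rewrite !linearP /= IHf IHg; ring.
  by rewrite DgX linearZ /= cfX; case: eqP => [->//|]; rewrite !mulr0.
have [->|nz] := eqVneq (cf b f) 0; first by rewrite !mulr0.
have e := cl b nz; by rewrite (d_mod e) (d_mod (eqmodS e)).
Qed.

End Dunkl_operators.

(** * Intertwining operators *)

Section AffineRotation.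
Variable n' : nat.
Local Notation n := n'.+1.
Local Notation expo := {ffun 'I_n -> nat}.
Implicit Types (a b : expo) (i j k : 'I_n).

Definition om : 'S_n := perm (can_inj (@ord_predK n)).

Lemma omE k : om k = (if k == ord0 then n' else k.-1) :> nat.
Proof.
rewrite permE /= /ord_pred /=; case: (k =P ord0) => [->|k0].
  by rewrite /= modn_small.
have k1 : (0 < k)%N by rewrite lt0n; apply: contra_notN k0 => /eqP e; apply: ord_inj.
by rewrite -{1}(prednK k1) addSn /= modnDr modn_small //; have := ltn_ord k; lia.
Qed.

Lemma om0 : om ord0 = ord_max.
Proof. by apply: ord_inj; rewrite omE eqxx. Qed.

Lemma om_max k : (om k == ord_max) = (k == ord0).
Proof. by rewrite -om0 (inj_eq perm_inj). Qed.

Lemma om_lt j k : (om j < om k)%N = if k == ord0 then j != ord0 else (j != ord0) && (j < k)%N.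
Proof.
rewrite !omE -!val_eqE /=; have := ltn_ord j; have := ltn_ord k.
by case: eqP; case: eqP; lia.
Qed.

(** The exponent of the image of x^a under [Phi]. *)
Definition phi a : expo := inc ord_max (expo_act om a).

Lemma phi_om a k : phi a (om k) = (a k + (k == ord0))%N.
Proof. by rewrite ffunE act_val om_max; case: eqP => _; rewrite ?addn1 ?addn0. Qed.

(** The first position becomes the last one and would now come first among
    equal entries; the unit added to its entry keeps it behind them. *)
Lemma rk_phi a k : rk (phi a) (om k) = rk a k.
Proof.
rewrite /rk -(card_preimset _ (@perm_inj _ om)); apply: eq_card => j; rewrite !inE.
rewrite /before !phi_om om_lt; have [->|j0] := eqVneq j ord0; have [->|k0] := eqVneq k ord0.
- by rewrite !ltnn /= !andbF.
- by rewrite /= addn1 addn0 ltn0 andbF andbT orbF; lia.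
- by rewrite /= addn1 addn0 lt0n j0 andbF orbF andbT; lia.
- by rewrite /= !addn0.
Qed.

End AffineRotation.

Section Relations.
Variables (K : numFieldType) (n' r : nat) (c0 : K) (d : int -> K).
Hypothesis r_gt0 : (0 < r)%N.
Local Notation n := n'.+1.
Local Notation expo := {ffun 'I_n -> nat}.
Local Notation P := {mpoly K[n]}.
Implicit Types (a b : expo) (i j k : 'I_n) (f g : P) (w : 'S_n).
Local Notation Xm := (@Xm K n).
Local Notation Y := (@Y K n r c0 d).
Local Notation S := (@S K n r).
Local Notation Z := (@Z K n r c0 d).
Local Notation Dg := (@Dg K n d).
Local Notation om := (@om n').

(** The affine intertwiner of Knop and Sahi. *)
Definition Phi f : P := 'X_ord_max * pm om f.

Lemma S_mulX_far i j k f : k != i -> k != j -> S i j ('X_k * f) = 'X_k * S i j f.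
Proof.
move=> ki kj; elim/mpoly_span_ind: f => [|c f g IHf IHg|a].
- by rewrite mulr0 !linear0 mulr0.
- by rewrite mulrDr -scalerAr !linearP /= IHf IHg -!mul_mpolyC; ring.
have ik : (i == k) = false by rewrite eq_sym (negPf ki).
have jk : (j == k) = false by rewrite eq_sym (negPf kj).
rewrite mulXX !SX /Smon !ffunE ik jk -scalerAr mulXX.
congr (_ *: Xm _); apply/ffunP => x; rewrite !ffunE.
by rewrite -(inj_eq (@perm_inj _ (tperm i j))) tpermK tpermD // eq_sym.
Qed.

Lemma Y_mulX_mulX i k f : k != i ->
  Y i ('X_k * ('X_i * f)) = 'X_k * (Y i ('X_i * f) + c0 *: S i k f).
Proof.
move=> ki; rewrite Y_mulX // mulrDr -scalerAr; congr (_ + _ *: _).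
elim/mpoly_span_ind: f => [|c f g IHf IHg|a].
- by rewrite mulr0 !linear0 mulr0.
- by rewrite mulrDr -scalerAr !linearP /= IHf IHg -!mul_mpolyC; ring.
rewrite mulXX WX /Wmon SX /Smon !ffunE eqxx (negPf ki) -scalerAr mulXX.
rewrite -[(a i).+1]addn1 -[(a k).+1]addn1 eqn_modDr; congr (_ *: Xm _).
apply/ffunP => x; rewrite !ffunE.
rewrite -[x == k](inj_eq (@perm_inj _ (tperm i k))) tpermR.
by [].
Qed.

Lemma Z_Phi k f : k != ord0 -> Z (om k) (Phi f) = Phi (Z k f).
Proof.
move=> k0; have mk : ord_max != om k by rewrite eq_sym om_max.
rewrite {1}/Z /Phi mulrCA Y_mulX_mulX //.
rewrite (eq_bigr (fun j => 'X_ord_max * S (om k) j (pm om f))); last first.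
  move=> j jk; rewrite S_mulX_far //; apply: contraTneq jk => <-.
  by rewrite -leqNgt /= -ltnS ltn_ord.
rewrite -mulr_sumr scalerAr -mulrDr; congr (_ * _).
rewrite /Z linearD /= pm_Y // pm_mulX linearZ /= (linear_sum (pm om)) /=.
rewrite [X in _ = _ + _ *: X](eq_bigr (fun j => S (om k) (om j) (pm om f))); last by move=> j _; rewrite pm_S.
rewrite [in RHS](bigD1 ord0) /=; last by rewrite lt0n; apply: contraNneq k0 => e; apply/eqP/ord_inj.
rewrite om0 scalerDr addrA; congr (_ + _ *: _).
rewrite (reindex_inj (@perm_inj _ om)) /=; apply: eq_bigl => j.
by rewrite om_lt (negPf k0) andbC.
Qed.

Lemma neq_ord_max : (fun j : 'I_n => j != ord_max) =1 (fun j : 'I_n => (j < n')%N).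
Proof. by move=> j /=; rewrite -val_eqE /= ltn_neqAle -ltnS ltn_ord andbT. Qed.

Lemma Z_Phi_max f : Z ord_max (Phi f) = Phi (Z ord0 f + f) - Dg ord_max (Phi f).
Proof.
rewrite {1}/Z Y_mulXx.
rewrite (eq_bigl _ _ neq_ord_max).
rewrite subrK /Phi !linearD /= mulrDr.
congr ('X__ * _ + _ - _); rewrite /Z big_pred0 ?scaler0 ?addr0; last by move=> j; rewrite ltn0.
by rewrite linear0 addr0 pm_Y // pm_mulX om0.
Qed.

(** Hence x_n y_n acts diagonally on the joint eigenvectors. *)
Lemma mulX_Y_max f : 'X_ord_max * Y ord_max f = Z ord_max f - f + Dg ord_max f.
Proof.
rewrite /Z Y_mulXx (eq_bigl _ _ neq_ord_max).
by rewrite subrK; ring.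
Qed.

(** ** Adjacent transpositions *)

Variables (i j : 'I_n).
Hypothesis ij : j = i.+1 :> nat.

Lemma Z_tperm_next f :
  Z j (pm (tperm i j) f) = pm (tperm i j) (Z i f) + c0 *: S i j (pm (tperm i j) f).
Proof.
have nij : i != j by rewrite -val_eqE /= ij; lia.
rewrite /Z linearD /= pm_Y // pm_mulX tpermL linearZ /= (linear_sum (pm (tperm i j))) /= -addrA; congr (_ + _).
rewrite (bigD1 i) /=; last by rewrite ij.
rewrite scalerDr addrC S_sym; congr (_ *: _ + _).
rewrite (eq_big (fun k : 'I_n => (k < i)%N) (fun k => pm (tperm i j) (S i k f))) // => k.
  by rewrite -val_eqE /= ij; lia.
rewrite -val_eqE /= ij => h; rewrite pm_S // tpermL tpermD //.
  by rewrite -val_eqE /=; lia.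
by rewrite -val_eqE /= ij; lia.
Qed.

Lemma Z_tperm_prev f :
  Z i (pm (tperm i j) f) = pm (tperm i j) (Z j f - c0 *: S i j f).
Proof.
have := Z_tperm_next (pm (tperm i j) f); rewrite pm_tpermK => ->.
by rewrite addrK pm_tpermK.
Qed.

Lemma Z_tperm_far k f : k != i -> k != j ->
  Z k (pm (tperm i j) f) = pm (tperm i j) (Z k f).
Proof.
move=> ki kj; have tk : tperm i j k = k by rewrite tpermD // eq_sym.
rewrite /Z linearD /= pm_Y // pm_mulX tk linearZ /= (linear_sum (pm (tperm i j))) /=; congr (_ + _ *: _).
rewrite (reindex_inj (@perm_inj _ (tperm i j))) /=; apply: eq_big => x.
  move: ki kj; rewrite -!val_eqE /=; case: tpermP => [->|->|_ _] //; rewrite ij; lia.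
by rewrite pm_S // tk.
Qed.

End Relations.

(** * Joint eigenvectors *)

Section Eigenbasis.
Variables (K : numFieldType) (n' r l : nat) (c0 : K) (d : int -> K).
Local Notation n := n'.+1.
Hypotheses (r_gt0 : (0 < r)%N) (l_gt0 : (0 < l)%N) (co_ln : coprime l n).
Hypotheses (c0E : c0 = l%:R / n%:R) (d_per : forall j : int, d (j + r%:Z) = d j).
Local Notation expo := {ffun 'I_n -> nat}.
Local Notation P := {mpoly K[n]}.
Implicit Types (a b : expo) (i j k : 'I_n) (f g G H : P) (w : 'S_n).
Local Notation Xm := (@Xm K n).
Local Notation Y := (@Y K n r c0 d).
Local Notation S := (@S K n r).
Local Notation Z := (@Z K n r c0 d).
Local Notation Dg := (@Dg K n d).
Local Notation ev := (@ev K n r c0 d).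
Local Notation Phi := (@Phi K n').
Local Notation rho := (@rho K n r).

(** Writing a - b = r t, one gets n t = l (p - q); as [l] is coprime to [n],
    this forces p = q. *)
Lemma coprime_arith (a b p q : nat) : (p < n)%N -> (q < n)%N -> a = b %[mod r] ->
  (n * a + r * l * q = n * b + r * l * p)%N -> a = b.
Proof.
wlog le : a b p q / (a <= b)%N => [W|] pn qn ab e.
  have [le|lt] := leqP a b; first exact: W e.
  by apply/esym; apply: W (esym e) => //; apply: ltnW.
have /dvdnP[t et] : (r %| b - a)%N by rewrite -eqn_mod_dvd //; apply/eqP.
have eb : b = (a + t * r)%N by lia.
have e2 : (n * t + l * p = l * q)%N.
  by apply/eqP; rewrite -(eqn_pmul2l r_gt0); apply/eqP; move: e; rewrite eb; nia.
have : (n %| q - p)%N.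
  by rewrite -(@Gauss_dvdr _ l) 1?coprime_sym // mulnBr -e2 addnK dvdn_mulr.
have [qp|pq] := leqP q p.
  by move=> _; have : (l * q <= l * p)%N := leq_mul (leqnn l) qp; nia.
by move/dvdn_leq; lia.
Qed.

Lemma ev_sub a b i j : a i = b j %[mod r] ->
  n%:R * (ev i a - ev j b) =
  (n * a i + r * l * rk b j)%:R - (n * b j + r * l * rk a i)%:R.
Proof.
move=> e; have n0 : n%:R != 0 :> K by rewrite pnatr_eq0.
rewrite /ev (d_mod d_per (eqmodS e)).
rewrite c0E !natrD !natrM -!natr1; field.
by rewrite natr1.
Qed.

Lemma ev_inj a b i j : a i = b j %[mod r] -> ev i a = ev j b ->
  a i = b j /\ rk a i = rk b j.
Proof.
move=> ab e; have := ev_sub ab; rewrite e subrr mulr0 => /esym/eqP.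
rewrite subr_eq0 eqr_nat => /eqP e2.
have eab : a i = b j by apply: coprime_arith e2 => //; apply: rk_bound.
split=> //; move: e2; rewrite eab => /addnI /eqP.
by rewrite eqn_pmul2l ?muln_gt0 ?r_gt0 // eq_sym => /eqP.
Qed.

Lemma ev_sep a b : (forall i, a i = b i %[mod r]) -> (forall i, ev i a = ev i b) -> a = b.
Proof. by move=> ab e; apply/ffunP => i; case: (ev_inj (ab i) (e i)). Qed.

Definition joint (eps : 'I_n -> K) (ka : expo) G :=
  (forall i, Z i G = eps i *: G) /\
  (forall b, cf b G != 0 -> forall i, b i = ka i %[mod r]).

(** The eigenvalues can be read off at any maximal monomial of the support. *)
Lemma joint_top eps ka G b0 : joint eps ka G -> cf b0 G != 0 ->
  exists b, [/\ b = b0 \/ expo_lt b0 b, cf b G != 0 & forall i, eps i = ev i b].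
Proof.
move=> [ZG _]; pose M := \max_(m <- msupp G) expo_height (ex m).
have leM b : cf b G != 0 -> (expo_height b <= M)%N.
  move=> nz; rewrite -[b](mnK) /M; apply: (@leq_bigmax_seq _ _ predT (fun m => expo_height (ex m))) => //.
  by rewrite mcoeff_msupp.
move: {2}(M - expo_height b0)%N (leqnn (M - expo_height b0)%N) => m.
elim: m b0 => [|m IH] b0 lem nz;
  (have [[c [nzc ltc]]|top] := pselect (exists c, cf c G != 0 /\ expo_lt b0 c)).
- by have := expo_height_lt ltc; have := leM _ nzc; lia.
- exists b0; split=> //; [by left|] => i; apply: (mulIf nz).
  rewrite -(@cf_Z_top K n r c0 d i b0 G) ?ZG ?linearZ //.
  by move=> c nzc ltc; apply: top; exists c.
- have [|b [lb nb eb]] := IH c _ nzc.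
    by have := expo_height_lt ltc; have := leM _ nzc; lia.
  exists b; split=> //; right; case: lb => [->//|]; exact: expo_lt_trans ltc.
- exists b0; split=> //; [by left|] => i; apply: (mulIf nz).
  rewrite -(@cf_Z_top K n r c0 d i b0 G) ?ZG ?linearZ //.
  by move=> c nzc ltc; apply: top; exists c.
Qed.

Definition isE a G := joint (ev^~ a) a G.

Lemma neq0_cf G : G <> 0 -> exists b, cf b G != 0.
Proof.
move=> nz; apply: contrapT => nex; apply: nz; apply/cfP => b; rewrite linear0.
by apply/eqP; apply: contraT => h; exfalso; apply: nex; exists b.
Qed.

Lemma isE_supp a G b : isE a G -> cf b G != 0 -> (b = a \/ expo_lt b a) /\ cf a G != 0.
Proof.
move=> EG nz; have [c [lc nc ec]] := joint_top EG nz.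
suff <- : c = a by split=> //; case: lc => [->|]; [left|right].
by apply: ev_sep => [i|i]; [apply: EG.2 nc i|rewrite ec].
Qed.

Lemma isE_neq0 a G : isE a G -> G <> 0 -> cf a G != 0.
Proof. by move=> EG /neq0_cf[b nz]; case: (isE_supp EG nz). Qed.

Lemma isE_lin a c G H : isE a G -> isE a H -> isE a (c *: G + H).
Proof.
move=> [ZG SG] [ZH SH]; split=> [i|b].
  by rewrite linearP /= ZG ZH scalerDr !scalerA mulrC.
rewrite linearP /= => nz i; have [e|] := eqVneq (cf b G) 0; last by move/SG; apply.
by apply: SH; move: nz; rewrite e mulr0 add0r.
Qed.

(** The difference is an eigenvector without the monomial x^a, hence zero. *)
Lemma isE_uniq a G H : isE a G -> isE a H -> cf a G = cf a H -> G = H.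
Proof.
move=> EG EH e; apply/eqP; rewrite -subr_eq0; apply/eqP; apply: contrapT.
have E : isE a (-1 *: H + G) by apply: isE_lin.
rewrite -scaleN1r addrC => /(isE_neq0 E); rewrite linearP /= e mulN1r addNr eqxx.
by [].
Qed.

(** ** Moving up: the operators Phi and sigma *)

Lemma phi_inj : injective (@phi n').
Proof.
move=> a b e; apply/ffunP => k; have := congr1 (fun c : expo => c (om n' k)) e.
by rewrite !phi_om => /addIn.
Qed.

Lemma PhiX a : Phi (Xm a) = Xm (phi a).
Proof. by rewrite /Phi pmX mulXX. Qed.

Lemma Phi_is_linear : linear Phi.
Proof. by move=> c f g; rewrite /Phi linearP mulrDr -scalerAr. Qed.

Lemma cf_Phi a f : cf (phi a) (Phi f) = cf a f.
Proof.
elim/mpoly_span_ind: f => [|c f g IHf IHg|b].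
- by rewrite /Phi linear0 mulr0 !linear0.
- by rewrite Phi_is_linear !linearP /= IHf IHg.
by rewrite PhiX !cfX (inj_eq phi_inj).
Qed.

Lemma cf_Phi_neq0 b f : cf b (Phi f) != 0 -> exists2 a, b = phi a & cf a f != 0.
Proof.
move=> nz; suff [a e] : exists a, b = phi a by exists a; rewrite // -cf_Phi -e.
apply: contrapT => nex; move/eqP: nz; apply.
elim/mpoly_span_ind: f => [|c f g IHf IHg|a].
- by rewrite /Phi linear0 mulr0 linear0.
- by rewrite Phi_is_linear linearP /= IHf IHg mulr0 addr0.
by rewrite PhiX cfX; case: eqP => // e; case: nex; exists a.
Qed.

Lemma ev_phi a k : k != ord0 -> ev (om n' k) (phi a) = ev k a.
Proof. by move=> k0; rewrite /ev rk_phi phi_om (negPf k0) addn0. Qed.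

Lemma ev_phi_max a : ev ord_max (phi a) =
  ev ord0 a + 1 - (d (- (a ord0).+1%:Z) - d (- (a ord0).+2%:Z)).
Proof.
rewrite -om0 /ev rk_phi phi_om eqxx addn1 -[in LHS]natr1; ring.
Qed.

Lemma phi_max a : phi a ord_max = (a ord0).+1.
Proof. by rewrite -om0 phi_om eqxx addn1. Qed.

Lemma isE_Phi a G : isE a G -> isE (phi a) (Phi G).
Proof.
move=> [ZG SG].
have cl b : cf b (Phi G) != 0 -> forall k, b k = phi a k %[mod r].
  move=> /cf_Phi_neq0[c -> nz] k; rewrite -(permKV (om n') k) !phi_om.
  by apply/eqP; rewrite eqn_modDr (SG c nz).
split=> // i; rewrite -(permKV (om n') i); set k := ((om n')^-1)%g i.
have [->|k0] := eqVneq k ord0; last first.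
  by rewrite Z_Phi // ZG ev_phi // /Phi linearZ -scalerAr.
rewrite om0 Z_Phi_max // (Dg_class d_per (q := phi a ord_max)); last by move=> b /cl.
rewrite ZG phi_max ev_phi_max -{2}[G]scale1r -scalerDl.
by rewrite /Phi linearZ -scalerAr -scalerBl.
Qed.

(** The operator s_ij + c_0 r / (z_i - z_j) intertwines z_i and z_j; on an
    eigenvector its denominator is a scalar. *)
Definition kap i j a : K := c0 * rho i j a / (ev i a - ev j a).

Definition sig i j a G : P := pm (tperm i j) G + kap i j a *: G.

Section Adjacent.
Variables (i j : 'I_n).
Hypothesis ij : j = i.+1 :> nat.

Lemma adj_neq : i != j. Proof. by rewrite -val_eqE /= ij; lia. Qed.

Lemma ev_adj_neq a : a i = a j %[mod r] -> ev i a - ev j a != 0.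
Proof.
move=> e; rewrite subr_eq0; apply/eqP => /(ev_inj e)[_ /rk_inj eij].
by have := adj_neq; rewrite eij eqxx.
Qed.

Lemma kapE a : kap i j a * (ev i a - ev j a) = c0 * rho i j a.
Proof.
rewrite /kap /rho; case: eqP => [e|_]; last by rewrite mulr0 mul0r mul0r.
by rewrite mulfVK // ev_adj_neq.
Qed.

Lemma sig_joint a G : isE a G ->
  joint (fun k => ev (tperm i j k) a) (swap i j a) (sig i j a G).
Proof.
move=> [ZG SG].
have cls b : cf b (pm (tperm i j) G) != 0 -> forall k, b k = swap i j a k %[mod r].
  rewrite -{1}(swapK i j b) cf_pm_tperm => /SG e k.
  by rewrite ffunE -e ffunE tpermK.
have SGe : S i j G = rho i j a *: pm (tperm i j) G.
  by apply: S_class => b nz; split; apply: SG nz _.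
have SsGe : S i j (pm (tperm i j) G) = rho i j a *: G.
  rewrite (S_class (ka := swap i j a)) ?pm_tpermK; last by move=> b nz; split; apply: cls nz _.
  by congr (_ *: _); rewrite /rho !ffunE tpermL tpermR eq_sym.
split=> [k|b nz k]; last first.
  have [e|] := eqVneq (cf b (pm (tperm i j) G)) 0; last by move/cls; apply.
  move: nz; rewrite linearD linearZ /= e add0r mulf_eq0 negb_or => /andP[nk /SG nz].
  have eij : a i = a j %[mod r].
    by apply/eqP; apply: contraNT nk => /negPf ne; rewrite /kap /rho ne mulr0 mul0r.
  by rewrite nz ffunE; case: tpermP => [->|->|//].
have pmZ c f : pm (tperm i j) (c *: f) = c *: pm (tperm i j) f by rewrite linearZ.
have key := kapE a; rewrite /sig linearD linearZ /= ZG.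
case: tpermP => [->|->|/eqP ki /eqP kj].
- rewrite Z_tperm_prev // ZG SGe linearB /= !pmZ pm_tpermK [c0 *: _]scalerA -key.
  by rewrite -!mul_mpolyC !(mpolyCM, mpolyCB); ring.
- rewrite Z_tperm_next // ZG SsGe !pmZ [c0 *: _]scalerA -key.
  by rewrite -!mul_mpolyC !(mpolyCM, mpolyCB); ring.
by rewrite Z_tperm_far // ZG !pmZ -!mul_mpolyC; ring.
Qed.

Lemma rk_swap a k : a i != a j -> rk (swap i j a) k = rk a (tperm i j k).
Proof.
move=> aij; rewrite /rk -(card_preimset _ (@perm_inj _ (tperm i j))).
apply: eq_card => x; rewrite !inE /before !ffunE tpermK; congr (_ || _).
case: eqP => //= e; move: e.
case: (tpermP i j k) => [->|->|/eqP ki /eqP kj]; case: tpermP => [->|->|/eqP xi /eqP xj] //.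
all: rewrite -?val_eqE /= ?ij; move=> e; try (by move: aij; rewrite e eqxx); try (by rewrite ?ltnn).
all: try (move: xi xj; rewrite -!val_eqE /= ij; lia).
all: try (move: ki kj; rewrite -!val_eqE /= ij; lia).
Qed.

Lemma ev_swap a k : a i != a j -> ev k (swap i j a) = ev (tperm i j k) a.
Proof. by move=> aij; rewrite /ev rk_swap // ffunE. Qed.

Lemma isE_sig a G : a i != a j -> isE a G -> isE (swap i j a) (sig i j a G).
Proof.
move=> aij /sig_joint[ZG SG]; split=> // k; rewrite ZG; congr (_ *: _).
by rewrite ev_swap.
Qed.

(** A nonzero image would be an eigenvector with the eigenvalues of z_i and z_j
    exchanged; these belong to the same exponent, but with the ranks at [i] and
    [j] exchanged. *)
Lemma sig_eq0 a G : a i = a j -> isE a G -> sig i j a G = 0.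
Proof.
move=> aij EG; apply: contrapT => /neq0_cf[b0 nz].
have sa : swap i j a = a.
  by apply/ffunP => k; rewrite ffunE; case: tpermP => [->|->|].
have [b [_ nb eb]] := joint_top (sig_joint EG) nz.
have bk k : b k = a k %[mod r] by rewrite ((sig_joint EG).2 b nb k) sa.
have at_ k : a (tperm i j k) = a k by have := congr1 (fun c : expo => c k) sa; rewrite ffunE.
have eab : b = a.
  apply/ffunP => k; have [] := ev_inj _ (esym (eb k)); first by rewrite bk at_.
  by rewrite at_.
have := eb i; rewrite eab tpermL => /(ev_inj (esym (congr1 (modn^~ r) aij)))[_ /rk_inj e].
by have := adj_neq; rewrite e eqxx.
Qed.

(** As a_i < a_j, the exponent [swap i j a] is larger than [a], so it is not in
    the support of [G]. *)
Lemma cf_sig_up a G : (a i < a j)%N -> isE a G -> cf (swap i j a) (sig i j a G) = cf a G.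
Proof.
move=> aij EG; rewrite /sig linearD linearZ /= cf_pm_tperm.
have [->|nz] := eqVneq (cf (swap i j a) G) 0; first by rewrite mulr0 addr0.
have up : expo_lt a (swap i j a).
  rewrite -{1}(swapK i j a); apply: expo_lt_swap; first by rewrite ij.
  by rewrite !ffunE tpermL tpermR.
case: (isE_supp EG nz) => -[e|lt] _; first by rewrite e in up; case: (expo_lt_irr up).
by case: (expo_lt_irr (expo_lt_trans up lt)).
Qed.

Lemma kap_swap a : a i != a j -> kap i j (swap i j a) = - kap i j a.
Proof.
move=> aij; rewrite /kap !ev_swap // tpermL tpermR -opprB invrN mulrN.
by congr (- (_ * _ / _)); rewrite /rho !ffunE tpermL tpermR eq_sym.
Qed.

Lemma sig_sig a G : a i != a j ->
  sig i j (swap i j a) (sig i j a G) = (1 - kap i j a ^+ 2) *: G.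
Proof.
move=> aij; rewrite /sig kap_swap // linearD linearZ /= pm_tpermK scalerDr scalerA.
rewrite scalerBl scale1r -addrA; congr (_ + _).
by rewrite addrA scaleNr addrN add0r mulNr scaleNr expr2.
Qed.

End Adjacent.

(** ** The eigenbasis *)

Definition expo0 : expo := [ffun => 0%N].

Lemma expo_sum_inc i a : expo_sum (inc i a) = (expo_sum a).+1.
Proof.
rewrite /expo_sum (bigD1 i) //= [in RHS](bigD1 i) //= ffunE eqxx addSn.
by congr (_.+1 + _)%N; apply: eq_bigr => k /negPf ki; rewrite ffunE ki.
Qed.

Lemma expo_sum_phi a : expo_sum (phi a) = (expo_sum a).+1.
Proof. by rewrite expo_sum_inc expo_sum_act. Qed.

Lemma phi_surj a : (0 < a ord_max)%N -> exists b, phi b = a.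
Proof.
move=> h; exists (expo_act ((om n')^-1)%g (dec ord_max a)); rewrite /phi.
have -> : expo_act (om n') (expo_act ((om n')^-1)%g (dec ord_max a)) = dec ord_max a.
  by apply/ffunP => k; rewrite ffunE [LHS]ffunE invgK permKV.
by rewrite incdec.
Qed.

(** A positive last entry is removed by undoing [phi]; if the last entry is
    zero and the exponent is not, there is an adjacent descent to undo. *)
Lemma expo_phi_swap_ind (Q : expo -> Prop) : Q expo0 ->
  (forall a, Q a -> Q (phi a)) ->
  (forall a i j, j = i.+1 :> nat -> (a i < a j)%N -> Q a -> Q (swap i j a)) ->
  forall a, Q a.
Proof.
move=> Q0 Qphi Qswap a; move: {2}(expo_sum a) (leqnn (expo_sum a)) => s.
elim: s a => [|s IHs] a les.
  suff -> : a = expo0 by [].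
  apply/ffunP => i; rewrite ffunE; move: les; rewrite leqn0 /expo_sum sum_nat_eq0.
  by move=> /forallP/(_ i)/eqP.
have [[i ai]|na] := pselect (exists i, (0 < a i)%N); last first.
  suff -> : a = expo0 by [].
  apply/ffunP => i; rewrite ffunE; apply/eqP; rewrite -leqn0 leqNgt; apply/negP => ai.
  by apply: na; exists i.
have [m em] : exists m, (i + m = n')%N by exists (n' - i)%N; rewrite subnKC // -ltnS.
elim: m a i les ai em => [|m IHm] a i les ai em.
  have e : i = ord_max by apply: ord_inj => /=; lia.
  have [b eb] : exists b, phi b = a by apply: phi_surj; rewrite -e.
  by rewrite -eb; apply/Qphi/IHs; move: les; rewrite -eb expo_sum_phi ltnS.
have lti : (i.+1 < n)%N by lia.
pose j : 'I_n := Ordinal lti; have ej : j = i.+1 :> nat by [].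
have [aj|aj] := posnP (a j); last by apply: (IHm a j) => //=; lia.
rewrite -(swapK i j a); apply: Qswap; rewrite ?ffunE ?tpermL ?tpermR ?aj //.
apply: (IHm _ j); rewrite ?swap_act ?expo_sum_act //.
  by rewrite -swap_act ffunE tpermR.
by rewrite /=; lia.
Qed.

Lemma expo_lt0 b : ~ expo_lt b expo0.
Proof.
move=> lt; have := expo_lt_sum lt; rewrite {2}/expo_sum big1 => [|i _]; last by rewrite ffunE.
move/eqP; rewrite /expo_sum sum_nat_eq0 => /forallP e; apply: (@expo_lt_irr _ expo0).
suff {1}<- : b = expo0 by [].
by apply/ffunP => i; rewrite ffunE; apply/eqP; apply: e.
Qed.

Lemma isE_exists a : exists2 G, isE a G & cf a G = 1.
Proof.
suff [G EG nz] : exists2 G, isE a G & cf a G != 0.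
  exists ((cf a G)^-1 *: G); last by rewrite linearZ /= mulVf.
  rewrite -[_ *: _]addr0; apply: isE_lin => //.
  split=> [i|b]; first by rewrite linear0 scaler0.
  by rewrite linear0 eqxx.
elim/expo_phi_swap_ind: a => [|a [G EG nz]|a i j ij aij [G EG nz]].
- exists (Xm expo0); last by rewrite cfX eqxx oner_eq0.
  split=> [i|b]; last by move=> /cfX_neq0 ->.
  apply/cfP => b; rewrite linearZ /= cfX; have [<-|ne] := eqVneq expo0 b.
    by rewrite cf_Z_diag mulr1.
  rewrite mulr0; apply/eqP; apply: contraT => /cf_Z_lt lt.
  by case: (@expo_lt0 b); apply: lt; rewrite eq_sym.
- by exists (Phi G); [apply: isE_Phi | rewrite cf_Phi].
- exists (sig i j a G); last by rewrite cf_sig_up.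
  by apply: isE_sig => //; rewrite neq_ltn aij.
Qed.

Definition F a : P := xget 0 [set G | isE a G /\ cf a G = 1]%classic.

Lemma F_spec a : isE a (F a) /\ cf a (F a) = 1.
Proof.
rewrite /F; case: xgetP => [G -> //|nex].
by have [G EG nG] := isE_exists a; case: (nex G).
Qed.

Lemma isE_F a : isE a (F a). Proof. by case: (F_spec a). Qed.
Lemma cf_F a : cf a (F a) = 1. Proof. by case: (F_spec a). Qed.

Lemma isE_scaleF a G : isE a G -> G = cf a G *: F a.
Proof.
move=> EG; apply: isE_uniq EG _ _; last by rewrite linearZ /= cf_F mulr1.
rewrite -[_ *: _]addr0; apply: isE_lin (isE_F a) _.
split=> [i|b]; first by rewrite linear0 scaler0.
by rewrite linear0 eqxx.
Qed.

Lemma F_supp a b : cf b (F a) != 0 -> b = a \/ expo_lt b a.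
Proof. by move=> /(isE_supp (isE_F a))[]. Qed.

Lemma F_sum a b : cf b (F a) != 0 -> expo_sum b = expo_sum a.
Proof. by move=> /F_supp[->//|/expo_lt_sum]. Qed.

(** The change of basis from the monomials to the eigenvectors. *)
Definition Flin : P -> P := lin F.
HB.instance Definition _ := GRing.Linear.copy Flin (lin F).

Lemma FlinX a : Flin (Xm a) = F a. Proof. exact: linX. Qed.

Lemma Flin_eq0 g : Flin g = 0 -> g = 0.
Proof.
move=> e; apply: contrapT => /neq0_cf[b0 nz0].
have [b nz top] : exists2 b, cf b g != 0 & forall c, cf c g != 0 -> ~ expo_lt b c.
  pose s := [seq expo_height (ex m) | m <- msupp g].
  have in_s b : cf b g != 0 -> expo_height b \in s.
    by move=> nz; apply/mapP; exists (mn b); rewrite ?mcoeff_msupp ?mnK.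
  have : exists h, h \in s by exists (expo_height b0); apply: in_s.
  move=> exs; have bnd h : h \in s -> (h <= \max_(x <- s) x)%N.
    by move=> hs; apply: (@leq_bigmax_seq _ _ predT id).
  case: (ex_maxnP exs bnd) => h /mapP[m ms ->] hmax; exists (ex m).
    by rewrite /cf exK -mcoeff_msupp.
  by move=> c /in_s/hmax le /expo_height_lt; lia.
have : cf b (Flin g) = cf b g.
  rewrite -{1}(lin_id g) /lin -lock !linear_sum /= (bigD1_seq (mn b)) ?msupp_uniq ?mcoeff_msupp //=.
  rewrite big1_seq ?addr0; first by rewrite !linearZ /= FlinX mnK cf_F mulr1.
  move=> m /andP[mb mg]; rewrite !linearZ /= FlinX.
  have [->|nzF] := eqVneq (cf b (F (ex m))) 0; first by rewrite mulr0.
  case: (F_supp nzF) => [eb|lt]; first by rewrite eb exK eqxx in mb.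
  exfalso; apply: (top (ex m)) lt; rewrite /cf exK -mcoeff_msupp; exact: mg.
by rewrite e linear0 => /esym/eqP; rewrite (negPf nz).
Qed.

Lemma Flin_inj : injective Flin.
Proof.
move=> f g e; apply/eqP; rewrite -subr_eq0; apply/eqP/Flin_eq0.
by rewrite linearB /= e subrr.
Qed.

Lemma Flin_surjX a : exists2 g, Xm a = Flin g & forall b, cf b g != 0 -> expo_sum b = expo_sum a.
Proof.
move: {2}(expo_height a) (leqnn (expo_height a)) => h.
elim: h a => [|h IH] a leh.
  exists (Xm a); last by move=> b /cfX_neq0 ->.
  rewrite FlinX; apply/cfP => b; rewrite cfX; have [<-|ne] := eqVneq a b; first by rewrite cf_F.
  apply/eqP; rewrite eq_sym; apply: contraT => /F_supp[e|/expo_height_lt]; last by lia.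
  by rewrite e eqxx in ne.
have [g eg sg] : exists2 g, F a - Xm a = Flin g & forall b, cf b g != 0 -> expo_sum b = expo_sum a.
  have supp b : cf b (F a - Xm a) != 0 -> expo_lt b a.
    rewrite linearB /= cfX; have [<-|ne] := eqVneq a b; first by rewrite cf_F subrr eqxx.
    by rewrite subr0 => /F_supp[e|//]; rewrite e eqxx in ne.
  rewrite -(lin_id (F a - Xm a)) {1}/lin -lock.
  have : {subset msupp (F a - Xm a) <= msupp (F a - Xm a)} by [].
  elim: {1 3}(msupp (F a - Xm a)) => [|m s IHs] sub.
    by rewrite big_nil; exists 0 => [|b]; rewrite ?linear0 ?eqxx.
  rewrite big_cons; have [|g eg sg] := IHs; first by move=> x xs; apply: sub; rewrite inE xs orbT.
  have lt : expo_lt (ex m) a by apply: supp; rewrite /cf exK -mcoeff_msupp sub ?mem_head.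
  have [|g1 eg1 sg1] := IH (ex m); first by have := expo_height_lt lt; lia.
  exists ((F a - Xm a)@_m *: g1 + g); first by rewrite eg1 eg linearP.
  move=> b; rewrite linearP /= => nz; have [e|] := eqVneq (cf b g) 0; last exact: sg.
  rewrite -(expo_lt_sum lt); apply: sg1; apply: contraNneq nz => ->.
  by rewrite mulr0 e addr0.
exists (Xm a - g); first by rewrite linearB /= FlinX -eg opprB addrC subrK.
move=> b; rewrite linearB /= cfX; have [<-//|_] := eqVneq a b.
by rewrite sub0r oppr_eq0; apply: sg.
Qed.

Lemma Flin_surj f : exists2 g, f = Flin g &
  forall b, cf b g != 0 -> exists2 a, cf a f != 0 & expo_sum b = expo_sum a.
Proof.
rewrite -{1}(lin_id f) {1}/lin -lock.
have : {subset msupp f <= msupp f} by [].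
elim: {1 3}(msupp f) => [|m s IHs] sub.
  by rewrite big_nil; exists 0 => [|b]; rewrite ?linear0 ?eqxx.
rewrite big_cons; have [|g eg sg] := IHs; first by move=> x xs; apply: sub; rewrite inE xs orbT.
have [g1 eg1 sg1] := Flin_surjX (ex m).
exists (f@_m *: g1 + g); first by rewrite eg1 eg linearP.
move=> b; rewrite linearP /= => nz; have [e|] := eqVneq (cf b g) 0; last exact: sg.
exists (ex m); first by rewrite /cf exK -mcoeff_msupp sub ?mem_head.
by apply: sg1; apply: contraNneq nz => ->; rewrite mulr0 e addr0.
Qed.

(** * The maximal submodule *)

(** Condition (a), stated for any two entries instead of the extreme entries of
    the sorted exponent. *)
Definition good_a a := forall i j,
  (a i <= a j + l * r)%N /\ (a i = (a j + l * r)%N -> (j < i)%N).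

(** Condition (b): being below [k] at index [m] of the sorted exponent means
    that more than [m] entries are below [k]. *)
Definition good_b a := forall k m : nat, (m <= n')%N -> (0 < k)%N ->
  d 0 - d (- k%:Z) + r%:R * m%:R * l%:R / n%:R = k%:R ->
  (m < #|[set j | (a j < k)%N]|)%N.

Definition good a := good_a a /\ good_b a.

Lemma lr_gt0 : (0 < l * r)%N. Proof. by rewrite muln_gt0 l_gt0. Qed.

Lemma good0 : good expo0.
Proof.
split=> [i j|k m lem k0 _]; first by rewrite !ffunE; have := lr_gt0; lia.
rewrite (eq_card (B := [set: 'I_n])) ?cardsT ?card_ord //.
by move=> i; rewrite !inE ffunE k0.
Qed.

Lemma pos_ord k : k != ord0 -> (0 < k)%N.
Proof. by rewrite lt0n; apply: contraNN => /eqP e; apply/eqP/ord_inj. Qed.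

Lemma good_a_phi a : good_a (phi a) <-> good_a a.
Proof.
have lr := lr_gt0; split=> h i j.
  have := h (om n' i) (om n' j); rewrite !phi_om om_lt.
  have [->|i0] := eqVneq i ord0; have [->|j0] := eqVneq j ord0; rewrite /= ?i0 ?j0 ?addn0 ?addn1 ?andbF ?andbT.
  - by move=> _; rewrite ltnn; lia.
  - by move=> [h1 h2]; rewrite ltn0; lia.
  - by move=> [h1 h2]; rewrite pos_ord //; lia.
  - by rewrite ?(negPf i0) ?(negPf j0).
rewrite -(permKV (om n') i) -(permKV (om n') j).
set i' := ((om n')^-1)%g i; set j' := ((om n')^-1)%g j.
have := h i' j'; rewrite !phi_om om_lt.
have [->|i0] := eqVneq i' ord0; have [->|j0] := eqVneq j' ord0; rewrite /= ?i0 ?j0 ?addn0 ?addn1 ?andbF ?andbT.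
- by move=> _; lia.
- by rewrite ltn0; move=> [h1 h2]; lia.
- by rewrite pos_ord //; move=> [h1 h2]; lia.
- by rewrite ?(negPf i0) ?(negPf j0).
Qed.

Lemma card_phi_lt a : #|[set j | (phi a j < (a ord0).+1)%N]| = rk a ord0.
Proof.
rewrite /rk -(card_preimset _ (@perm_inj _ (om n'))); apply: eq_card => j.
rewrite !inE phi_om /before; have [->|j0] := eqVneq j ord0.
  by rewrite addn1 !ltnn andbF.
by rewrite addn0 pos_ord // andbT ltnS leq_eqVlt orbC.
Qed.

Lemma card_lt_rk0 a : #|[set j | (a j < (a ord0).+1)%N]| = (rk a ord0).+1.
Proof.
rewrite (cardsD1 ord0) inE ltnSn add1n; congr _.+1; apply: eq_card => j.
rewrite !inE /before; have [->|j0] := eqVneq j ord0; first by rewrite ltnn andbF.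
by rewrite pos_ord // andbT ltnS leq_eqVlt orbC.
Qed.

Lemma card_phi_le a (k : nat) : (#|[set j | (phi a j < k)%N]| <= #|[set j | (a j < k)%N]|)%N.
Proof.
rewrite -(card_preimset _ (@perm_inj _ (om n'))); apply: subset_leq_card.
by apply/fintype.subsetP => j; rewrite !inE phi_om; lia.
Qed.

Lemma n_neq0 : n%:R != 0 :> K. Proof. by rewrite pnatr_eq0. Qed.

(** So y_n kills [F (phi a)] exactly when k = a_0 + 1 and m = rk a 0 solve the
    equation of condition (b). *)
Lemma ev0_eq0 a (m : nat) : rk a ord0 = m -> (ev ord0 a == 0) =
  (d 0 - d (- (a ord0).+1%:Z) + r%:R * m%:R * l%:R / n%:R == (a ord0).+1%:R).
Proof.
move=> em; rewrite /ev em c0E -subr_eq0 [RHS]eq_sym -[RHS]subr_eq0.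
congr (_ == _); first by field; rewrite nat1r n_neq0.
Qed.

Lemma good_phi a : good (phi a) -> good a.
Proof.
move=> [/good_a_phi ha hb]; split=> // k m lem k0 e.
by apply: leq_trans (hb k m lem k0 e) (card_phi_le a k).
Qed.

Lemma good_phi_ev a : good (phi a) -> ev ord0 a != 0.
Proof.
move=> [_ hb]; apply/negP; rewrite (ev0_eq0 erefl) => /eqP e.
have lem : (rk a ord0 <= n')%N by rewrite -ltnS rk_bound.
by have := hb _ _ lem (ltn0Sn _) e; rewrite card_phi_lt ltnn.
Qed.

(** Passing from [a] to [phi a] can violate (b) for k = a_0 + 1 only, where the
    number of entries below [k] drops from rk a 0 + 1 to rk a 0; so m = rk a 0
    solves the equation. *)
Lemma bad_phi_ev a : good a -> ~ good (phi a) -> ev ord0 a = 0.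
Proof.
move=> [ha hb] nb; apply/eqP; apply: contrapT => nz; apply: nb.
split; first exact/good_a_phi.
move=> k m lem k0 e; rewrite ltnNge; apply/negP => le.
have lt := hb k m lem k0 e; apply: nz.
have ak : (a ord0).+1 = k.
  apply: contrapT => ne; suff : #|[set j | (a j < k)%N]| = #|[set j | (phi a j < k)%N]| by lia.
  rewrite -[in RHS](card_preimset _ (@perm_inj _ (om n'))); apply: eq_card => j.
  by rewrite !inE phi_om; case: eqP => [->|_]; rewrite ?addn0 ?addn1 //; lia.
move: le lt; rewrite -ak card_lt_rk0 card_phi_lt => le lt.
by rewrite (@ev0_eq0 a m); [apply/eqP; rewrite ak|lia].
Qed.

(** ** Adjacent swaps and goodness *)

Lemma good_b_swap i j a : good_b a -> good_b (swap i j a).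
Proof.
move=> h k m lem k0 e; rewrite -(card_preimset _ (@perm_inj _ (tperm i j))).
rewrite (eq_card (B := [set x | (a x < k)%N])); first exact: h.
by move=> x; rewrite !inE ffunE tpermK.
Qed.

Section AdjacentGood.
Variables (i j : 'I_n).
Hypothesis ij : j = i.+1 :> nat.

Lemma tperm_lt (x y : 'I_n) : (x < y)%N -> ~~ ((x == i) && (y == j)) -> (tperm i j x < tperm i j y)%N.
Proof.
move=> xy; rewrite -!val_eqE /= => h.
case: tpermP => [ex|ex|/eqP xi /eqP xj]; case: tpermP => [ey|ey|/eqP yi /eqP yj]; move: xy h;
  rewrite ?ex ?ey ?ij ?eqxx //; try (move: xi xj; rewrite -!val_eqE /= ij);
  try (move: yi yj; rewrite -!val_eqE /= ij); lia.
Qed.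

Lemma good_a_swap_down a : (a i < a j)%N -> good_a (swap i j a) -> good_a a.
Proof.
move=> aij h x y; have := h (tperm i j x) (tperm i j y); rewrite !ffunE !tpermK.
move=> [le ord]; split=> // e; have lt := ord e.
rewrite -(tpermK i j x) -(tpermK i j y); apply: tperm_lt => //.
apply/negP => /andP[/eqP ey /eqP ex].
have := tpermK i j x; have := tpermK i j y; rewrite ex ey tpermL tpermR => yj xi.
by move: e; rewrite -xi -yj; lia.
Qed.

Lemma good_a_swap_pair a : good_a (swap i j a) -> ~ good_a a ->
  a i = (a j + l * r)%N.
Proof.
move=> h na; apply: contrapT => ne; apply: na => x y.
have := h (tperm i j x) (tperm i j y); rewrite !ffunE !tpermK.
move=> [le ord]; split=> // e; have lt := ord e.
rewrite -(tpermK i j x) -(tpermK i j y); apply: tperm_lt => //.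
apply/negP => /andP[/eqP ey /eqP ex].
have := tpermK i j x; have := tpermK i j y; rewrite ex ey tpermL tpermR => yj xi.
have := h j i; rewrite !ffunE tpermL tpermR; move: ne e; rewrite -xi -yj => ne e [h1 _].
by have := lr_gt0; lia.
Qed.

Lemma n_kap a : a i = a j %[mod r] ->
  kap i j a * (n%:R * (ev i a - ev j a)) = (r * l)%:R.
Proof.
move=> e; rewrite mulrCA kapE // /rho e eqxx c0E natrM; field.
by rewrite nat1r n_neq0.
Qed.

(** If kap = 1, then n divides rk a j - rk a i - 1, which is smaller than n,
    hence zero, and a_i = a_j follows. If kap = -1, then a_j = a_i + l r, and
    the order of the positions in (a) fails after the swap. *)
Lemma kap_one_bad a : (a i < a j)%N -> kap i j a ^+ 2 = 1 -> ~ good_a (swap i j a).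
Proof.
move=> aij k1 h.
have e : a i = a j %[mod r].
  apply/eqP; apply: contraT => /negPf ne; move/eqP: k1.
  by rewrite /kap /rho ne mulr0 mul0r expr0n /= eq_sym oner_eq0.
have bf : before a i j by rewrite /before aij.
have rij := rk_lt bf; have bi := rk_bound a i; have bj := rk_bound a j.
have /dvdnP[t et] : (r %| a j - a i)%N by rewrite -eqn_mod_dvd ?e // ltnW.
have := n_kap e; rewrite (ev_sub e).
have [{}k1|{}k1] : kap i j a = 1 \/ kap i j a = -1.
  by move/eqP: k1; rewrite sqrf_eq1 => /orP[]/eqP; [left|right].
  rewrite k1 mul1r => /eqP; rewrite subr_eq -natrD eqr_nat => /eqP e2.
  have e3 : (n * t = l * (rk a j - rk a i - 1))%N.
    apply/eqP; rewrite -(eqn_pmul2l r_gt0); apply/eqP.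
    have -> : (rk a j - rk a i - 1 = rk a j - (rk a i).+1)%N by lia.
    by rewrite mulnBr mulnBr; move: e2 et; nia.
  have : (n %| rk a j - rk a i - 1)%N by rewrite -(@Gauss_dvdr _ l) 1?coprime_sym // -e3 dvdn_mulr.
  have [z|p] := posnP (rk a j - rk a i - 1)%N; last by move/(dvdn_leq p); lia.
  by move=> _; move: e3; rewrite z muln0 => /eqP; rewrite muln_eq0 /= => /eqP t0; rewrite t0 in et; lia.
rewrite k1 mulN1r opprB => /eqP; rewrite subr_eq -natrD eqr_nat => /eqP e2.
have e3 : (n * t = l * (rk a j - rk a i).+1)%N.
  apply/eqP; rewrite -(eqn_pmul2l r_gt0); apply/eqP.
  have -> : ((rk a j - rk a i).+1 = (rk a j).+1 - rk a i)%N by lia.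
  by rewrite mulnBr mulnBr; move: e2 et; nia.
have : (n %| (rk a j - rk a i).+1)%N by rewrite -(@Gauss_dvdr _ l) 1?coprime_sym // -e3 dvdn_mulr.
move/(dvdn_leq (ltn0Sn _)) => le.
have en : (rk a j - rk a i).+1 = n by lia.
have et2 : t = l.
  by apply/eqP; rewrite -(eqn_pmul2l (ltn0Sn n')) e3 en mulnC.
have := h i j; rewrite !ffunE tpermL tpermR => -[_].
have -> : a j = (a i + l * r)%N by rewrite -et2 -et; lia.
by move=> /(_ erefl); rewrite ij; lia.
Qed.

Lemma rk_extreme a : good_a (swap i j a) -> a i = (a j + l * r)%N ->
  rk a i = n' /\ rk a j = 0%N.
Proof.
move=> h e; have lr := lr_gt0; have nij := adj_neq ij.
have nji : j != i by rewrite eq_sym.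
split.
  rewrite /rk (eq_card (B := [set~ i])); first by rewrite cardsC1 card_ord.
  move=> x; rewrite !inE /before; have [->|xi] := eqVneq x i; first by rewrite !ltnn andbF.
  have [->|xj] := eqVneq x j; first by rewrite e; lia.
  have := h x i; rewrite !ffunE tpermL tpermD 1?eq_sym // -e => -[le lt].
  by move: xi; rewrite -val_eqE /=; lia.
apply/eqP; rewrite cards_eq0; apply/eqP/setP => x; rewrite !inE /before.
have [->|xj] := eqVneq x j; first by rewrite !ltnn andbF.
have [->|xi] := eqVneq x i; first by rewrite e; lia.
have := h j x; rewrite !ffunE tpermR tpermD 1?eq_sym // e => -[le lt].
by move: xj; rewrite -val_eqE /=; lia.
Qed.

(** Here a_i = a_j + l r, with [i] and [j] of extreme ranks, so kap = 1 and
    [sig] composed with [sig] is zero. The second factor raises the exponent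
    and so keeps the leading coefficient; hence already the first one gives
    zero. *)
Lemma sig_bad_good a : ~ good a -> good (swap i j a) -> sig i j a (F a) = 0.
Proof.
move=> na [ha hb].
have na' : ~ good_a a.
  by move=> h; apply: na; split=> //; rewrite -(swapK i j a); apply: good_b_swap.
have e := good_a_swap_pair ha na'; have [ri rj] := rk_extreme ha e.
have aij : a i != a j by rewrite neq_ltn e; have := lr_gt0; lia.
have em : a i = a j %[mod r] by rewrite e addnC modnMDl.
have k1 : kap i j a = 1.
  have := n_kap em; rewrite (ev_sub em) ri rj e muln0 addn0.
  have -> : (n * (a j + l * r))%:R - (n * a j + r * l * n')%:R = (r * l)%:R :> K.
    by apply/eqP; rewrite subr_eq -natrD eqr_nat; apply/eqP; nia.
  move=> /eqP; rewrite -subr_eq0 -{2}[(r * l)%:R]mul1r -mulrBl mulf_eq0 subr_eq0.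
  by rewrite pnatr_eq0 muln_eq0 !gtn_eqF // !orbF => /eqP.
apply: contrapT => nz.
have EG := isE_sig ij aij (isE_F a).
have up : (swap i j a i < swap i j a j)%N.
  by rewrite !ffunE tpermL tpermR e; have := lr_gt0; lia.
have := cf_sig_up ij up EG; rewrite sig_sig // k1 expr1n subrr scale0r linear0.
by move/esym/eqP; apply/negP; apply: isE_neq0 EG nz.
Qed.

Lemma sig_up_good a : (a i < a j)%N -> good (swap i j a) ->
  good a /\ 1 - kap i j a ^+ 2 != 0.
Proof.
move=> aij [ha hb]; split.
  split; first exact: good_a_swap_down ha.
  by rewrite -(swapK i j a); apply: good_b_swap.
by rewrite subr_eq0 eq_sym; apply/eqP => /(kap_one_bad aij).
Qed.

End AdjacentGood.

(** ** Bad eigenvectors span a submodule *)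

Definition Bad f := exists2 g, (forall b, cf b g != 0 -> ~ good b) & f = Flin g.

Lemma Bad_lin c f g : Bad f -> Bad g -> Bad (c *: f + g).
Proof.
move=> [f' Hf ->] [g' Hg ->]; exists (c *: f' + g'); last by rewrite linearP.
move=> b; rewrite linearP /= => nz; have [e|] := eqVneq (cf b g') 0; last exact: Hg.
by apply: Hf; apply: contraNneq nz => ->; rewrite mulr0 e addr0.
Qed.

Lemma Bad0 : Bad 0.
Proof. by exists 0 => [b|]; rewrite ?linear0 ?eqxx. Qed.

Lemma Bad_scale c f : Bad f -> Bad (c *: f).
Proof. by move=> Bf; rewrite -[_ *: _]addr0; apply: Bad_lin Bad0. Qed.

Lemma Bad_isE a G : ~ good a -> isE a G -> Bad G.
Proof.
move=> na EG; exists (cf a G *: Xm a); last by rewrite linearZ /= FlinX -isE_scaleF.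
move=> b; rewrite linearZ /=; have [->|] := eqVneq (cf b (Xm a)) 0; first by rewrite mulr0 eqxx.
by move=> /cfX_neq0 <-.
Qed.

Lemma Bad_map (A : P -> P) : linear A -> (forall a, ~ good a -> Bad (A (F a))) ->
  forall f, Bad f -> Bad (A f).
Proof.
move=> linA HA f [g Hg ->].
have A0 : A 0 = 0 by have := linA (-1) 0 0; rewrite scaler0 addr0 scaleN1r addNr.
rewrite -(lin_id g) /lin -lock (linear_sum Flin) /=.
have : {subset msupp g <= msupp g} by [].
elim: {1 3}(msupp g) => [|m s IHs] sub; first by rewrite big_nil A0; apply: Bad0.
rewrite big_cons linearZ /= FlinX linA; apply: Bad_lin.
  by apply/HA/Hg; rewrite /cf exK -mcoeff_msupp sub ?mem_head.
by apply: IHs => x xs; apply: sub; rewrite inE xs orbT.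
Qed.

(** The transposition is [sig] minus a scalar, and [sig] leads from a bad
    exponent to a good one with coefficient zero. *)
Lemma Bad_adj i j f : j = i.+1 :> nat -> Bad f -> Bad (pm (tperm i j) f).
Proof.
move=> ij; apply: Bad_map => [|a na]; first exact: linearP.
have -> : pm (tperm i j) (F a) = sig i j a (F a) - kap i j a *: F a by rewrite addrK.
rewrite addrC -scaleNr; apply: Bad_lin; first exact: Bad_isE na (isE_F a).
have [e|ne] := eqVneq (a i) (a j); first by rewrite sig_eq0 //; [apply: Bad0|apply: isE_F].
have [g|ng] := pselect (good (swap i j a)); first by rewrite sig_bad_good //; apply: Bad0.
by apply: Bad_isE ng _; apply: isE_sig (isE_F a).
Qed.

Lemma pmM u w f : pm u (pm w f) = pm (w * u)%g f.
Proof.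
elim/mpoly_span_ind: f => [|c f g IHf IHg|a]; rewrite ?linear0 //.
  by rewrite !linearP /= IHf IHg.
rewrite !pmX; congr Xm; apply/ffunP => k; rewrite !ffunE.
by rewrite invMg permM.
Qed.

Lemma pm1 f : pm 1%g f = f.
Proof.
elim/mpoly_span_ind: f => [|c f g IHf IHg|a]; rewrite ?linear0 //.
  by rewrite !linearP /= IHf IHg.
by rewrite pmX; congr Xm; apply/ffunP => k; rewrite ffunE invg1 perm1.
Qed.

(** Adjacent transpositions generate the symmetric group. *)
Lemma adj_generate (U : P -> Prop) :
  (forall i j f, j = i.+1 :> nat -> U f -> U (pm (tperm i j) f)) ->
  forall w f, U f -> U (pm w f).
Proof.
move=> Uadj.
have Ut m i j f : (j - i <= m)%N -> (i < j)%N -> U f -> U (pm (tperm i j) f).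
  elim: m i j f => [|m IH] i j f le lt Uf; first by lia.
  have ltk : (j.-1 < n)%N by have := ltn_ord j; lia.
  pose k : 'I_n := Ordinal ltk; have ek : j = k.+1 :> nat by rewrite /=; lia.
  have [eik|nik] := eqVneq i k; first by apply: (Uadj); rewrite // eik.
  have jk : j != k by rewrite -val_eqE /=; lia.
  have ij : j != i by rewrite -val_eqE /=; lia.
  have -> : tperm i j = (tperm k j * (tperm i k * tperm k j))%g.
    have := tpermJ i k (tperm k j); rewrite /conjg tpermV tpermL tpermD => [<- //||//].
    by rewrite eq_sym.
  rewrite -!pmM; apply: (Uadj) => //; apply: IH; last exact: Uadj.
    by rewrite /=; lia.
  by move: nik; rewrite -val_eqE /=; lia.
move=> w f Uf; have [ts -> ats] := prod_tpermP w.
elim: ts ats f Uf => [|[x y] s IH] /= ats f Uf; first by rewrite big_nil pm1.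
rewrite big_cons -pmM; move: ats => /andP[xy ats]; apply: IH => //=.
have := xy; rewrite /dpair /= -val_eqE neq_ltn => /orP[lt|lt]; first exact: Ut lt Uf.
by rewrite tpermC; apply: Ut lt Uf.
Qed.

Lemma Bad_pm w f : Bad f -> Bad (pm w f).
Proof. by move: w f; apply: adj_generate => i j f; apply: Bad_adj. Qed.

Lemma Bad_Phi f : Bad f -> Bad (Phi f).
Proof.
apply: Bad_map => [|a na]; first exact: Phi_is_linear.
by apply: (Bad_isE (a := phi a)); [move=> /good_phi|apply/isE_Phi/isE_F].
Qed.

Lemma Bad_mulX i f : Bad f -> Bad ('X_i * f).
Proof.
move=> Bf.
have -> : 'X_i * f = pm (tperm i ord_max) (Phi (pm ((om n')^-1)%g (pm (tperm i ord_max) f))).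
  by rewrite /Phi (pmM (om n')) mulVg pm1 pm_mulX tpermR pm_tpermK.
by apply/Bad_pm/Bad_Phi/Bad_pm/Bad_pm.
Qed.

Lemma Phi_F a : Phi (F a) = F (phi a).
Proof.
have := isE_scaleF (isE_Phi (isE_F a)).
by rewrite cf_Phi cf_F scale1r.
Qed.

Lemma Y_F_phi a : Y ord_max (F (phi a)) = ev ord0 a *: pm (om n') (F a).
Proof.
rewrite -Phi_F /Phi -om0 -pm_mulX -pm_Y // -linearZ /=; congr (pm _ _).
have [/(_ ord0) <- _] := isE_F a.
by rewrite /Z big_pred0 ?scaler0 ?addr0 // => j; rewrite ltn0.
Qed.

Lemma Y_F_max0 a : a ord_max = 0%N -> Y ord_max (F a) = 0.
Proof.
move=> a0; have [/(_ ord_max) ZF clF] := isE_F a.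
have rk0 : rk a ord_max = 0%N.
  apply/eqP; rewrite cards_eq0; apply/eqP/setP => x; rewrite !inE /before a0 ltn0 /=.
  by apply/negP => /andP[_]; rewrite /= ltnNge -ltnS ltn_ord.
have : 'X_ord_max * Y ord_max (F a) = 0.
  rewrite mulX_Y_max ZF (Dg_class d_per (q := a ord_max)); last by move=> b /clF.
  rewrite /ev rk0 a0 -{2}[F a]scale1r -scalerBl -scalerDl oppr0.
  by rewrite -[RHS](scale0r (F a)); congr (_ *: _); ring.
move/eqP; rewrite mulf_eq0 => /orP[|/eqP//].
by rewrite -msupp_eq0 msuppX.
Qed.

(** By equivariance only the last variable matters, where y_n [F (phi b)] is
    [ev ord0 b] times a rotation of [F b], and the factor is zero when [b] is
    good. *)
Lemma Bad_Y i f : Bad f -> Bad (Y i f).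
Proof.
move=> Bf.
have -> : Y i f = pm (tperm i ord_max) (Y ord_max (pm (tperm i ord_max) f)).
  by rewrite pm_Y // tpermR pm_tpermK.
apply/Bad_pm; move/(Bad_pm (tperm i ord_max)): Bf; move: (pm _ f) => {}f.
apply: Bad_map => [|a na]; first exact: linearP.
have [a0|/phi_surj[b eb]] := posnP (a ord_max); first by rewrite Y_F_max0 //; apply: Bad0.
rewrite -eb Y_F_phi; have [gb|nb] := pselect (good b).
  by rewrite bad_phi_ev // ?scale0r ?eb //; apply: Bad0.
by apply/Bad_scale/Bad_pm; apply: Bad_isE nb (isE_F b).
Qed.

(** The spectral projections of zeta_i. *)
Definition cls i (q : nat) : P -> P :=
  lin (fun a => (if a i == q %[mod r] then 1 else 0) *: Xm a).
HB.instance Definition _ i q := GRing.Linear.copy (cls i q)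
  (lin (fun a => (if a i == q %[mod r] then 1 else 0) *: Xm a)).

Lemma cf_cls i (q : nat) f b : cf b (cls i q f) = if b i == q %[mod r] then cf b f else 0.
Proof.
elim/mpoly_span_ind: f => [|c f g IHf IHg|a].
- by rewrite !linear0 if_same.
- by rewrite !linearP /= IHf IHg; case: ifP => // _; rewrite mulr0 addr0.
rewrite /cls linX linearZ /= cfX; have [->|_] := eqVneq a b; last by rewrite mulr0 if_same.
by rewrite mulr1.
Qed.

Lemma cls_F i (q : nat) a : cls i q (F a) = (if a i == q %[mod r] then 1 else 0) *: F a.
Proof.
apply/cfP => b; rewrite cf_cls linearZ /=; have [_ clF] := isE_F a.
have [->|nz] := eqVneq (cf b (F a)) 0; first by rewrite mulr0 if_same.
by rewrite (clF b nz); case: ifP; rewrite ?mul1r ?mul0r.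
Qed.

Lemma Bad_cls i (q : nat) f : Bad f -> Bad (cls i q f).
Proof.
apply: Bad_map => [|a na]; first exact: linearP.
by rewrite cls_F; apply/Bad_scale/Bad_isE/isE_F.
Qed.

(** The submodules of the polynomial representation; the diagonal matrices
    enter through their spectral projections. *)
Record stable (U : P -> Prop) : Prop := Stable {
  stable_sub : subspace U;
  stable_mulX : forall i f, U f -> U ('X_i * f);
  stable_Y : forall i f, U f -> U (Y i f);
  stable_pm : forall w f, U f -> U (pm w f);
  stable_cls : forall i q f, U f -> U (cls i q f) }.

Lemma Bad_stable : stable Bad.
Proof.
split; [split; [exact: Bad0|exact: Bad_lin]|exact: Bad_mulX|exact: Bad_Y|exact: Bad_pm|exact: Bad_cls].
Qed.

Lemma F0 : F expo0 = Xm expo0.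
Proof.
apply/cfP => b; rewrite cfX; have [<-|nb] := eqVneq expo0 b; first by rewrite cf_F.
apply/eqP; apply: contraT => /F_supp[e|/expo_lt0//]; by rewrite e eqxx in nb.
Qed.

Lemma Xm0 : Xm expo0 = 1.
Proof. exact: Xm_zero. Qed.

Lemma Bad_one : ~ Bad 1.
Proof.
move=> [g Hg]; rewrite -Xm0 -F0 -FlinX => /Flin_inj eg.
by case: (Hg expo0); rewrite -?eg ?cfX ?eqxx ?oner_eq0 //; apply: good0.
Qed.

Lemma S_cls i j f : S i j f =
  r%:R *: \sum_(q < r) pm (tperm i j) (cls i q (cls j q f)).
Proof.
elim/mpoly_span_ind: f => [|c f g IHf IHg|a].
- by rewrite !linear0 big1 ?scaler0 // => q _; rewrite !linear0.
- rewrite !linearP /= IHf IHg [in RHS](eq_bigr (fun q : 'I_r => c *: pm (tperm i j) (cls i q (cls j q f)) +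
    pm (tperm i j) (cls i q (cls j q g)))) => [|q _]; last by rewrite (linearP (cls j q)) (linearP (cls i q)) linearP.
  by rewrite big_split -scaler_sumr /= -!mul_mpolyC; ring.
have clsX k (q : nat) b : cls k q (Xm b) = (if b k == q %[mod r] then 1 else 0) *: Xm b.
  exact: linX.
rewrite (bigD1 (Ordinal (ltn_pmod (a j) r_gt0))) //= big1 ?addr0 => [|q qj]; last first.
  rewrite clsX [(q %% r)%N]modn_small // eq_sym.
  move: qj; rewrite -val_eqE /= => /negPf ->.
  by rewrite scale0r !linear0.
rewrite clsX modn_mod eqxx scale1r clsX modn_mod SX /Smon linearZ /= pmX -swap_act scalerA.
by case: ifP; rewrite ?mulr1 ?mulr0.
Qed.

Definition diag (la : expo -> K) : P -> P := lin (fun a => la a *: Xm a).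

Lemma cf_diag la g b : cf b (diag la g) = la b * cf b g.
Proof.
rewrite /diag; elim/mpoly_span_ind: g => [|c f g IHf IHg|a].
- by rewrite !linear0 mulr0.
- by rewrite !linearP /= IHf IHg; ring.
by rewrite linX linearZ /= cfX; have [->|_] := eqVneq a b; rewrite ?mulr0.
Qed.

Lemma diag_Flin (A : {linear P -> P}) la g : (forall a, A (F a) = la a *: F a) ->
  A (Flin g) = Flin (diag la g).
Proof.
move=> AF; rewrite /diag; elim/mpoly_span_ind: g => [|c f g IHf IHg|a].
- by rewrite !linear0.
- by rewrite !linearP /= IHf IHg.
by rewrite linX [RHS]linearZ /= FlinX AF.
Qed.

Section StableSubspace.
Variable U : P -> Prop.
Hypothesis stU : stable U.

Let subU := stable_sub stU.

Lemma st_S i j f : U f -> U (S i j f).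
Proof.
move=> Uf; rewrite S_cls; apply/(sp_scale subU)/(sp_sum subU) => q _.
by apply/(stable_pm stU)/(stable_cls stU)/(stable_cls stU).
Qed.

Lemma st_Z i f : U f -> U (Z i f).
Proof.
move=> Uf; apply: (sp_add subU); first exact/(stable_Y stU)/(stable_mulX stU).
by apply/(sp_scale subU)/(sp_sum subU) => j _; apply: st_S.
Qed.

(** Joint eigenvalues separate the [F a], so a stable subspace contains every
    eigenvector occurring in one of its members. *)
Lemma st_spectral g a : U (Flin g) -> cf a g != 0 -> U (F a).
Proof.
move: {2}(size (msupp g)) (leqnn (size (msupp g))) => m.
elim: m g => [|m IH] g les Ug nza.
  by move: nza; rewrite -mcoeff_msupp; case: (msupp g) les.
have step (A : {linear P -> P}) la b : (forall f, U f -> U (A f)) ->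
    (forall c, A (F c) = la c *: F c) -> cf b g != 0 -> la b = 0 -> la a != 0 -> U (F a).
  move=> UA AF nzb lb0 la0; apply: (IH (diag la g)); last 1 first.
  - by rewrite cf_diag mulf_neq0.
  - rewrite -ltnS; apply: leq_trans les.
    have sub : {subset mn b :: msupp (diag la g) <= msupp g}.
      move=> x; rewrite inE => /orP[/eqP ->|]; first by rewrite mcoeff_msupp.
      rewrite !mcoeff_msupp -[x]exK -!/(cf _ _) cf_diag.
      by apply: contraNneq => ->; rewrite mulr0.
    apply: (uniq_leq_size _ sub); rewrite /= msupp_uniq andbT mcoeff_msupp -/(cf _ _).
    by rewrite cf_diag lb0 mul0r eqxx.
  by rewrite -(diag_Flin _ AF); apply: UA.
have [[b [nzb ba]]|nb] := pselect (exists b, cf b g != 0 /\ b <> a); last first.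
  have eg : g = cf a g *: Xm a.
    apply/cfP => b; rewrite linearZ /= cfX; have [<-|ab] := eqVneq a b; first by rewrite mulr1.
    rewrite mulr0; apply/eqP; apply: contraT => nzb; case: nb; exists b; split=> //.
    by move=> e; rewrite e eqxx in ab.
  move: Ug; rewrite eg linearZ /= FlinX => /(sp_scale subU (cf a g)^-1).
  by rewrite scalerA mulVf // scale1r.
have [[i ni]|ncl] := pselect (exists i, b i <> a i %[mod r]).
  apply: (step (cls i (a i)) (fun c => if c i == a i %[mod r] then 1 else 0) b) => //.
  - by move=> f; apply: (stable_cls stU).
  - by move=> c; apply: cls_F.
  - by case: eqP.
  - by rewrite eqxx oner_eq0.
have cl i : b i = a i %[mod r] by apply: contrapT => h; apply: ncl; exists i.
have [i ni] : exists i, ev i a != ev i b.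
  apply: contrapT => h; apply: ba; apply: ev_sep => // i.
  by apply/eqP; apply: contraT => ne; case: h; exists i; rewrite eq_sym.
have linA : linear (fun f => Z i f - ev i b *: f).
  by move=> c f h; rewrite linearP /= -!mul_mpolyC; ring.
pose A : {linear P -> P} := HB.pack_for {linear P -> P} (fun f => Z i f - ev i b *: f)
  (@GRing.isLinear.Build K P P *:%R _ linA).
apply: (step A (fun c => ev i c - ev i b) b) => //.
- move=> f Uf /=; rewrite -scaleNr; apply: (sp_add subU); [exact: st_Z|exact: (sp_scale subU)].
- by move=> c /=; have [/(_ i) -> _] := isE_F c; rewrite -scalerBl.
- by rewrite subrr.
- by rewrite subr_eq0.
Qed.

(** On the good exponents all the coefficients met on the way down to 0 are
    invertible. *)
Lemma st_descend a : good a -> U (F a) -> U 1.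
Proof.
rewrite -Xm0 -F0; elim/expo_phi_swap_ind: a => [//|a IH|a i j ij aij IH] ga Ua.
  apply: IH; first exact: good_phi.
  have := stable_Y stU ord_max Ua; rewrite Y_F_phi => /(sp_scale subU (ev ord0 a)^-1).
  rewrite scalerA (mulVf (good_phi_ev ga)) scale1r => /(stable_pm stU ((om n')^-1)%g).
  by rewrite pmM mulgV pm1.
have [ga' k1] := sig_up_good ij aij ga; apply: (IH ga').
have ne : a i != a j by rewrite neq_ltn aij.
have eF : F (swap i j a) = sig i j a (F a).
  have := isE_scaleF (isE_sig ij ne (isE_F a)).
  by rewrite cf_sig_up ?cf_F ?scale1r //; apply: isE_F.
have : U (sig i j (swap i j a) (F (swap i j a))).
  by apply: (sp_add subU); [apply: (stable_pm stU)|apply: (sp_scale subU)].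
rewrite eF (sig_sig ij (F a) ne) => /(sp_scale subU (1 - kap i j a ^+ 2)^-1).
by rewrite scalerA (mulVf k1) scale1r.
Qed.

Lemma stable_dichotomy f : U f -> ~ Bad f -> U 1.
Proof.
have [g -> _] := Flin_surj f; move=> Ug nB.
have [a [nz ga]] : exists a, cf a g != 0 /\ good a.
  apply: contrapT => h; apply: nB; exists g => // b nz gb; apply: h.
  by exists b.
exact: st_descend ga (st_spectral Ug nz).
Qed.

End StableSubspace.

(** ** The grading element when d is constant *)

Section Euler.
Hypothesis d_const : forall j : int, d j = d 0.

Definition eulerC : K := \sum_(i < n) (1 - r%:R * c0 * i%:R).

(** For constant [d] the sum of the z_i is the Euler operator up to a constant. *)
Lemma sum_ev a : \sum_i ev i a = (expo_sum a)%:R + eulerC.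
Proof.
rewrite /eulerC [X in _ + X](reindex_inj (@rko_inj n a)) /= natr_sum -big_split /=.
by apply: eq_bigr => i _; rewrite /ev (d_const (- (a i).+1%:Z)) -natr1; ring.
Qed.

(** The product of the (Euler operator - m) for 1 <= m <= D, where D is the
    degree, removes all components of positive degree and multiplies the
    constant term by a nonzero integer. *)
Lemma euler_const (U : P -> Prop) f : subspace U -> (forall i f, U f -> U (Z i f)) ->
  U f -> cf expo0 f != 0 -> U 1.
Proof.
move=> subU UZ Uf nz; have [g eg _] := Flin_surj f.
pose A (m : nat) h := \sum_i Z i h - (m%:R + eulerC) *: h.
have UA m h : U h -> U (A m h).
  move=> Uh; rewrite /A -scaleNr; apply: (sp_add subU); last exact: (sp_scale subU).
  by apply: (sp_sum subU) => i _; apply: UZ.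
have linA m : linear (A m).
  move=> c h h'; rewrite /A (eq_bigr (fun i => c *: Z i h + Z i h')) => [|i _]; last by rewrite linearP.
  by rewrite big_split -scaler_sumr /= -!mul_mpolyC; ring.
have AF m a : A m (F a) = ((expo_sum a)%:R - m%:R) *: F a.
  rewrite /A (eq_bigr (fun i => ev i a *: F a)) => [|i _]; last by have [->] := isE_F a.
  by rewrite -scaler_suml sum_ev -scalerBl; congr (_ *: _); ring.
have key (D : nat) : U (Flin (diag (fun a => \prod_(1 <= m < D.+1) ((expo_sum a)%:R - m%:R)) g)).
  elim: D => [|D IH].
    have -> : diag (fun a => \prod_(1 <= m < 1) ((expo_sum a)%:R - m%:R)) g = g.
      by apply/cfP => b; rewrite cf_diag big_geq // mul1r.
    by rewrite -eg.
  have -> : diag (fun a => \prod_(1 <= m < D.+2) ((expo_sum a)%:R - m%:R)) g =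
     diag (fun a => (expo_sum a)%:R - D.+1%:R) (diag (fun a => \prod_(1 <= m < D.+1) ((expo_sum a)%:R - m%:R)) g).
    by apply/cfP => b; rewrite !cf_diag big_nat_recr //= mulrA [_ * \prod_(_ <= _ < _) _]mulrC.
  pose A' : {linear P -> P} := HB.pack_for {linear P -> P} (A D.+1)
    (@GRing.isLinear.Build K P P *:%R _ (linA D.+1)).
  by rewrite -(diag_Flin (A := A') _ (AF D.+1)); apply: UA.
have nzg : cf expo0 g != 0.
  move: nz; rewrite eg; apply: contraNneq => g0.
  rewrite -(lin_id g) /lin -lock !linear_sum /=; apply/eqP/big1 => m _.
  rewrite !linearZ /= FlinX; have [->|nF] := eqVneq (cf expo0 (F (ex m))) 0; first by rewrite mulr0.
  have [e|/expo_lt_sum e] := F_supp nF; first by rewrite -[m]exK -/(cf _ _) -e g0 mul0r.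
  suff em : ex m = expo0 by rewrite -[m]exK -/(cf _ _) em g0 mul0r.
  apply/ffunP => i; move: e; rewrite {1}/expo_sum big1 => [|k _]; last by rewrite ffunE.
  move/esym/eqP; rewrite sum_nat_eq0 => /forallP/(_ i)/eqP ->; by rewrite ffunE.
pose D := \max_(m <- msupp g) expo_sum (ex m).
have := key D; set h := diag _ g.
have eh : h = cf expo0 h *: Xm expo0.
  apply/cfP => b; rewrite linearZ /= cfX; have [<-|ne] := eqVneq expo0 b; first by rewrite mulr1.
  rewrite mulr0 /h cf_diag; have [->|nb] := eqVneq (cf b g) 0; first by rewrite mulr0.
  have leb : (expo_sum b <= D)%N.
    rewrite -[b]mnK; apply: (@leq_bigmax_seq _ _ predT (fun m => expo_sum (ex m))) => //.
    by rewrite mcoeff_msupp.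
  have gt0 : (0 < expo_sum b)%N.
    rewrite lt0n; apply: contraNneq ne => /eqP; rewrite sum_nat_eq0 => /forallP e.
    by apply/eqP/ffunP => i; rewrite ffunE; apply/esym/eqP; apply: e.
  rewrite (bigD1_seq (expo_sum b)) ?iota_uniq ?mem_index_iota ?gt0 //=.
  by rewrite subrr !mul0r.
rewrite eh linearZ /= FlinX F0 Xm0 => /(sp_scale subU (cf expo0 h)^-1).
rewrite scalerA mulVf ?scale1r // /h cf_diag mulf_neq0 // prodf_seq_neq0.
apply/allP => m; rewrite mem_index_iota => /andP[m0 _] /=.
rewrite /expo_sum big1 => [|i _]; last by rewrite ffunE.
by rewrite sub0r oppr_eq0 pnatr_eq0 -lt0n.
Qed.

End Euler.


(** ** Bases of the quotient *)

Lemma cf_sumX (s : seq expo) (c : expo -> K) b : uniq s ->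
  cf b (\sum_(a <- s) c a *: Xm a) = if b \in s then c b else 0.
Proof.
move=> us; rewrite linear_sum /=; case: ifP => bs.
  rewrite (bigD1_seq b) //= big1 ?addr0 => [|a ab]; first by rewrite linearZ /= cfX eqxx mulr1.
  by rewrite linearZ /= cfX (negPf ab) mulr0.
rewrite big1_seq // => a /andP[_ sa]; rewrite linearZ /= cfX.
by have [e|_] := eqVneq a b; [rewrite -e sa in bs|rewrite mulr0].
Qed.

(** The predicate [D] selects degrees, so that the graded pieces are covered as
    well. *)
Lemma quotient_basis (V : lmodType K) (q : {linear P -> V}) (D : nat -> Prop) :
  (forall f, q f = 0 <-> Bad f) ->
  is_basis [set a | good a /\ D (expo_sum a)]%classic (fun a => q (F a))
    [set v | exists2 f, forall b, cf b f != 0 -> D (expo_sum b) & q f = v]%classic.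
Proof.
move=> kerq; split.
- by move=> a [ga Da]; exists (F a) => // b /F_sum ->.
- move=> s c us gs e a sa.
  have /kerq[g Hg] : q (Flin (\sum_(a <- s) c a *: Xm a)) = 0.
    rewrite -[RHS]e !linear_sum; apply: eq_bigr => b _.
    by rewrite !linearZ /= FlinX.
  move/Flin_inj => eg; apply/eqP; apply: contraT => nz.
  case: (Hg a); last by case: (gs a sa).
  by rewrite -eg cf_sumX // sa.
- move=> v [f Df <-]; have [g ef Dg'] := Flin_surj f; rewrite ef.
  pose s := [seq ex m | m <- msupp g & `[< good (ex m) >]].
  exists s, (fun a => cf a g); split.
    move=> a /mapP[m]; rewrite mem_filter => /andP[/asboolP gm mg] ->; split=> //.
    have [|b nb ->] := Dg' (ex m); last exact: Df nb.
    by rewrite /cf exK -mcoeff_msupp.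
  rewrite /Flin /lin -lock linear_sum /= /s big_map big_filter.
  rewrite (bigID (fun m => `[< good (ex m) >])) /= [X in _ + X]big1 ?addr0 => [|m /asboolPn nm].
    by apply: eq_bigr => m _; rewrite linearZ /= /cf exK.
  by apply/kerq/Bad_scale/Bad_isE/isE_F.
Qed.

End Eigenbasis.

Lemma has_dim_basis (K : fieldType) (V : lmodType K) (I : choiceType)
    (Q : set I) (b : I -> V) (T : set V) (s : seq I) :
  is_basis Q b T -> uniq s -> (forall i, Q i <-> i \in s) -> has_dim T (size s).
Proof.
move=> [inT free span] us Qs; exists (fun i => b (tnth (in_tuple s) i)); split.
- by move=> i _; apply/inT/Qs/mem_tnth.
- move=> u c uu _ e i iu; pose t := tnth (in_tuple s).
  have t_inj : injective t by apply/tuple_uniqP.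
  have st i' : t i' \in s by apply: mem_tnth.
  pose g x := if insub (index x s) is Some j then c j else 0.
  have gt j : g (t j) = c j.
    have ej : index (t j) s = j by rewrite /t (tnth_nth (t i)) /= index_uniq.
    by rewrite /g ej (valK j).
  rewrite -gt; apply: (free [seq t j | j <- u] g).
  + by rewrite map_inj_uniq.
  + by move=> _ /mapP[j _ ->]; apply/Qs.
  + by rewrite big_map -[RHS]e; apply: eq_bigr => j _; rewrite gt.
  + by rewrite map_f.
- move=> v /span[t [a [tQ ->]]].
  pose t' := pmap (fun x => insub (index x s) : option 'I_(size s)) t.
  exists t', (fun i => a (tnth (in_tuple s) i)); split=> //.
  rewrite /t'; elim: t tQ {t'} => [|x t IH] tQ; first by rewrite !big_nil.
  have xs : x \in s by apply/Qs/tQ/mem_head.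
  have lt : (index x s < size s)%N by rewrite index_mem.
  rewrite big_cons IH => [|y yt]; last by apply: tQ; rewrite inE yt orbT.
  rewrite /= (insubT (fun k => (k < size s)%N) lt) /= big_cons.
  by rewrite (tnth_nth x) /= nth_index.
Qed.

(** * Conditions (a) and (b) on the entries *)

Section Conditions.
Variables (K : numFieldType) (n' r l : nat) (d : int -> K).
Local Notation n := n'.+1.
Hypotheses (r_gt0 : (0 < r)%N) (l_gt0 : (0 < l)%N).
Local Notation expo := {ffun 'I_n -> nat}.
Implicit Types (a b : expo) (i j k : 'I_n).

Lemma aminusE a k : aminus a k.+1 = a ((rkp a)^-1%g k).
Proof.
rewrite /aminus /=; set b := expo_act (rkp a) a.
have bE x : b x = a ((rkp a)^-1%g x) by rewrite ffunE.
have nthb (x : 'I_n) : nth 0%N (codom b) x = b x.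
  by rewrite /codom /image_mem (nth_map ord0) ?size_enum_ord ?nth_ord_enum.
have -> : sort leq (codom a) = codom b.
  apply: (sorted_eq leq_trans anti_leq).
  - by apply: sort_sorted; apply: leq_total.
  - apply/(sortedP 0%N) => x; rewrite size_codom card_ord => lt.
    rewrite (nthb (Ordinal (ltnW lt))) (nthb (Ordinal lt)).
    have /sortingP/forallP/(_ (Ordinal (ltnW lt))) := @sorting_rkp _ a.
    by move=> /forallP/(_ (Ordinal lt)); rewrite /= leqnSn.
  - by rewrite perm_sort perm_sym perm_codom_act.
by rewrite nthb bE.
Qed.

Lemma rkp_mono a i j : (i <= j)%N -> (a ((rkp a)^-1%g i) <= a ((rkp a)^-1%g j))%N.
Proof.
have /sortingP/forallP/(_ i)/forallP/(_ j)/implyP h := @sorting_rkp _ a.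
by move=> /h; rewrite !ffunE.
Qed.

Lemma aminus_lt a k (x : nat) : (aminus a k.+1 < x)%N = (k < #|[set j | (a j < x)%N]|)%N.
Proof.
rewrite aminusE; set v := (rkp a)^-1%g.
rewrite -(card_preimset _ (@perm_inj _ v)); apply/idP/idP => h.
  have := @subset_leq_card _ [set y : 'I_n | (y < k.+1)%N] (v @^-1: [set j | (a j < x)%N]).
  rewrite cardsE -sum1_card (eq_bigl (fun y : 'I_n => true && (y < k.+1)%N)) //.
  rewrite (big_ord_narrow_cond (ltn_ord k)) sum1_card card_ord; apply.
  apply/fintype.subsetP => y; rewrite !inE ltnS => le.
  exact: leq_ltn_trans (rkp_mono a le) h.
rewrite ltnNge; apply/negP => le; move: h; apply/negP; rewrite -leqNgt.
have := @subset_leq_card _ (v @^-1: [set j | (a j < x)%N]) [set y : 'I_n | (y < k)%N].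
rewrite [X in (_ <= X)%N]cardsE -[X in (_ <= X)%N]sum1_card (eq_bigl (fun y : 'I_n => true && (y < k)%N)) //.
rewrite (big_ord_narrow_cond (ltnW (ltn_ord k))) sum1_card card_ord; apply.
apply/fintype.subsetP => y; rewrite !inE => lt; rewrite ltnNge; apply/negP => ky.
by have := rkp_mono a ky; rewrite -/v; lia.
Qed.

Lemma condition_bP a : condition_b r l d a <-> good_b r l d a.
Proof.
split=> h k m lem k0 e; have ltm : (m < n)%N by rewrite ltnS.
  by have := h k m lem k0 e; rewrite -[m]/(nat_of_ord (Ordinal ltm)) aminus_lt.
by have := h k m lem k0 e; rewrite -[m]/(nat_of_ord (Ordinal ltm)) aminus_lt.
Qed.

Lemma condition_aP a : condition_a r l a <-> good_a r l a.
Proof.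
have lr : (0 < l * r)%N by rewrite muln_gt0 l_gt0.
rewrite /condition_a walphaE.
have -> : aminus a n = a ((rkp a)^-1%g ord_max) by rewrite -(aminusE a ord_max).
have -> : aminus a 1 = a ((rkp a)^-1%g ord0) by rewrite -(aminusE a ord0).
set v := (rkp a)^-1%g.
have amax i : (a i <= a (v ord_max))%N.
  by rewrite -{1}(permK (rkp a) i); apply: rkp_mono; rewrite -ltnS ltn_ord.
have amin i : (a (v ord0) <= a i)%N.
  by rewrite -{1}(permK (rkp a) i); apply: rkp_mono.
split=> [[h1 h2] i j|h].
  split=> [|e]; first by have := amax i; have := amin j; lia.
  have ei : a i = a (v ord_max) by have := amax i; have := amin j; lia.
  have ej : a j = a (v ord0) by have := amax i; have := amin j; lia.
  have lt : (v ord0 < v ord_max)%N by apply: h2 => //; lia.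
  have li : (v ord_max <= i)%N.
    rewrite leqNgt; apply/negP => li; have bf : before a (v ord_max) i by rewrite /before ei eqxx li orbT.
    by have := rk_lt bf; have := rk_bound a i; rewrite -!rkpE permKV /=; lia.
  have lj : (j <= v ord0)%N.
    rewrite leqNgt; apply/negP => lj; have bf : before a j (v ord0) by rewrite /before ej eqxx lj orbT.
    by have := rk_lt bf; rewrite -!rkpE permKV.
  by apply: leq_ltn_trans lj (leq_trans lt li).
have [le ord] := h (v ord_max) (v ord0); split; first by lia.
move=> e i1 im e1 em; have -> : i1 = ord0 by apply: ord_inj.
have -> : im = ord_max by apply: ord_inj; rewrite em.
by apply: ord; have := amin (v ord_max); lia.
Qed.

End Conditions.

(** * Counting the exponents for r = 2 and l = 1 *)

Section Counting.
Local Open Scope nat_scope.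
Variables (N h : nat).
Local Notation ex3 := {ffun 'I_N -> 'I_3}.
Implicit Types (x y : ex3) (B : {set 'I_N}).

Definition level (c : nat) x : {set 'I_N} := [set i | x i == c :> nat].

(** Condition (a) for entries 0, 1 and 2. *)
Definition zeros_first x : bool :=
  [forall i, forall j, (x i == 2 :> nat) ==> (x j == 0 :> nat) ==> (j < i)%N].

Definition admissible k : {set ex3} :=
  [set x | [&& zeros_first x, N <= #|level 0 x| + h & \sum_i x i == k]].

Lemma level_cases x i : [|| i \in level 0 x, i \in level 1 x | i \in level 2 x].
Proof. by rewrite !inE; case: (x i) => -[|[|[|]]]. Qed.

Lemma card_levels x : #|level 0 x| + #|level 1 x| + #|level 2 x| = N.
Proof.
have d01 : [disjoint level 0 x & level 1 x].
  by rewrite -setI_eq0; apply/eqP/setP => i; rewrite !inE; case: eqP => // ->.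
have d2 : [disjoint level 0 x :|: level 1 x & level 2 x].
  rewrite -setI_eq0; apply/eqP/setP => i; rewrite !inE.
  by case: (x i) => -[|[|[|]]].
rewrite -[RHS](card_ord N) -[RHS]cardsT.
have -> : [set: 'I_N] = level 0 x :|: level 1 x :|: level 2 x.
  by apply/setP => i; have := level_cases x i; rewrite !finset.in_setU finset.in_setT orbA.
by rewrite !cardsU (disjoint_setI0 d2) (disjoint_setI0 d01) !cards0 !subn0.
Qed.

Lemma sum_levels x : \sum_i x i = #|level 1 x| + #|level 2 x| * 2.
Proof.
rewrite -!sum1_card big_distrl /= [X in _ = X + _]big_mkcond [X in _ = _ + X]big_mkcond -big_split /=.
by apply: eq_bigr => i _; rewrite !inE; case: (x i) => -[|[|[|]]].
Qed.

Lemma zeros_firstP x : reflect (forall i j, x i = 2 :> nat -> x j = 0 :> nat -> j < i) (zeros_first x).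
Proof.
apply: (iffP forallP) => [u i j xi xj|u i].
  by have /forallP/(_ j) := u i; rewrite xi xj.
by apply/forallP => j; apply/implyP => /eqP xi; apply/implyP => /eqP xj; apply: u.
Qed.

(** The degree gives the number of twos, and outside the ones all zeros come
    before all twos. *)
Lemma level1_inj k : {in admissible k &, injective (level 1)}.
Proof.
move=> x y; rewrite !inE => /and3P[/zeros_firstP ux _ /eqP sx] /and3P[/zeros_firstP uy _ /eqP sy] e1.
have e2 : #|level 2 x| = #|level 2 y|.
  by move: sx sy; rewrite !sum_levels e1; lia.
have sub u v : zeros_first u -> zeros_first v -> level 1 u = level 1 v ->
    #|level 2 u| = #|level 2 v| -> level 2 u \subset level 2 v.
  move=> /zeros_firstP uu /zeros_firstP uv ee1 ee2; apply/fintype.subsetP => i iu.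
  apply: contraT => niv; have : ~~ (level 2 v \subset level 2 u).
    apply: contraNN niv => vu; suff -> : level 2 v = level 2 u by [].
    by apply/eqP; rewrite eqEcard vu ee2 leqnn.
  move=> /subsetPn[j jv nju].
  have i1 : i \notin level 1 v by rewrite -ee1 inE; move: iu; rewrite inE => /eqP ->.
  have j1 : j \notin level 1 u by rewrite ee1 inE; move: jv; rewrite inE => /eqP ->.
  have := level_cases u j; have := level_cases v i.
  rewrite (negPf i1) (negPf j1) (negPf niv) (negPf nju) !orbF !inE => /eqP vi /eqP uj.
  move: iu jv; rewrite !inE => /eqP ui /eqP vj.
  by have := uu _ _ ui uj; have := uv _ _ vj vi; lia.
have s2 : level 2 x = level 2 y.
  by apply/eqP; rewrite finset.eqEsubset !sub //; apply/zeros_firstP.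
apply/ffunP => i; apply: val_inj => /=.
have := congr1 (fun A : {set 'I_N} => i \in A) e1.
have := congr1 (fun A : {set 'I_N} => i \in A) s2.
by rewrite !inE; case: (x i) => -[|[|[|]]] //; case: (y i) => -[|[|[|]]].
Qed.

Lemma zeros_first_exists B e : #|B| + e <= N ->
  exists x, [/\ zeros_first x, level 1 x = B & #|level 2 x| = e].
Proof.
elim: e => [_|e IH le].
  exists [ffun i => if i \in B then @inord 2 1 else ord0]; split.
  - by apply/zeros_firstP => i j; rewrite ffunE; case: ifP; rewrite ?inordK.
  - by apply/setP => i; rewrite !inE ffunE; case: ifP; rewrite ?inordK.
  - by apply/eqP; rewrite cards_eq0; apply/eqP/setP => i; rewrite !inE ffunE; case: ifP; rewrite ?inordK.
have [|x [/zeros_firstP ux lx ex]] := IH; first by lia.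
have [i0 i00] : exists i, i \in level 0 x.
  by apply/set0Pn; rewrite -card_gt0; have := card_levels x; rewrite lx ex; lia.
pose i := [arg max_(j > i0 in level 0 x) j : nat].
have [i0x imax] : i \in level 0 x /\ forall j, j \in level 0 x -> j <= i.
  by rewrite /i; case: arg_maxnP => // k k0 kmax; split.
have xi : x i = 0 :> nat by move: i0x; rewrite inE => /eqP.
pose y : ex3 := [ffun j => if j == i then @inord 2 2 else x j]; exists y.
have y2 : level 2 y = i |: level 2 x.
  by apply/setP => j; rewrite !inE ffunE; have [_|_] := eqVneq j i; rewrite ?inordK.
split.
- apply/zeros_firstP => p q; rewrite !ffunE; case: (eqVneq p i) => [->|pi]; case: (eqVneq q i) => [->|qi].
  + by rewrite !inordK.
  + move=> _ xq; have := imax q; rewrite inE xq eqxx => /(_ isT).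
    by rewrite leq_eqVlt val_eqE (negPf qi).
  + by rewrite inordK.
  + exact: ux.
- rewrite -lx; apply/setP => j; rewrite !inE ffunE.
  by have [->|//] := eqVneq j i; rewrite inordK // xi.
- by rewrite y2 cardsU1 ex inE xi.
Qed.

Definition count_sum k : nat :=
  \sum_(b < N.+1 | [&& b <= k, ~~ odd (k - b) & b + k <= 2 * h]) 'C(N, b).

(** With b ones and e twos, k = b + 2 e, and the bound b + e <= h becomes b + k
    <= 2 h. *)
Lemma level1_image k : h <= N ->
  [set level 1 x | x in admissible k] =
  [set B : {set 'I_N} | [&& #|B| <= k, ~~ odd (k - #|B|) & #|B| + k <= 2 * h]].
Proof.
move=> hN; apply/setP => B; rewrite inE; apply/imsetP/and3P => [[x + ->]|[le ev bk]].
  rewrite inE => /and3P[_ z /eqP s]; have := card_levels x.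
  by rewrite -s sum_levels => c; split; [lia| |lia]; rewrite addKn oddM andbF.
pose e := (k - #|B|)./2.
have ee : k = #|B| + e * 2 by rewrite /e; have := odd_double_half (k - #|B|); rewrite (negPf ev) -muln2; lia.
have [|x [ux lx ex]] := @zeros_first_exists B e; first by lia.
exists x => //; rewrite inE ux sum_levels lx ex -ee eqxx andbT /=.
have := card_levels x; rewrite lx ex; move: hN ee bk.
by clear; move: e (#|level 0 x|) (#|B|) => e p q; lia.
Qed.

Lemma card_admissible k : h <= N -> #|admissible k| = count_sum k.
Proof.
move=> hN; rewrite -(card_in_imset (@level1_inj k)) level1_image //.
pose Q (b : nat) := [&& b <= k, ~~ odd (k - b) & b + k <= 2 * h].
pose f (B : {set 'I_N}) : 'I_N.+1 := inord #|B|.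
have fE B : f B = #|B| :> nat.
  by rewrite inordK // ltnS; apply: leq_trans (max_card _) _; rewrite card_ord.
rewrite -sum1_card (partition_big f (fun b : 'I_N.+1 => Q b)) /=; last first.
  by move=> B; rewrite inE fE.
apply: eq_bigr => b Qb; have -> : 'C(N, b) = #|[set A : {set 'I_N} | #|A| == b]|.
  by rewrite card_draws card_ord.
rewrite -[RHS]sum1_card; apply: eq_bigl => B; rewrite !inE.
rewrite -val_eqE /= fE; apply/andP/idP => [[]//|/eqP e]; split; last by apply/eqP.
by rewrite e.
Qed.

End Counting.

Lemma parity_binsumE (n h k : nat) : (h <= n)%N -> count_sum (2 * n) h k =
  if (k <= h)%N then parity_binsum n k else
  if (k <= 2 * h)%N then parity_binsum n (2 * h - k) else 0%N.
Proof.
move=> hn; have key e : (e <= 2 * n)%N -> (forall b : nat, [&& b <= k, ~~ odd (k - b) & b + k <= 2 * h]%N = (b <= e)%N && ~~ odd (e - b)) ->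
   count_sum (2 * n) h k = parity_binsum n e.
  move=> le H; rewrite /parity_binsum big_mkord /count_sum (eq_bigl _ _ (fun b : 'I__ => H b)).
  have lt : (e.+1 <= (2 * n).+1)%N by [].
  rewrite (big_ord_widen_cond _ (fun b => ~~ odd (e - b)) (fun b => 'C(2 * n, b)) lt).
  by apply: eq_bigl => b; rewrite ltnS andbC.
case: leqP => [kh|hk]; first by apply: key => [|b]; lia.
case: leqP => [kh|hk2]; first by apply: key => [|b]; lia.
by rewrite /count_sum big1 // => b; lia.
Qed.

Lemma series_coef (n h k : nat) : (h <= n)%N ->
  ((parity_binsum n h)%:P * 'X^h + \sum_(0 <= j < h)
      (parity_binsum n j)%:P * ('X^j + 'X^(2 * h - j)) : {poly nat})`_k
  = count_sum (2 * n) h k.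
Proof.
move=> hn; rewrite parity_binsumE // coefD coefCM coefXn coef_sum.
rewrite (eq_bigr (fun j => (parity_binsum n j) * ((k == j)%:R + (k == 2 * h - j)%N%:R))); last first.
  by move=> j _; rewrite coefCM coefD !coefXn.
have sum0 : (forall j, (j < h)%N -> (k != j) && (k != 2 * h - j)%N) ->
    \sum_(0 <= j < h) parity_binsum n j * ((k == j)%:R + (k == 2 * h - j)%N%:R) = 0.
  move=> H; rewrite big_nat_cond big1 // => j /andP[/andP[_ /H/andP[/negPf -> /negPf ->]] _].
  by rewrite addr0 mulr0.
have sum1 (e : nat) : (e < h)%N -> (forall j, (j < h)%N -> (k == j)%:R + (k == 2 * h - j)%N%:R = (j == e)%:R :> nat) ->
    \sum_(0 <= j < h) parity_binsum n j * ((k == j)%:R + (k == 2 * h - j)%N%:R) = parity_binsum n e.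
  move=> lt H; rewrite (bigD1_seq e) ?mem_index_iota ?iota_uniq //= H // eqxx mulr1.
  rewrite big_nat_cond big1 ?addr0 // => j /andP[/andP[_ /H ->] /negPf ->].
  by rewrite mulr0.
have [kh|hk|e] := ltngtP k h.
- rewrite mulr0 add0r (sum1 k) // => j lt; have -> : (k == 2 * h - j)%N = false by lia.
  by rewrite addr0 eq_sym.
- rewrite mulr0 add0r; case: leqP => le2.
    rewrite (sum1 (2 * h - k)%N) //; first by lia.
    move=> j lt; have -> : (k == j) = false by lia.
    by rewrite add0r; congr (_%:R); congr nat_of_bool; lia.
  by rewrite sum0 // => j lt; lia.
by rewrite mulr1 sum0 ?addr0 ?e // => j lt; lia.
Qed.

Section GoodExponents.
Variables (K : numFieldType) (N' h : nat) (d : int -> K).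
Local Notation N := N'.+1.
Local Notation expo := {ffun 'I_N -> nat}.
Implicit Types (a : expo).

Hypothesis good_bE : forall a, good_b 2 1 d a <-> (N <= #|[set j | (a j < 1)%N]| + h)%N.
Hypothesis hN : (h < N)%N.

Definition of_ex3 (x : {ffun 'I_N -> 'I_3}) : expo := [ffun i => x i : nat].

Lemma of_ex3_inj : injective of_ex3.
Proof. by move=> x y e; apply/ffunP => i; apply: val_inj; have := congr1 (fun c : expo => c i) e; rewrite !ffunE. Qed.

Lemma good_ex3P (k : nat) a : good 2 1 d a /\ expo_sum a = k <->
  a \in [seq of_ex3 x | x <- enum (admissible N h k)].
Proof.
split=> [[[ga gb] sa]|/mapP[x + ->]].
  have /good_bE z := gb.
  have [j0 j00] : exists j0, a j0 = 0%N.
    have : (0 < #|[set j | (a j < 1)%N]|)%N by lia.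
    by rewrite card_gt0 => /set0Pn[j]; rewrite inE ltnS leqn0 => /eqP; exists j.
  have a2 i : (a i < 3)%N by have [+ _] := ga i j0; rewrite j00; lia.
  pose x : {ffun 'I_N -> 'I_3} := [ffun i => Ordinal (a2 i)].
  have ax : a = of_ex3 x by apply/ffunP => i; rewrite !ffunE.
  rewrite ax mem_map ?mem_enum; last exact: of_ex3_inj.
  rewrite inE; apply/and3P; split.
  - apply/zeros_firstP => i j; rewrite !ffunE /= => ai aj.
    by have [_] := ga i j; apply; rewrite ai aj.
  - by rewrite (eq_card (B := [set j | (a j < 1)%N])) // => i; rewrite !inE ffunE /= ltnS leqn0.
  - by rewrite -sa /expo_sum; apply/eqP/eq_bigr => i _; rewrite ffunE.
rewrite mem_enum inE => /and3P[/zeros_firstP u z /eqP s]; split; last first.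
  by rewrite -s /expo_sum; apply: eq_bigr => i _; rewrite ffunE.
split.
  move=> i j; rewrite !ffunE; have lt := ltn_ord (x i); split.
    by apply: leq_trans (_ : (x i <= 2)%N) _; rewrite ?leq_addl.
  move=> e; have xj : x j = 0%N :> nat.
    apply/eqP; rewrite -leqn0 -(leq_add2r 2); move: lt; rewrite e ltnS.
    by move/leq_trans; apply.
  by apply: u => //; rewrite e xj.
apply/good_bE; move: z; rewrite (eq_card (B := [set j | (of_ex3 x j < 1)%N])) // => i.
by rewrite !inE ffunE ltnS leqn0.
Qed.

Lemma size_good (k : nat) : size [seq of_ex3 x | x <- enum (admissible N h k)] = count_sum N h k.
Proof. by rewrite size_map -cardE card_admissible // ltnW. Qed.

Lemma uniq_good (k : nat) : uniq [seq of_ex3 x | x <- enum (@admissible N h k)].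
Proof. by rewrite map_inj_uniq ?enum_uniq //; apply: of_ex3_inj. Qed.

End GoodExponents.

Section GoodTypeBD.
Variables (K : numFieldType) (n N' : nat).
Hypothesis NE : N'.+1 = (2 * n)%N.
Local Notation N := N'.+1.
Let c : K := 1 / N%:R.
Implicit Types (a : {ffun 'I_N -> nat}).

Lemma N_neq0 : N%:R != 0 :> K. Proof. by rewrite pnatr_eq0. Qed.

(** The equation of (b) reads 2 odd(k) + 2 m = 2 n k, which for m < 2 n only k
    = 1 and m = n - 1 solve. *)
Lemma good_b_B a : good_b 2 1 (fun j : int => c * (-1) ^ j) a <->
  (N <= #|[set j | (a j < 1)%N]| + n)%N.
Proof.
have dE (k : nat) : c * (-1) ^ (- k%:Z) = c * (-1) ^+ odd k.
  by rewrite -exprnN invr_sign signr_odd.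
have eqE (k m : nat) : c * (-1) ^ 0 - c * (-1) ^ (- k%:Z) + 2%:R * m%:R * 1%:R / N%:R = k%:R <->
   (2 * odd k + 2 * m = N * k)%N.
  rewrite dE expr0z; have -> : (c * 1 - c * (-1) ^+ odd k + 2%:R * m%:R * 1%:R / N%:R = k%:R) <->
      ((2 * odd k + 2 * m)%:R = (N * k)%:R :> K).
    rewrite natrD !natrM /c; split=> [e|e].
      by rewrite -e; case: (odd k); rewrite ?expr1 ?expr0 /=; field; rewrite nat1r N_neq0.
    apply: (mulfI N_neq0); rewrite -e.
    by case: (odd k); rewrite ?expr1 ?expr0 /=; field; rewrite nat1r N_neq0.
  by split=> [/eqP|->//]; rewrite eqr_nat => /eqP.
split=> [h|h k m lem k0 /eqE e].
  have := h 1%N n.-1; rewrite eqE /=; move=> H.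
  have lt : (n.-1 < #|[set j | (a j < 1)%N]|)%N by apply: H; lia.
  by lia.
have k2 : (k <= 2)%N.
  rewrite leqNgt; apply/negP => k3.
  have : (N * 3 <= N * k)%N by rewrite leq_pmul2l.
  by rewrite -e; case: (odd k) => /=; lia.
have k1 : k = 1%N.
  have kn2 : k <> 2 by move=> k2'; move: e; rewrite k2' /=; lia.
  by lia.
move: e h; rewrite k1 /=; move: #|[set j | (a j < 1)%N]| => z e h; lia.
Qed.

(** The equation of (b) reads 2 m = 2 n k, which for m < 2 n only k = 1 and m =
    n solve. *)
Lemma good_b_D a : good_b 2 1 (fun=> 0 : K) a <->
  (N <= #|[set j | (a j < 1)%N]| + n.-1)%N.
Proof.
have eqE (k m : nat) : (0 - 0 + 2%:R * m%:R * 1%:R / N%:R = k%:R :> K) <-> (2 * m = N * k)%N.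
  have -> : (0 - 0 + 2%:R * m%:R * 1%:R / N%:R = k%:R :> K) <-> ((2 * m)%:R = (N * k)%:R :> K).
    rewrite !natrM; split=> [<-|e]; first by field; rewrite nat1r N_neq0.
    by apply: (mulfI N_neq0); rewrite -e; field; rewrite nat1r N_neq0.
  by split=> [/eqP|->//]; rewrite eqr_nat => /eqP.
split=> [h|h k m lem k0 /eqE e].
  have := h 1%N n; rewrite eqE /=; move=> H.
  have lt : (n < #|[set j | (a j < 1)%N]|)%N by apply: H; lia.
  by lia.
have k1 : k = 1%N.
  apply/eqP; rewrite eqn_leq k0 andbT leqNgt; apply/negP => k3.
  have : (N * 2 <= N * k)%N by rewrite leq_pmul2l.
  by rewrite -e; lia.
move: e h; rewrite k1; move: #|[set j | (a j < 1)%N]| => z e h; lia.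
Qed.

End GoodTypeBD.

(** * Monomial matrices *)

Section MonomialMatrices.
Variables (K : numFieldType) (n r : nat).
Hypothesis r_gt0 : (0 < r)%N.
Local Notation P := {mpoly K[n]}.
Implicit Types (s t : 'S_n) (la mu : 'I_n -> K) (i j k : 'I_n) (w : 'M[K]_n) (f : P).
Local Notation Xm := (@Xm K n).

Definition mmx s la : 'M[K]_n := \matrix_(i, j) (if i == s j then la j else 0).

Lemma mmxM s la t mu : mmx s la *m mmx t mu = mmx (t * s)%g (fun j => la (t j) * mu j).
Proof.
apply/matrixP => i j; rewrite !mxE (bigD1 (t j)) //= big1 ?addr0 => [|k kj]; last first.
  by rewrite !mxE (negPf kj) mulr0.
by rewrite !mxE eqxx permM; case: ifP; rewrite ?mul0r.
Qed.

Lemma mmx1 : mmx 1%g (fun=> 1) = 1%:M.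
Proof. by apply/matrixP => i j; rewrite !mxE perm1; case: eqP. Qed.

Lemma eq_mmx s la mu : la =1 mu -> mmx s la = mmx s mu.
Proof. by move=> e; apply/matrixP => i j; rewrite !mxE e. Qed.

Lemma root_neq0 (x : K) : x ^+ r = 1 -> x != 0.
Proof.
by move=> e; apply/eqP => x0; move/eqP: e; rewrite x0 expr0n gtn_eqF // eq_sym oner_eq0.
Qed.

Lemma mmx_inv s la : (forall k, la k != 0) ->
  invmx (mmx s la) = mmx (s^-1)%g (fun k => (la ((s^-1)%g k))^-1).
Proof.
move=> nz; pose B := mmx (s^-1)%g (fun k => (la ((s^-1)%g k))^-1).
have AB : mmx s la *m B = 1%:M.
  rewrite mmxM mulVg -mmx1; apply: eq_mmx => k.
  by rewrite divff.
have [uA _] := mulmx1_unit AB.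
by rewrite -/B -[B](mulKmx uA) AB mulmx1.
Qed.

Lemma Gr1n_mmx s la : (forall k, la k ^+ r = 1) -> Gr1n r (mmx s la).
Proof.
move=> la1; have nz k := root_neq0 (la1 k).
apply/and3P; split.
- apply/forallP => i; rewrite (eq_card (B := [set (s^-1)%g i])) ?cards1 // => j.
  rewrite !inE mxE -[RHS](inj_eq (@perm_inj _ s)) permKV [RHS]eq_sym.
  by have [_|_] := eqVneq i (s j); rewrite ?nz ?eqxx.
- apply/forallP => j; rewrite (eq_card (B := [set s j])) ?cards1 // => i.
  by rewrite !inE mxE; have [_|_] := eqVneq i (s j); rewrite ?nz ?eqxx.
- apply/forallP => i; apply/forallP => j; apply/implyP; rewrite mxE.
  by case: ifP => _; rewrite ?eqxx // la1.
Qed.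

Lemma Gr1nP w : Gr1n r w -> exists s la, (forall k, la k ^+ r = 1) /\ w = mmx s la.
Proof.
move=> /and3P[/forallP rw /forallP cl /forallP rt].
have fP j : {i | w i j != 0 & forall i', w i' j != 0 -> i' = i}.
  have /cards1P/cid[i ei] := cl j; exists i.
    by have := set11 i; rewrite -ei inE.
  by move=> i' ni'; apply/set1P; rewrite -ei inE.
have [f f_nz f_uniq] : exists2 f : 'I_n -> 'I_n, (forall j, w (f j) j != 0) &
    (forall j i, w i j != 0 -> i = f j).
  exists (fun j => s2val (fP j)) => [j|j i]; first exact: (s2valP (fP j)).
  exact: (s2valP' (fP j)).
have f_inj : injective f.
  move=> j j' e; have /cards1P[x ex] := rw (f j).
  have mem k : w (f j) k != 0 -> k = x by move=> h; apply/set1P; rewrite -ex inE.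
  by rewrite (mem j (f_nz j)); apply/esym/mem; rewrite e.
exists (perm f_inj), (fun j => w (f j) j); split.
  by move=> k; have /forallP/(_ k)/implyP/(_ (f_nz k))/eqP := rt (f k).
apply/matrixP => i j; rewrite mxE permE; case: eqP => [->//|ne].
by apply/eqP; apply: contra_notT ne => /f_uniq.
Qed.

Lemma linform_scale (c : K) (u : 'rV[K]_n) : linform (c *: u) = c *: linform u.
Proof. by rewrite /linform scaler_sumr; apply: eq_bigr => j _; rewrite mxE scalerA. Qed.

Lemma linformD (u v : 'rV[K]_n) : linform (u + v) = linform u + linform v.
Proof. by rewrite /linform -big_split; apply: eq_bigr => j _; rewrite mxE scalerDl. Qed.

Lemma linform_delta j : linform (delta_mx 0 j : 'rV[K]_n) = 'X_j.
Proof.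
rewrite /linform (bigD1 j) //= mxE !eqxx scale1r big1 ?addr0 // => k kj.
by rewrite mxE (negPf kj) andbF scale0r.
Qed.

Lemma row_mmx_inv s la i : (forall k, la k != 0) ->
  row i (invmx (mmx s la)) = (la i)^-1 *: delta_mx 0 (s i).
Proof.
move=> nz; rewrite mmx_inv //; apply/rowP => k; rewrite !mxE eqxx /=.
rewrite -(inj_eq (@perm_inj _ s)) permKV eq_sym; case: eqP => [->|_]; last by rewrite mulr0.
by rewrite permK mulr1.
Qed.

Lemma poly_act_mmx s la f : (forall k, la k != 0) ->
  poly_act (mmx s la) f = mono s (fun k => (la k)^-1) f.
Proof.
move=> nz; rewrite /poly_act; elim/mpoly_span_ind: f => [|c f g IHf IHg|a].
- by rewrite !linear0.
- by rewrite !linearP /= IHf IHg.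
rewrite monoX /Xm comp_mpolyX.
rewrite (eq_bigr (fun i => (la i)^-1 ^+ a i *: 'X_(s i) ^+ a i)); last first.
  move=> i _; rewrite tnth_mktuple row_mmx_inv // linform_scale linform_delta mnmE.
  by rewrite exprZn.
rewrite scaler_prod; congr (_ *: _); rewrite mpolyXE_id [RHS](reindex_inj (@perm_inj _ s)) /=.
by apply: eq_bigr => i _; rewrite mnmE act_val.
Qed.

Variable zeta : K.
Hypothesis zeta_prim : r.-primitive_root zeta.
Local Notation W := (@W K n r).
Local Notation S := (@S K n r).

Lemma zeta1 : zeta ^+ r = 1. Proof. exact: prim_expr_order. Qed.
Lemma zeta_neq0 : zeta != 0. Proof. exact: root_neq0 zeta1. Qed.

(** Orthogonality of the characters of the group of r-th roots of unity. *)
Lemma sum_zeta (k : nat) : \sum_(l < r) zeta ^+ (l * k) = if (r %| k)%N then r%:R else 0.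
Proof.
rewrite (eq_bigr (fun l : 'I_r => (zeta ^+ k) ^+ l)) => [|l _]; last by rewrite mulnC exprM.
case: ifP => rk.
  rewrite (prim_order_dvd zeta_prim) in rk; rewrite (eqP rk).
  by rewrite (eq_bigr (fun=> 1)) ?sumr_const ?card_ord // => l _; rewrite expr1n.
have z1 : zeta ^+ k - 1 != 0 by rewrite subr_eq0 -(prim_order_dvd zeta_prim) rk.
by apply: (mulfI z1); rewrite -subrX1 mulr0 -exprM mulnC exprM zeta1 expr1n subrr.
Qed.

Lemma sum_zetaB (p q : nat) :
  \sum_(l < r) zeta ^+ (l * p) * zeta ^- (l * q) = if p == q %[mod r] then r%:R else 0.
Proof.
have zq (l : nat) : zeta ^- (l * q) = zeta ^+ (l * (q * r.-1)).
  apply: (mulIf (expf_neq0 (l * q) zeta_neq0)); rewrite mulVf ?expf_neq0 ?zeta_neq0 //.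
  rewrite -exprD -mulnDr; have -> : (q * r.-1 + q = r * q)%N by nia.
  by rewrite mulnCA exprM zeta1 expr1n.
rewrite (eq_bigr (fun l : 'I_r => zeta ^+ (l * (p + q * r.-1)))) => [|l _]; last first.
  by rewrite zq -exprD mulnDr.
rewrite sum_zeta; congr (if _ then _ else _).
rewrite -(eqn_modDr (q * r.-1)); have -> : (q + q * r.-1 = q * r)%N by nia.
by rewrite modnMl.
Qed.

Lemma zeta_mxE i : zeta_mx zeta i = mmx 1%g (fun j => if j == i then zeta else 1).
Proof.
apply/matrixP => x y; rewrite !mxE perm1; have [->|_] := eqVneq x y; first by rewrite mulr1n.
by rewrite mulr0n.
Qed.

Lemma zeta_mxX i (l : nat) :
  zeta_mx zeta i ^+ l = mmx 1%g (fun j => if j == i then zeta ^+ l else 1).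
Proof.
elim: l => [|l IH].
  by rewrite expr0 -[LHS]/(1%:M) -mmx1; apply: eq_mmx => j; rewrite expr0 if_same.
rewrite exprS IH zeta_mxE [_ * _]mmxM mulg1; apply: eq_mmx => j; rewrite perm1.
by case: ifP; rewrite ?mulr1 // exprS.
Qed.

Lemma refl_mxE i j (l : nat) : i != j -> refl_mx zeta i j l =
  mmx (tperm i j) (fun k => if k == i then zeta ^- l else if k == j then zeta ^+ l else 1).
Proof.
move=> ij; have ji : (j == i) = false by rewrite eq_sym (negPf ij).
have tE : tperm_mx i j = mmx (tperm i j) (fun=> 1).
  apply/matrixP => x y; rewrite !mxE -(inj_eq (@perm_inj _ (tperm i j))) tpermK.
  by case: eqP.
rewrite /refl_mx zeta_mxX mmx_inv; last by move=> k; case: ifP; rewrite ?oner_eq0 ?expf_neq0 ?zeta_neq0.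
rewrite tE !mmxM mulg1 invg1 mul1g; apply: eq_mmx => k; rewrite !perm1 mulr1.
case: tpermP => [->|->|/eqP ki /eqP kj]; rewrite ?eqxx ?ji ?(negPf ij) ?mul1r ?divr1 //.
by rewrite (negPf ki) (negPf kj) divr1.
Qed.

Lemma refl_la_root i j (l : nat) k :
  (if k == i then zeta ^- l else if k == j then zeta ^+ l else 1) ^+ r = 1.
Proof.
have zl : zeta ^+ l ^+ r = 1 by rewrite -exprM mulnC exprM zeta1 expr1n.
by case: ifP => _; [rewrite exprVn zl invr1|case: ifP => _; rewrite ?expr1n].
Qed.

Lemma Gr1n_refl i j (l : nat) : i != j -> Gr1n r (refl_mx zeta i j l).
Proof. by move=> ij; rewrite refl_mxE //; apply/Gr1n_mmx/refl_la_root. Qed.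

Lemma Gr1n_zeta i (l : nat) : Gr1n r (zeta_mx zeta i ^+ l).
Proof.
rewrite zeta_mxX; apply: Gr1n_mmx => k; case: ifP => _; last exact: expr1n.
by rewrite -exprM mulnC exprM zeta1 expr1n.
Qed.

Lemma poly_act_refl i j (l : nat) a : i != j -> poly_act (refl_mx zeta i j l) (Xm a) =
  (zeta ^+ (l * a i) * zeta ^- (l * a j)) *: Xm (swap i j a).
Proof.
move=> ij; rewrite refl_mxE // poly_act_mmx; last by move=> k; apply: root_neq0 (refl_la_root i j l k).
rewrite monoX -swap_act /chi; congr (_ *: _).
rewrite (bigD1 i) //= (bigD1 j) /=; last by rewrite eq_sym.
rewrite big1 ?mulr1 => [|k /andP[/negPf -> /negPf ->]]; last by rewrite invr1 expr1n.
by rewrite eqxx eq_sym (negPf ij) eqxx invrK exprVn -!exprM.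
Qed.

Lemma poly_act_zeta i (l : nat) a :
  poly_act (zeta_mx zeta i ^+ l) (Xm a) = zeta ^- (l * a i) *: Xm a.
Proof.
rewrite zeta_mxX poly_act_mmx; last by move=> k; case: ifP; rewrite ?oner_eq0 ?expf_neq0 ?zeta_neq0.
rewrite monoX /chi (bigD1 i) //= big1 ?mulr1 => [|k /negPf ->]; last by rewrite invr1 expr1n.
by rewrite eqxx exprVn -exprM; congr (_ *: Xm _); apply/ffunP => k; rewrite ffunE invg1 perm1.
Qed.

Lemma poly_act_is_linear w : linear (poly_act w).
Proof. by move=> c f g; rewrite /poly_act linearP. Qed.

Lemma sum_refl i j f : i != j -> \sum_(l < r) poly_act (refl_mx zeta i j l) f = S i j f.
Proof.
move=> ij; elim/mpoly_span_ind: f => [|c f g IHf IHg|a].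
- by rewrite big1 ?linear0 // => l _; rewrite /poly_act linear0.
- rewrite linearP /= -IHf -IHg scaler_sumr -big_split; apply: eq_bigr => l _.
  exact: poly_act_is_linear.
rewrite SX /Smon -sum_zetaB scaler_suml; apply: eq_bigr => l _.
by rewrite poly_act_refl.
Qed.

Lemma sum_refl_twist i j f : i != j ->
  \sum_(l < r) zeta ^- l *: poly_act (refl_mx zeta i j l) f = W i j f.
Proof.
move=> ij; elim/mpoly_span_ind: f => [|c f g IHf IHg|a].
- by rewrite big1 ?linear0 // => l _; rewrite /poly_act linear0 scaler0.
- rewrite linearP /= -IHf -IHg scaler_sumr -big_split; apply: eq_bigr => l _ /=.
  by rewrite poly_act_is_linear scalerDr !scalerA mulrC.
rewrite WX /Wmon -sum_zetaB scaler_suml; apply: eq_bigr => l _.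
rewrite poly_act_refl // scalerA mulnS exprD invfM.
by rewrite mulrCA [_^-1 * _]mulrC mulrA.
Qed.

Lemma scale_nest (x y c : K) f g :
  x *: (y *: (c *: f + g)) = c *: (x *: (y *: f)) + x *: (y *: g).
Proof. by rewrite -!mul_mpolyC; ring. Qed.

Lemma sum_idem (d : int -> K) i f : (forall j : int, d (j + r%:Z) = d j) ->
  \sum_(j < r) (d j%:Z - d (j%:Z - 1)) *:
     (r%:R^-1 *: \sum_(l < r) zeta ^- (l * j) *: poly_act (zeta_mx zeta i ^+ l) f) =
  Dg d i f.
Proof.
move=> d_per; elim/mpoly_span_ind: f => [|c f g IHf IHg|a].
- rewrite big1 ?linear0 // => j _; rewrite big1 ?scaler0 // => l _.
  by rewrite /poly_act linear0 scaler0.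
- rewrite linearP /= -IHf -IHg scaler_sumr -big_split; apply: eq_bigr => j _ /=.
  rewrite (eq_bigr (fun l : 'I_r => c *: (zeta ^- (l * j) *: poly_act (zeta_mx zeta i ^+ l) f) +
     zeta ^- (l * j) *: poly_act (zeta_mx zeta i ^+ l) g)) => [|l _]; last first.
    by rewrite poly_act_is_linear scalerDr !scalerA mulrC.
  by rewrite big_split -scaler_sumr /=; apply: scale_nest.
have r_neq0 : r%:R != 0 :> K by rewrite pnatr_eq0 -lt0n.
rewrite DgX /Dmon.
have term (j : 'I_r) : r%:R^-1 *: \sum_(l < r) zeta ^- (l * j) *: poly_act (zeta_mx zeta i ^+ l) (Xm a)
   = (if (r %| j + a i)%N then 1 else 0) *: Xm a.
  have -> : (if (r %| j + a i)%N then 1 else 0 : K) =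
     r%:R^-1 * \sum_(l < r) zeta ^+ (l * 0) * zeta ^- (l * (j + a i)).
    by rewrite sum_zetaB mod0n eq_sym /dvdn; case: ifP => _; rewrite ?mulVf ?mulr0.
  rewrite -scalerA scaler_suml; congr (_ *: _); apply: eq_bigr => l _.
  by rewrite poly_act_zeta scalerA muln0 mul1r mulnDr exprD invfM.
pose j0 : 'I_r := Ordinal (ltn_pmod (a i * r.-1) r_gt0).
have dvd_j0 : (r %| j0 + a i)%N.
  by rewrite /dvdn /= modnDml; have -> : (a i * r.-1 + a i = a i * r)%N; [nia|rewrite modnMl].
rewrite (eq_bigr (fun j : 'I_r => (d j%:Z - d (j%:Z - 1)) *:
   ((if (r %| j + a i)%N then 1 else 0) *: Xm a))) => [|j _]; last by rewrite term.
rewrite (bigD1 j0) //= big1 ?addr0 => [|j jj0]; last first.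
  case: ifP => dj; last by rewrite scale0r scaler0.
  case/eqP: jj0; apply: val_inj => /=.
  have : j = j0 %[mod r].
    by apply/eqP; rewrite -(eqn_modDr (a i)); move: dj dvd_j0; rewrite /dvdn => /eqP -> /eqP ->.
  by rewrite [(j %% r)%N]modn_small ?[(j0 %% r)%N]modn_small.
rewrite -[((a i * r.-1) %% r)%N]/(nat_of_ord j0) dvd_j0 scale1r; congr ((_ - _) *: _).
  have /dvdnP[t et] := dvd_j0.
  have -> : j0%:Z = - (a i)%:Z + (t * r)%:Z by lia.
  elim: t {et} => [|t IH]; first by rewrite addr0.
  by rewrite mulSn PoszD [r%:Z + _]addrC addrA d_per.
have /dvdnP[t et] := dvd_j0.
have -> : j0%:Z - 1 = - (a i).+1%:Z + (t * r)%:Z by lia.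
elim: t {et} => [|t IH]; first by rewrite addr0.
by rewrite mulSn PoszD [r%:Z + _]addrC addrA d_per.
Qed.

End MonomialMatrices.

(** * The polynomial representation *)

Section Representation.
Variables (K : numFieldType) (n r : nat) (c0 : K) (d : int -> K).
Hypothesis r_gt0 : (0 < r)%N.
Hypothesis d_per : forall j : int, d (j + r%:Z) = d j.
Local Notation P := {mpoly K[n]}.
Local Notation expo := {ffun 'I_n -> nat}.
Implicit Types (a b : expo) (i j k : 'I_n) (f g : P) (w : 'M[K]_n).
Local Notation Xm := (@Xm K n).
Local Notation Y := (@Y K n r c0 d).
Local Notation S := (@S K n r).
Local Notation W := (@W K n r).
Local Notation Z := (@Z K n r c0 d).
Local Notation Dg := (@Dg K n d).

(** ** The Dunkl operators commute *)

Lemma Y_one i : Y i 1 = 0.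
Proof.
rewrite -(Xm_zero K n) YX /Ymon /ycoef ffunE oppr0 add0r addNr scale0r big1 ?scaler0 ?subr0 // => j _.
by rewrite /Tmon !ffunE big_geq.
Qed.

Lemma Y_class i a b : cf b (Y i (Xm a)) != 0 ->
  forall k, (b k + (k == i) = a k %[mod r])%N.
Proof.
rewrite YX /Ymon linearB !linearZ /= => nz k.
have [e|ne] := eqVneq (ycoef d a i * cf b (Xm (dec i a))) 0; last first.
  have := ne; rewrite mulf_eq0 negb_or => /andP[nc /cfX_neq0 <-]; rewrite ffunE.
  case: eqP => [->|_]; rewrite ?addn0 // addn1 prednK // lt0n.
  by apply: contraNneq nc => a0; rewrite /ycoef a0 oppr0 add0r addNr.
move: nz; rewrite e sub0r oppr_eq0 mulf_eq0 negb_or linear_sum => /andP[_ nz].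
have [j [ji nzj]] : exists j, j != i /\ cf b (Tmon K r i j a) != 0.
  apply: contrapT => h; move/eqP: nz; apply; apply: big1 => j ji; apply/eqP.
  by apply: contraT => nzj; case: h; exists j.
have [q [qN qj qb]] : exists q : nat, [/\ (q < a i + a j)%N, q = a j %[mod r] &
    b = upd a i j ((a i + a j).-1 - q) q].
  apply: contrapT => h; move/eqP: nzj; apply; rewrite linear_sum big_nat_cond big1 //.
  move=> q /andP[/andP[_ qN] /eqP qj]; rewrite linearZ /= cfX.
  have [e'|_] := eqVneq (upd a i j ((a i + a j).-1 - q) q) b; last by rewrite mulr0.
  by case: h; exists q.
rewrite qb ffunE; have [->|ki] := eqVneq k i.
  rewrite addn1 -subSn; last by lia.
  rewrite prednK; last by lia.
  by apply/eqP; rewrite -(eqn_modDr q) subnK ?eqn_modDl ?qj //; lia.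
by rewrite addn0; case: eqP => [->|].
Qed.

Lemma W_class i j f (ka : expo) :
  (forall b, cf b f != 0 -> b i = ka i %[mod r] /\ (b j).+1 = (ka j).+1 %[mod r]) ->
  W i j f = (if ka i == (ka j).+1 %[mod r] then r%:R else 0) *: pm (tperm i j) f.
Proof.
move=> cl; rewrite -(lin_id f) /lin -lock (linear_sum (W i j)) (linear_sum (pm (tperm i j))) scaler_sumr /=.
rewrite big_seq [RHS]big_seq; apply: eq_bigr => m mf.
have -> : (if ka i == (ka j).+1 %[mod r] then r%:R else 0) =
          (if ex m i == (ex m j).+1 %[mod r] then r%:R else 0) :> K.
  by have [|-> ->//] := cl (ex m); rewrite /cf exK -mcoeff_msupp.
by rewrite !linearZ /= WX pmX -swap_act /Wmon -!mul_mpolyC; ring.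
Qed.

Definition comX i k f : P := Y i ('X_k * f) - 'X_k * Y i f.

Lemma comX_neq i k f : k != i -> comX i k f = c0 *: W i k f.
Proof. by move=> ki; rewrite /comX Y_mulX // addrC addKr. Qed.

Lemma comX_eq i f : comX i i f = f - Dg i f - c0 *: \sum_(j | j != i) S i j f.
Proof. by rewrite /comX Y_mulXx; ring. Qed.

Lemma comX_is_linear i k : linear (comX i k).
Proof.
move=> c f g; rewrite /comX mulrDr -scalerAr !linearP /= mulrDr -scalerAr.
by rewrite -!mul_mpolyC; ring.
Qed.

Lemma predmodK (x : nat) : (x + r.-1).+1 = x %[mod r].
Proof. by rewrite -addnS prednK // modnDr. Qed.

(** The residues of the exponents in y_j x^a are those of [a], lowered by one
    at [j], so [S i j] acts on it as a multiple of a transposition. *)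
Lemma S_Y_near i j a : i != j -> S i j (Y j (Xm a)) =
  (if (a i).+1 == a j %[mod r] then r%:R else 0) *: Y i (Xm (swap i j a)).
Proof.
(* Adding r - 1 lowers the residue by one without leaving the naturals. *)
move=> ij; pose ka : expo := [ffun x => if x == j then (a x + r.-1)%N else a x].
rewrite (S_class (ka := ka)) => [|b /Y_class cl].
  rewrite pm_Y // tpermR pmX -swap_act /rho !ffunE eqxx (negPf ij); congr (_ *: _).
  by rewrite -(eqn_modDr 1) !addn1 predmodK.
have := cl i; have := cl j; rewrite !ffunE eqxx (negPf ij) addn0 => bj ->; split=> //.
by apply/eqP; rewrite -(eqn_modDr 1) bj addn1 predmodK.
Qed.

Lemma S_Y_far x y j a : x != j -> y != j -> S x y (Y j (Xm a)) = Y j (S x y (Xm a)).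
Proof.
move=> xj yj; rewrite (S_class (ka := a)) => [|b /Y_class cl].
  by rewrite pm_Y // tpermD // pmX -swap_act SX /Smon linearZ.
by have := cl x; have := cl y; rewrite (negPf xj) (negPf yj) !addn0.
Qed.

Lemma W_Y_near i j a : i != j -> W j i (Y i (Xm a)) =
  (if a i == a j %[mod r] then r%:R else 0) *: Y j (Xm (swap i j a)).
Proof.
move=> ij; have ji : j != i by rewrite eq_sym.
pose ka : expo := [ffun x => if x == i then (a x + r.-1)%N else a x].
rewrite (W_class (ka := ka)) => [|b /Y_class cl].
  rewrite pm_Y // tpermR pmX -swap_act !ffunE eqxx (negPf ji); congr (_ *: Y _ (Xm _)).
    by rewrite predmodK eq_sym.
  by rewrite /swap tpermC.
have := cl i; have := cl j; rewrite !ffunE eqxx (negPf ji) addn0 addn1 => -> bi; split=> //.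
by rewrite bi predmodK.
Qed.

Lemma W_Y_far x y j a : x != j -> y != j -> W x y (Y j (Xm a)) = Y j (W x y (Xm a)).
Proof.
move=> xj yj; rewrite (W_class (ka := a)) => [|b /Y_class cl].
  by rewrite pm_Y // tpermD // pmX -swap_act WX /Wmon linearZ.
have := cl x; have := cl y; rewrite (negPf xj) (negPf yj) !addn0 => by_ bx; split=> //.
exact: eqmodS.
Qed.

Lemma Dg_Y_far i j a : i != j -> Dg i (Y j (Xm a)) = Y j (Dg i (Xm a)).
Proof.
move=> ij; rewrite (Dg_class d_per (q := a i)) => [|b /Y_class/(_ i)].
  by rewrite DgX /Dmon linearZ.
by rewrite (negPf ij) addn0.
Qed.

(** The Jacobi identity: it says that the commutator of y_i and y_j commutes
    with x_k. *)
Lemma comX_Y i j k f : i != j ->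
  comX i k (Y j f) + Y i (comX j k f) = comX j k (Y i f) + Y j (comX i k f).
Proof.
wlog : i j / k != j => [W0 ij|kj ij].
  have [ekj|] := eqVneq k j; last by move=> kj; apply: W0.
  by apply/esym/W0; [rewrite ekj|]; rewrite eq_sym.
elim/mpoly_span_ind: f => [|c f g IHf IHg|a].
- have com0 x y : comX x y 0 = 0 by rewrite /comX mulr0 !linear0 mulr0 subr0.
  by rewrite !linear0 !com0 !linear0.
- rewrite !(linearP (Y _)) /= !comX_is_linear !(linearP (Y _)) /=.
  move: IHf IHg; move: (comX i k (Y j f)) (Y i (comX j k f)) (comX j k (Y i f))
    (Y j (comX i k f)) (comX i k (Y j g)) (Y i (comX j k g)) (comX j k (Y i g))
    (Y j (comX i k g)) => A B C D A' B' C' D' IHf IHg.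
  by rewrite addrACA -scalerDr IHf IHg scalerDr addrACA.
have ji : j != i by rewrite eq_sym.
have [eki|ki] := eqVneq k i; last first.
  rewrite !(comX_neq _ ki) !(comX_neq _ kj) (W_Y_far _ ij kj) (W_Y_far _ ji ki).
  by rewrite (linearZ_LR (Y i)) (linearZ_LR (Y j)) addrC.
rewrite eki !(comX_neq (i := j) (k := i)) // !comX_eq.
rewrite !(linearB (Y j)) !(linearZ_LR (Y _)) (linear_sum (Y j)) /= -Dg_Y_far //.
rewrite (bigD1 j) //= [in RHS](bigD1 j) //=.
rewrite (eq_bigr (fun x => Y j (S i x (Xm a)))) => [|x /andP[xi xj]]; last by rewrite S_Y_far.
rewrite S_Y_near // W_Y_near // SX WX /Smon /Wmon !linearZ /=.
rewrite [swap j i a]/swap tpermC -/(swap i j a) [a j == _ %[mod r]]eq_sym.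
set T := \sum_(x | _) _; set Y1 := Y i (Xm _); set Y2 := Y j (Xm (swap i j a)).
by rewrite -!mul_mpolyC; ring.
Qed.

(** The commutator kills 1 and commutes with the variables. *)
Lemma Y_comm i j f : Y i (Y j f) = Y j (Y i f).
Proof.
have [->//|ij] := eqVneq i j; apply/eqP; rewrite -subr_eq0; apply/eqP.
elim/mpoly_mulX_ind: f => [|c f g IHf IHg|k f IH].
- by rewrite !Y_one (linear0 (Y i)) (linear0 (Y j)) subrr.
- move/eqP: IHf; move/eqP: IHg; rewrite !subr_eq0 => /eqP eg /eqP ef.
  by rewrite !(linearP (Y _)) /= ef eg subrr.
have eY x : Y x ('X_k * f) = 'X_k * Y x f + comX x k f by rewrite /comX addrC subrK.
rewrite !eY; set C1 := comX j k f; set C2 := comX i k f; rewrite (linearD (Y i)) (linearD (Y j)) /=.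
have eY2 x y : Y x ('X_k * Y y f) = 'X_k * Y x (Y y f) + comX x k (Y y f).
  by rewrite /comX addrC subrK.
rewrite !eY2 {}/C1 {}/C2; have := comX_Y k f ij => J.
by move/eqP: IH; rewrite subr_eq0 => /eqP ->; rewrite -[X in X - _]addrA J addrA subrr.
Qed.

End Representation.

(** ** The relations of the Cherednik algebra *)

Section Action.
Variables (K : numFieldType) (n r : nat) (c0 : K) (d : int -> K) (zeta : K).
Hypotheses (r_gt0 : (0 < r)%N) (zeta_prim : r.-primitive_root zeta).
Hypothesis d_per : forall j : int, d (j + r%:Z) = d j.
Local Notation P := {mpoly K[n]}.
Local Notation expo := {ffun 'I_n -> nat}.
Implicit Types (a b : expo) (i j k : 'I_n) (f g : P) (w : 'M[K]_n).
Local Notation Xm := (@Xm K n).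
Local Notation Y := (@Y K n r c0 d).
Local Notation Z := (@Z K n r c0 d).
Local Notation E := (fexp K (cgen K r n)).
Local Notation crel := (@crel K zeta r n c0 d).
Implicit Types e : E.

Lemma mono_comp (s t : 'S_n) (la mu : 'I_n -> K) f :
  mono s la (mono t mu f) = mono (t * s)%g (fun j => la (t j) * mu j) f.
Proof.
elim/mpoly_span_ind: f => [|c f g IHf IHg|a]; rewrite ?linear0 //.
  by rewrite !linearP /= IHf IHg.
rewrite !monoX linearZ /= monoX scalerA; congr (_ *: Xm _).
  rewrite /chi [in X in _ * X](reindex_inj (@perm_inj _ t)) -big_split /=.
  by apply: eq_bigr => k _; rewrite act_val exprMn mulrC.
by apply/ffunP => k; rewrite !ffunE invMg permM.
Qed.

Lemma mono1 f : mono 1%g (fun=> 1) f = f.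
Proof.
elim/mpoly_span_ind: f => [|c f g IHf IHg|a]; rewrite ?linear0 //.
  by rewrite linearP /= IHf IHg.
rewrite monoX /chi big1 ?scale1r => [|k _]; last by rewrite expr1n.
by congr Xm; apply/ffunP => k; rewrite ffunE invg1 perm1.
Qed.

Lemma eq_mono s (la mu : 'I_n -> K) f : la =1 mu -> mono s la f = mono s mu f.
Proof. by move=> /funext ->. Qed.

Lemma poly_actM w w' f : Gr1n r w -> Gr1n r w' ->
  poly_act (w *m w') f = poly_act w (poly_act w' f).
Proof.
move=> /Gr1nP[s [la [/[dup] lar /(_ _)/(root_neq0 r_gt0) la0 ->]]].
move=> /Gr1nP[t [mu [/[dup] mur /(_ _)/(root_neq0 r_gt0) mu0 ->]]].
rewrite mmxM !poly_act_mmx // => [|k]; last by rewrite mulf_neq0.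
by rewrite mono_comp; apply: eq_mono => k; rewrite invfM.
Qed.

Lemma poly_act1 f : poly_act 1%:M f = f.
Proof.
rewrite -mmx1 poly_act_mmx => [|k]; last exact: oner_neq0.
by rewrite -[RHS]mono1; apply: eq_mono => k; rewrite invr1.
Qed.

Definition YV (v : 'cV[K]_n) f : P := \sum_i v i 0 *: Y i f.

Lemma YV_delta i f : YV (delta_mx i 0) f = Y i f.
Proof.
rewrite /YV (bigD1 i) //= mxE !eqxx scale1r big1 ?addr0 // => j ji.
by rewrite mxE (negPf ji) scale0r.
Qed.

Lemma poly_act_YV w v f : Gr1n r w -> poly_act w (YV v f) = YV (w *m v) (poly_act w f).
Proof.
move=> /Gr1nP[s [la [/[dup] lar /(_ _)/(root_neq0 r_gt0) la0 ->]]].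
rewrite !poly_act_mmx // /YV (linear_sum (mono s _)) [RHS](reindex_inj (@perm_inj _ s)).
apply: eq_bigr => i _; rewrite linearZ /= mono_Y // => [|k]; last by rewrite exprVn lar invr1.
rewrite invrK scalerA mulrC; congr (_ *: _).
rewrite !mxE (bigD1 i) //= mxE eqxx big1 ?addr0 // => j ji.
by rewrite mxE (inj_eq perm_inj) eq_sym (negPf ji) mul0r.
Qed.

Lemma poly_act_linform w (x : 'rV[K]_n) f :
  poly_act w (linform x * f) = linform (x *m invmx w) * poly_act w f.
Proof.
rewrite /poly_act rmorphM; congr (_ * _).
rewrite /linform raddf_sum /=.
under eq_bigr do rewrite comp_mpolyZ comp_mpolyXU -tnth_nth tnth_mktuple /linform scaler_sumr.
rewrite exchange_big /=; apply: eq_bigr => j _; rewrite mxE scaler_suml.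
by apply: eq_bigr => i _; rewrite scalerA !mxE.
Qed.

(** The polynomial representation, on expressions in the generators. *)
Fixpoint eval e : P -> P :=
  match e with
  | FScal a => fun f => a *: f
  | FGen (GY v) => YV v
  | FGen (GX x) => fun f => linform x * f
  | FGen (GW w) => poly_act (sval w)
  | FAdd x y => fun f => eval x f + eval y f
  | FMul x y => fun f => eval x (eval y f)
  end.

Lemma eval_linear e : linear (eval e).
Proof.
elim: e => [a|[v|x|w]|x IHx y IHy|x IHx y IHy] c f g /=.
- by rewrite scalerDr !scalerA mulrC.
- rewrite /YV scaler_sumr -big_split; apply: eq_bigr => i _ /=.
  by rewrite linearP scalerDr !scalerA mulrC.
- by rewrite mulrDr -scalerAr.
- exact: poly_act_is_linear.
- by rewrite IHx IHy scalerDr addrACA.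
- by rewrite IHy IHx.
Qed.

Lemma eval_esum (I : Type) (s : seq I) (Q : pred I) (F : I -> E) f :
  eval (\big[@FAdd _ _/FScal _ 0]_(i <- s | Q i) F i) f = \sum_(i <- s | Q i) eval (F i) f.
Proof. by apply: (big_morph (fun e => eval e f)) => //=; rewrite scale0r. Qed.

Lemma eval_EW w f : Gr1n r w -> eval (EW r w) f = poly_act w f.
Proof. by move=> Gw; rewrite /EW insubT. Qed.

Lemma eval_Ey i f : eval (Ey K r i) f = Y i f. Proof. exact: YV_delta. Qed.
Lemma eval_Ex i f : eval (Ex K r i) f = 'X_i * f. Proof. by rewrite /= linform_delta. Qed.

Lemma eval_crel e e' f : crel e e' -> eval e f = eval e' f.
Proof.
case=> [c u v|c u v||w w' Gw Gw'|w v Gw|w x Gw|i j|i j|i j ij|i] /=.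
- rewrite /YV scaler_sumr -big_split; apply: eq_bigr => i _ /=.
  by rewrite !mxE scalerDl scalerA.
- by rewrite linformD linform_scale mulrDl -scalerAl.
- rewrite eval_EW ?poly_act1 ?scale1r // -mmx1; apply: Gr1n_mmx => // k; exact: expr1n.
- rewrite !eval_EW // ?poly_actM //.
  move: Gw Gw' => /Gr1nP[s [la [lar ->]]] /Gr1nP[t [mu [mur ->]]].
  by rewrite mmxM; apply: Gr1n_mmx => // k; rewrite exprMn lar mur mulr1.
- by rewrite !eval_EW // poly_act_YV.
- by rewrite !eval_EW // poly_act_linform.
- by rewrite !linform_delta mulrCA.
- by rewrite !YV_delta (Y_comm _ r_gt0 d_per).
- rewrite !YV_delta !linform_delta eval_esum Y_mulX 1?eq_sym //; congr (_ + _ *: _).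
  rewrite -(sum_refl_twist r_gt0 zeta_prim) //; apply: eq_bigr => l _ /=.
  by rewrite eval_EW //; exact: Gr1n_refl.
- rewrite !YV_delta !linform_delta !eval_esum Y_mulXx scale1r scaleN1r scaleNr.
  congr (_ - _ - _ *: _).
    rewrite -(sum_idem r_gt0 zeta_prim) //; apply: eq_bigr => j _ /=; rewrite eval_esum.
    congr (_ *: (_ *: _)); apply: eq_bigr => l _ /=.
    by rewrite eval_EW //; apply: Gr1n_zeta.
  apply: eq_bigr => j ji; rewrite eval_esum -(sum_refl r_gt0 zeta_prim) 1?eq_sym //.
  by apply: eq_bigr => l _; rewrite eval_EW //; apply: (Gr1n_refl r_gt0 zeta_prim); rewrite eq_sym.
Qed.

Lemma eval_pcong e e' : pcong crel e e' -> forall f, eval e f = eval e' f.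
Proof.
elim=> {e e'} [x y xy f|x|x y _ IH f|y x z _ IH _ IH' f|x x' y y' _ IH _ IH' f
  |x x' y y' _ IH _ IH' f|x y z f|x y f|x f|x f|x y z f|x f|x f|x y z f|x y z f|a b f
  |a b f|a x f] //=.
- exact: eval_crel.
- by rewrite IH IH'.
- by rewrite IH IH'.
- by rewrite IH' IH.
- by rewrite addrA.
- by rewrite addrC.
- by rewrite scale0r add0r.
- by rewrite scaleN1r addNr scale0r.
- by rewrite scale1r.
- by rewrite scale1r.
- by rewrite -{1}[eval y _]scale1r eval_linear scale1r.
- by rewrite scalerDl.
- by rewrite scalerA.
- have e0 : eval x 0 = 0.
    by have := eval_linear x (-1) 0 0; rewrite scaler0 addr0 scaleN1r addNr.
  by have := eval_linear x a f 0; rewrite e0 !addr0.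
Qed.

End Action.


(** * The standard module is the polynomial representation *)

Section StandardModule.
Variables (K : numFieldType) (n r : nat) (c0 : K) (d : int -> K) (zeta : K).
Hypotheses (r_gt0 : (0 < r)%N) (zeta_prim : r.-primitive_root zeta).
Hypothesis d_per : forall j : int, d (j + r%:Z) = d j.
Local Notation P := {mpoly K[n]}.
Local Notation expo := {ffun 'I_n -> nat}.
Implicit Types (a b : expo) (i j k : 'I_n) (f g : P) (w : 'M[K]_n).
Local Notation Xm := (@Xm K n).
Local Notation Y := (@Y K n r c0 d).
Local Notation Z := (@Z K n r c0 d).
Local Notation E := (fexp K (cgen K r n)).
Local Notation crel := (@crel K zeta r n c0 d).
Local Notation H := (@Hc K zeta r n c0 d).
Local Notation Delta := (@Delta_triv K zeta r n c0 d).
Local Notation DeltaK := (@over_scalars K _ crel Delta).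
Local Notation eval := (@eval K n r c0 d).
Local Notation hx := (@hx K zeta r n c0 d).
Local Notation hy := (@hy K zeta r n c0 d).
Local Notation hw := (@hw K zeta r n c0 d).
Local Notation hscal := (@hscal K zeta r n c0 d).
Local Notation one := (@Delta_one K zeta r n c0 d).
Local Notation trivcl := (@triv_closed K zeta r n c0 d).
Local Notation pr := (@pr K _ crel).
Implicit Types (e : E) (h : H).

Lemma prD e e' : pr (e + e')%F = (pr e : H) + pr e'.
Proof. by rewrite -[RHS]/(pr_add _ _) pr_addE. Qed.

Lemma prM e e' : pr (e * e')%F = (pr e : H) * pr e'.
Proof. by rewrite -[RHS]/(pr_mul _ _) pr_mulE. Qed.

Lemma pr_rel e e' : crel e e' -> pr e = pr e'.
Proof. by move=> ee; apply/prP/pc_rel. Qed.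

Definition hact h : P -> P := eval (generic_quotient.repr h).

Lemma hact_pr e f : hact (pr e) f = eval e f.
Proof. by apply: (eval_pcong r_gt0 zeta_prim d_per); apply: repr_pr. Qed.

Lemma hactD h h' f : hact (h + h') f = hact h f + hact h' f.
Proof. by rewrite -[h]prK -[h']prK -prD !hact_pr. Qed.

Lemma hactM h h' f : hact (h * h') f = hact h (hact h' f).
Proof. by rewrite -[h]prK -[h']prK -prM !hact_pr. Qed.

Lemma hact_linear h : linear (hact h).
Proof. exact: eval_linear. Qed.

Lemma hact_scal c f : hact (hscal c) f = c *: f.
Proof. exact: hact_pr. Qed.

Lemma hact1 f : hact 1 f = f.
Proof. by rewrite -[1]/(hscal 1) hact_scal scale1r. Qed.

Lemma hact0 f : hact 0 f = 0.
Proof. by rewrite -[0]/(hscal 0) hact_scal scale0r. Qed.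

Lemma hact_r0 h : hact h 0 = 0.
Proof. by have := hact_linear h (-1) 0 0; rewrite scaler0 addr0 scaleN1r addNr. Qed.

Lemma hactN h f : hact (- h) f = - hact h f.
Proof. by apply/eqP; rewrite -addr_eq0 -hactD addNr hact0. Qed.

Lemma hact_sum (I : Type) (s : seq I) (Q : pred I) (F : I -> H) f :
  hact (\sum_(x <- s | Q x) F x) f = \sum_(x <- s | Q x) hact (F x) f.
Proof. by apply: (big_morph (fun h => hact h f)) => [x y|]; rewrite ?hactD ?hact0. Qed.

Lemma hact_x i f : hact (hx i) f = 'X_i * f.
Proof. by rewrite hact_pr eval_Ex. Qed.

Lemma hact_y i f : hact (hy i) f = Y i f.
Proof. by rewrite hact_pr eval_Ey. Qed.

Lemma hact_w w f : Gr1n r w -> hact (hw w) f = poly_act w f.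
Proof. by move=> Gw; rewrite hact_pr eval_EW. Qed.

Lemma hact_z i f : hact (hz zeta r c0 d i) f = Z i f.
Proof.
rewrite /hz hactD !hactM hact_x hact_y hact_scal hact_sum /Z; congr (_ + _ *: _).
apply: eq_bigr => j ji; have ij : i != j by rewrite -val_eqE /= neq_ltn ji orbT.
rewrite hact_sum -(sum_refl r_gt0 zeta_prim) //; apply: eq_bigr => l _.
by rewrite hact_w //; apply: Gr1n_refl.
Qed.

Lemma hx_comm i j : hx i * hx j = hx j * hx i.
Proof. by rewrite -!prM; apply: pr_rel; constructor. Qed.

Lemma prod_hx_inc i a : \prod_(j < n) hx j ^+ inc i a j = hx i * \prod_(j < n) hx j ^+ a j.
Proof.
have comx j q : GRing.comm (hx i) (hx j ^+ q) by apply: commrX; apply: hx_comm.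
have far (s : seq 'I_n) : i \notin s ->
    \prod_(j <- s) hx j ^+ inc i a j = \prod_(j <- s) hx j ^+ a j.
  move=> nis; apply: eq_big_seq => j js; rewrite ffunE; case: eqP => // ji.
  by rewrite -ji js in nis.
have : i \in index_enum 'I_n by rewrite mem_index_enum.
elim: (index_enum _) (index_enum_uniq 'I_n) => // j s IH /= /andP[js us].
rewrite inE !big_cons; have [ij _|ne /= si] := eqVneq i j.
  by rewrite -ij in js *; rewrite far // ffunE eqxx exprS mulrA.
by rewrite (IH us si) ffunE eq_sym (negPf ne) !mulrA -comx.
Qed.

Definition tau f : DeltaK := lin (fun a => xmon zeta r c0 d a : DeltaK) f.
HB.instance Definition _ :=
  GRing.Linear.copy tau (lin (fun a => xmon zeta r c0 d a : DeltaK)).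

Lemma tauX a : tau (Xm a) = xmon zeta r c0 d a.
Proof. exact: linX. Qed.

Lemma tau1 : tau 1 = one.
Proof.
rewrite -(Xm_zero K n) tauX /xmon big1 ?scale1r // => i _; by rewrite ffunE expr0.
Qed.

Lemma tauZ c f : tau (c *: f) = hscal c *: (tau f : Delta).
Proof. exact: linearZ. Qed.

Lemma hscal_comm c h : hscal c * h = h * hscal c.
Proof. by rewrite -[h]prK -!prM; apply/prP/pc_scalC. Qed.

Lemma tau_mulX i f : tau ('X_i * f) = hx i *: (tau f : Delta).
Proof.
elim/mpoly_span_ind: f => [|c f g IHf IHg|a].
- by rewrite mulr0 !linear0 scaler0.
- rewrite mulrDr -scalerAr !linearD /= !tauZ IHf IHg scalerDr !scalerA.
  by rewrite hscal_comm.
by rewrite mulXX !tauX /xmon prod_hx_inc scalerA.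
Qed.

Lemma pi_scale h h' : quotmod_pi trivcl (h * h') =
  h *: (quotmod_pi trivcl h' : Delta).
Proof. exact: (quotmod_piZ trivcl h h'). Qed.

Lemma pi_one h : quotmod_pi trivcl h = h *: one.
Proof. by rewrite -[in LHS](mulr1 h) pi_scale. Qed.

Lemma pi_eq0 h : triv_ideal h -> h *: one = 0.
Proof.
move=> ih; rewrite -pi_one -[0 in RHS](scale0r one) -pi_one.
by apply/quotmod_eqP; rewrite subr0; apply/asboolP.
Qed.

Lemma hy_one i : hy i *: one = 0.
Proof.
by apply: pi_eq0; rewrite -[hy i]addr0 -[hy i]mul1r; apply: TI_Y; constructor.
Qed.

Lemma hw_one w : Gr1n r w -> hw w *: one = one.
Proof.
move=> Gw; apply/eqP; rewrite -subr_eq0 -[X in _ - X]scale1r -scalerBl; apply/eqP.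
by apply: pi_eq0; rewrite -[hw w - 1]addr0 -[_ - 1]mul1r; apply: TI_W => //; constructor.
Qed.

Lemma poly_act_one w : poly_act w (1 : P) = 1.
Proof. exact: comp_mpoly1. Qed.

(** Stated at a single [f]: when y_i is moved past x_k, the induction
    hypothesis is about y_i at [f] only. *)
Definition acts_at e f : Prop := pr e *: (tau f : Delta) = tau (eval e f).

Lemma acts_scal c f : acts_at (c%:S)%F f.
Proof. by rewrite /acts_at tauZ. Qed.

Lemma acts_add e e' f : acts_at e f -> acts_at e' f -> acts_at (e + e')%F f.
Proof. by rewrite /acts_at prD scalerDl => -> ->; rewrite /= linearD. Qed.

Lemma acts_mul e e' f : acts_at e' f -> acts_at e (eval e' f) -> acts_at (e * e')%F f.
Proof. by rewrite /acts_at prM -scalerA => -> ->. Qed.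

Lemma acts_sum (I : Type) (s : seq I) (Q : pred I) (F : I -> E) f :
  (forall x, Q x -> acts_at (F x) f) ->
  acts_at (\big[@FAdd _ _/FScal _ 0]_(x <- s | Q x) F x) f.
Proof.
move=> AF; elim: s => [|x s IH]; rewrite ?big_nil ?big_cons; first exact: acts_scal.
by case: ifP => // Qx; apply: acts_add => //; apply: AF.
Qed.

Lemma acts_pcong e e' f : pcong crel e e' -> acts_at e' f -> acts_at e f.
Proof.
move=> ee; rewrite /acts_at (eval_pcong r_gt0 zeta_prim d_per ee).
by move: ee => /prP ->.
Qed.

Lemma acts_linear e : acts_at e 1 ->
  (forall k f, acts_at e f -> acts_at e ('X_k * f)) -> forall f, acts_at e f.
Proof.
move=> e1 eX; elim/mpoly_mulX_ind => // c f g ef eg.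
rewrite /acts_at eval_linear (linearD tau) (linearD tau (_ *: _)) /= !tauZ.
by rewrite scalerDr scalerA -hscal_comm -scalerA ef eg.
Qed.

Lemma acts_span (V : lmodType K) (I : finType) (v : I -> V) (c : I -> K) (F : V -> E) f :
  (forall (x : K) u u', crel (F (x *: u + u')) (x%:S * F u + F u')%F) ->
  (forall x, acts_at (F (v x)) f) -> acts_at (F (\sum_x c x *: v x)) f.
Proof.
move=> linF AF; elim/big_rec: _ => [|i u _ Au].
  apply: (@acts_pcong _ (0%:S)%F); last exact: acts_scal.
  apply: pc_trans (pc_addN _ (F 0)); apply: pc_rel.
  by have := linF (-1) 0 0; rewrite scaler0 addr0.
apply: (acts_pcong (pc_rel (linF _ _ _))).
by apply: acts_add => //; apply: acts_mul => //; apply: acts_scal.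
Qed.

Lemma acts_X x f : acts_at (EX r x) f.
Proof.
rewrite [x]row_sum_delta; apply: acts_span => [a u u'|i]; first by constructor.
by rewrite /acts_at eval_Ex tau_mulX.
Qed.

Lemma acts_W w f : Gr1n r w -> acts_at (EW r w) f.
Proof.
move=> Gw; move: f; apply: acts_linear => [|k f IH].
  by rewrite /acts_at eval_EW // poly_act_one tau1 [LHS]hw_one.
rewrite -(@eval_Ex K n r c0 d) /acts_at -(acts_X (delta_mx 0 k)) scalerA -prM.
have rel := pc_rel (CR_WX zeta c0 d (delta_mx 0 k) Gw).
have -> : eval (EW r w) (eval (Ex K r k) f) = eval (EX r (delta_mx 0 k *m invmx w) * EW r w)%F f.
  exact: (eval_pcong r_gt0 zeta_prim d_per rel).
by rewrite ((prP _ _ _).2 rel); apply: acts_mul => //; apply: acts_X.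
Qed.

(** Moving y_i past x_k creates only elements of the group, whose action is
    known. *)
Lemma acts_Y v f : acts_at (EY r v) f.
Proof.
have -> : v = \sum_i v i 0 *: delta_mx i 0.
  by rewrite {1}[v]matrix_sum_delta; apply: eq_bigr => i _; rewrite big_ord1.
apply: acts_span => [a u u'|i]; first by constructor.
move: f; apply: acts_linear => [|k f IH].
  by rewrite /acts_at eval_Ey Y_one linear0 tau1 [LHS]hy_one.
have Aw w c g : Gr1n r w -> acts_at (c%:S * EW r w)%F g.
  by move=> Gw; apply: acts_mul; [apply: acts_W|apply: acts_scal].
have AXY : acts_at (Ex K r k * Ey K r i)%F f by apply: acts_mul => //; apply: acts_X.
suff : acts_at (Ey K r i * Ex K r k)%F f.
  by rewrite /acts_at prM -scalerA (acts_X (delta_mx 0 k)) /= linform_delta.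
have [ki|ik] := eqVneq k i; last first.
  apply: (acts_pcong (pc_rel (CR_YX zeta r c0 d _))); first by rewrite eq_sym.
  apply: acts_add => //; apply: acts_mul; last exact: acts_scal.
  by apply: acts_sum => l _; apply: Aw; apply: Gr1n_refl; rewrite // eq_sym.
rewrite ki in AXY *; apply: (acts_pcong (pc_rel (CR_YXii zeta r c0 d i))).
apply: acts_add; first apply: acts_add; first apply: acts_add => //.
- exact: acts_scal.
- apply: acts_mul; last exact: acts_scal; apply: acts_sum => q _.
  apply: acts_mul; last exact: acts_scal; apply: acts_mul; last exact: acts_scal.
  by apply: acts_sum => l _; apply: Aw; apply: Gr1n_zeta.
apply: acts_mul; last exact: acts_scal; apply: acts_sum => j ji; apply: acts_sum => l _.
by apply: acts_W; apply: Gr1n_refl; rewrite // eq_sym.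
Qed.

Lemma hact_tau h f : h *: (tau f : Delta) = tau (hact h f).
Proof.
rewrite -[h]prK hact_pr; move: f; elim: (generic_quotient.repr h) => [c|[v|x|w]|x IHx y IHy|x IHx y IHy] f.
- exact: acts_scal.
- exact: acts_Y.
- exact: acts_X.
- have := acts_W f (valP w); rewrite /EW; case: insubP => [u _ /val_inj -> //|].
  by rewrite (valP w).
- exact: acts_add.
- exact: acts_mul.
Qed.

Lemma tau_surj (u : Delta) : exists f, tau f = u.
Proof. by exists (hact (generic_quotient.repr u) 1); rewrite -hact_tau tau1 -pi_one quotmod_piK. Qed.

Lemma hact_triv h : triv_ideal h -> hact h 1 = 0.
Proof.
elim=> [|h' i q _ IH|h' w q Gw _ IH]; first exact: hact0.
  by rewrite hactD hactM hact_y Y_one IH addr0 hact_r0.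
by rewrite hactD hactM hactD hactN hact_w // hact1 poly_act_one subrr IH addr0 hact_r0.
Qed.

Lemma hact_onto f : exists h, hact h 1 = f.
Proof.
elim/mpoly_mulX_ind: f => [|c f g [h eh] [h' eh']|k f [h eh]].
- by exists 1; rewrite hact1.
- by exists (hscal c * h + h'); rewrite hactD hactM hact_scal eh eh'.
- by exists (hx k * h); rewrite hactM hact_x eh.
Qed.

(** The left ideal that defines the standard module annihilates the polynomial
    1. *)
Lemma tau_eq0 f : tau f = 0 -> f = 0.
Proof.
have [h <-] := hact_onto f; rewrite -hact_tau tau1 -pi_one => e.
have /quotmod_eqP : quotmod_pi trivcl h = quotmod_pi trivcl 0 by rewrite [RHS]pi_one scale0r.
by rewrite subr0 => /asboolP/hact_triv.
Qed.

Lemma tau_inj : injective tau.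
Proof. by move=> f g e; apply/eqP; rewrite -subr_eq0; apply/eqP/tau_eq0; rewrite linearB /= e subrr. Qed.

End StandardModule.


(** * The eigenvectors and the irreducible quotient *)

Section IrreducibleQuotient.
Variables (K : numFieldType) (n' r l : nat) (c0 : K) (d : int -> K) (zeta : K).
Local Notation n := n'.+1.
Hypotheses (r_gt0 : (0 < r)%N) (l_gt0 : (0 < l)%N) (co_ln : coprime l n).
Hypotheses (c0E : c0 = l%:R / n%:R) (d_per : forall j : int, d (j + r%:Z) = d j).
Hypothesis zeta_prim : r.-primitive_root zeta.
Local Notation P := {mpoly K[n]}.
Local Notation expo := {ffun 'I_n -> nat}.
Implicit Types (a b : expo) (i j k : 'I_n) (f g : P) (w : 'M[K]_n).
Local Notation Xm := (@Xm K n).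
Local Notation Y := (@Y K n r c0 d).
Local Notation Z := (@Z K n r c0 d).
Local Notation ev := (@ev K n r c0 d).
Local Notation F := (@F K n' r c0 d).
Local Notation Bad := (@Bad K n' r l c0 d).
Local Notation stable := (@stable K n' r c0 d).
Local Notation E := (fexp K (cgen K r n)).
Local Notation crel := (@crel K zeta r n c0 d).
Local Notation H := (@Hc K zeta r n c0 d).
Local Notation Delta := (@Delta_triv K zeta r n c0 d).
Local Notation eval := (@eval K n r c0 d).
Local Notation hact := (@hact K n r c0 d zeta).
Local Notation tau := (@tau K n r c0 d zeta).
Local Notation hx := (@hx K zeta r n c0 d).
Local Notation hy := (@hy K zeta r n c0 d).
Local Notation hw := (@hw K zeta r n c0 d).
Local Notation hscal := (@hscal K zeta r n c0 d).
Local Notation FF := (F_spec r_gt0 l_gt0 co_ln c0E d_per).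

Lemma hact_tauE h f : h *: (tau f : Delta) = tau (hact h f).
Proof. exact: hact_tau. Qed.

Lemma poly_act_zeta1 i a : poly_act (zeta_mx zeta i) (Xm a) = zeta ^- a i *: Xm a.
Proof. by rewrite -[zeta_mx zeta i]expr1 (poly_act_zeta r_gt0 zeta_prim) mul1n. Qed.

Lemma cf_poly_act_zeta i f b : cf b (poly_act (zeta_mx zeta i) f) = zeta ^- b i * cf b f.
Proof.
elim/mpoly_span_ind: f => [|c f g IHf IHg|a].
- by rewrite /poly_act !linear0 mulr0.
- by rewrite poly_act_is_linear !linearP /= IHf IHg; ring.
rewrite poly_act_zeta1 linearZ /= cfX; have [->//|_] := eqVneq a b.
by rewrite !mulr0.
Qed.

Lemma is_f_F a : is_f a (tau (F a)).
Proof.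
have [[ZF cl] ca] := FF a; split.
- move=> i; exists (ev i a).
  by rewrite hact_tauE (hact_z _ r_gt0 zeta_prim d_per) ZF tauZ.
- move=> i; exists (zeta ^- a i).
  rewrite hact_tauE (hact_w _ r_gt0 zeta_prim d_per); last first.
    by rewrite -[zeta_mx zeta i]expr1; apply: Gr1n_zeta.
  rewrite -tauZ; congr (tau _); apply/cfP => b.
  rewrite cf_poly_act_zeta linearZ /=; have [->|nz] := eqVneq (cf b (F a)) 0; first by rewrite !mulr0.
  congr (_^-1 * _); apply/eqP; rewrite (eq_prim_root_expr zeta_prim).
  by apply/eqP/cl.
pose s := [seq m <- msupp (F a) | ex m != a].
exists [seq ex m | m <- s], (fun b => cf b (F a)); split.
  move=> b /mapP[m]; rewrite mem_filter mcoeff_msupp => /andP[ma nz] ->.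
  have [|/eqP|//] := F_supp r_gt0 l_gt0 co_ln c0E d_per (a := a) (b := ex m).
    by rewrite /cf exK.
  by rewrite (negPf ma).
rewrite -{1}(lin_id (F a)) /lin -lock (bigD1_seq (mn a)) ?msupp_uniq //=; last first.
  by rewrite mcoeff_msupp -/(cf a _) ca oner_neq0.
rewrite mnK -/(cf a _) ca scale1r linearD /= tauX big_map linear_sum /= big_filter.
congr (_ + _); apply: eq_big => [m|m _].
  by rewrite -(inj_eq (can_inj (@exK n))) mnK.
by rewrite tauZ tauX /cf exK.
Qed.

(** The eigenvalues of an eigenvector are read off at its leading monomial x^a,
    so it is a joint eigenvector for [a]. *)
Lemma f_alphaE a : f_alpha zeta r c0 d a = tau (F a).
Proof.
apply: xget_subset1; first exact: is_f_F.
suff uniq_f u : is_f a u -> u = tau (F a) by move=> u v /uniq_f -> /uniq_f ->.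
have [g <-] := tau_surj r_gt0 zeta_prim d_per u; case=> zg wg [s [q [sa eg]]].
congr (tau _).
have eg' : g = Xm a + \sum_(b <- s) q b *: Xm b.
  apply: (tau_inj r_gt0 zeta_prim d_per); apply: (etrans eg); apply: esym.
  rewrite linearD /= linear_sum /= tauX.
  by congr (_ + _); apply: eq_bigr => b _; rewrite tauZ tauX.
have irr b : b \in s -> b != a.
  by move=> /sa lba; apply/eqP => e; move: lba; rewrite e; apply: expo_lt_irr.
have supp b : cf b g != 0 -> b = a \/ expo_lt b a.
  move=> nz; have [bs|nbs] := boolP (b \in s); first by right; apply: sa.
  left; apply: contra_neq_eq nz => ba.
  rewrite eg' linearD linear_sum /= cfX eq_sym (negPf ba) add0r big_seq big1 // => c cs.
  by rewrite linearZ /= cfX; have [e|_] := eqVneq c b; [rewrite -e cs in nbs|rewrite mulr0].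
have ga : cf a g = 1.
  rewrite eg' linearD linear_sum /= cfX eqxx big_seq big1 ?addr0 // => c cs.
  by rewrite linearZ /= cfX (negPf (irr _ cs)) mulr0.
have gE : isE r c0 d a g.
  split=> [i|b nz i].
    have [e he] := zg i; move: he.
    rewrite hact_tauE (hact_z _ r_gt0 zeta_prim d_per) -tauZ => /(tau_inj r_gt0 zeta_prim d_per) Zg.
    suff -> : ev i a = e by [].
    have := congr1 (cf a) Zg; rewrite cf_Z_top => [|c /supp[->|lca lac]]; last first.
    - by have := expo_lt_trans lac lca; apply: expo_lt_irr.
    - exact: expo_lt_irr.
    by rewrite linearZ /= ga !mulr1.
  have [e he] := wg i; move: he.
  rewrite hact_tauE (hact_w _ r_gt0 zeta_prim d_per); last first.
    by rewrite -[zeta_mx zeta i]expr1; apply: Gr1n_zeta.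
  rewrite -tauZ => /(tau_inj r_gt0 zeta_prim d_per) Wg.
  have := congr1 (cf a) Wg; have := congr1 (cf b) Wg.
  rewrite !cf_poly_act_zeta !linearZ /= ga !mulr1 => /(mulIf nz) eb ea.
  apply/eqP; rewrite -(eq_prim_root_expr zeta_prim); apply/eqP/invr_inj.
  by rewrite eb ea.
by rewrite (isE_scaleF r_gt0 l_gt0 co_ln c0E d_per gE) ga scale1r.
Qed.

Lemma Delta_degP (k : nat) u : Delta_deg k u <->
  exists2 f, (forall b, cf b f != 0 -> expo_sum b = k) & tau f = u.
Proof.
split=> [[s [c [sk ->]]]|[f fk <-]].
  exists (\sum_(b <- s) c b *: Xm b).
    move=> b; rewrite linear_sum /= => nz; apply: contrapT => nk.
    move/eqP: nz; apply; rewrite big_seq big1 // => x xs.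
    by rewrite linearZ /= cfX; have [e|_] := eqVneq x b; [rewrite -e sk in nk|rewrite mulr0].
  by rewrite linear_sum /=; apply: eq_bigr => b _; rewrite tauZ tauX.
exists [seq ex m | m <- msupp f], (fun b => cf b f); split.
  by move=> b /mapP[m]; rewrite mcoeff_msupp => nz ->; apply: fk; rewrite /cf exK.
rewrite -{1}(lin_id f) /lin -lock linear_sum [RHS]big_map /=.
by apply: eq_bigr => m _; rewrite tauZ tauX /cf exK.
Qed.

Lemma cf_mono1 (mu : 'I_n -> K) b f : cf b (mono 1%g mu f) = chi mu b * cf b f.
Proof.
elim/mpoly_span_ind: f => [|c f g IHf IHg|a]; first by rewrite !linear0 mulr0.
  by rewrite !linearP /= IHf IHg; ring.
rewrite monoX linearZ /=.
have -> : expo_act 1%g a = a by apply/ffunP => j; rewrite ffunE invg1 perm1.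
by rewrite cfX; have [->|] := eqVneq a b; rewrite ?mulr0.
Qed.

Lemma cls_poly_act i q f : cls r i q f =
  r%:R^-1 *: \sum_(m < r) zeta ^+ (m * q) *: poly_act (zeta_mx zeta i ^+ m) f.
Proof.
elim/mpoly_span_ind: f => [|c f g IHf IHg|a].
- by rewrite linear0 big1 ?scaler0 // => m _; rewrite /poly_act linear0 scaler0.
- rewrite linearP /= IHf IHg scalerA mulrC -scalerA -scalerDr scaler_sumr -big_split.
  congr (_ *: _); apply: eq_bigr => m _ /=.
  by rewrite poly_act_is_linear -!mul_mpolyC; ring.
rewrite /cls linX.
under eq_bigr => m _ do rewrite (poly_act_zeta r_gt0 zeta_prim) ?scalerA.
rewrite -scaler_suml scalerA (sum_zetaB r_gt0 zeta_prim) eq_sym; congr (_ *: _).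
by case: ifP; rewrite ?mulr0 // mulVf // pnatr_eq0 -lt0n.
Qed.

Section Stable.
Variable U : P -> Prop.
Hypothesis stU : stable U.
Let subU := stable_sub stU.

(** A diagonal matrix of r-th roots of unity is a product of combinations of
    spectral projections. *)
Lemma st_mono (s : 'S_n) (la : 'I_n -> K) f : (forall k, la k ^+ r = 1) -> U f -> U (mono s la f).
Proof.
move=> lar Uf; have -> : mono s la f = pm s (mono 1%g la f).
  rewrite pm_mono mono_comp mul1g; apply: eq_mono => k; by rewrite mul1r.
apply: (stable_pm stU).
have -> : mono 1%g la f = mono 1%g (fun k => if k \in enum 'I_n then la k else 1) f.
  by apply: eq_mono => k; rewrite mem_enum.
elim: (enum 'I_n) (enum_uniq 'I_n) => [|k t IH] /= => [_|/andP[kt /IH Ut]].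
  by rewrite -[mono _ _ _]/(mono 1%g (fun=> 1) f) mono1.
set g := mono _ _ f in Ut.
have -> : mono 1%g (fun j => if j \in k :: t then la j else 1) f =
          \sum_(q < r) la k ^+ q *: cls r k q g.
  apply/cfP => b; rewrite linear_sum /=.
  under eq_bigr => q _ do rewrite linearZ /= cf_cls.
  rewrite (bigD1 (Ordinal (ltn_pmod (b k) r_gt0))) //= modn_mod eqxx big1 ?addr0 => [|q qb].
    rewrite cf_mono1 /g cf_mono1 mulrA; congr (_ * _).
    rewrite (expr_mod _ (lar k)) /chi (bigD1 k) //= inE eqxx; congr (_ * _).
    rewrite [RHS](bigD1 k) //= (negPf kt) expr1n mul1r.
    by apply: eq_bigr => j jk; rewrite inE (negPf jk).
  rewrite ifN ?mulr0 //; apply: contra qb => /eqP e.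
  by apply/eqP/val_inj; rewrite /= e modn_small.
by apply: sp_sum => // q _; apply: sp_scale => //; apply: (stable_cls stU).
Qed.

Lemma st_eval e f : U f -> U (eval e f).
Proof.
elim: e f => [c|[v|x|[w Gw]]|x IHx y IHy|x IHx y IHy] f Uf /=.
- exact: sp_scale.
- by apply: sp_sum => // i _; apply: sp_scale => //; apply: (stable_Y stU).
- rewrite /linform mulr_suml; apply: sp_sum => // i _; rewrite -scalerAl.
  by apply: sp_scale => //; apply: (stable_mulX stU).
- have [s [la [lar ->]]] := Gr1nP Gw.
  rewrite poly_act_mmx => [|k]; last exact: root_neq0 (lar k).
  by apply: st_mono => // k; rewrite exprVn lar invr1.
- by apply: sp_add => //; [apply: IHx|apply: IHy].
- by apply: IHx; apply: IHy.
Qed.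

End Stable.

Section Quotient.
Variables (L : lmodType H) (p : {linear Delta -> L}).
Hypothesis irr_p : is_Ltriv p.

Definition ptau f : @over_scalars K _ crel L := p (tau f).

Lemma ptau_is_linear : linear ptau.
Proof.
move=> c f g; rewrite /ptau linearD /= tauZ.
by rewrite [LHS](linearP p (hscal c)).
Qed.
HB.instance Definition _ := GRing.isLinear.Build K P (@over_scalars K _ crel L) _ ptau ptau_is_linear.

Lemma ptau_hact h f : ptau (hact h f) = h *: (ptau f : L).
Proof. by rewrite /ptau -(hact_tau r_gt0 zeta_prim d_per); apply: (linearZ_LR p). Qed.

Lemma ptau_stable : stable (fun f => ptau f = 0).
Proof.
have ker h f : ptau f = 0 -> ptau (hact h f) = 0.
  by move=> e; rewrite ptau_hact e [LHS]scaler0.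
split.
- by split=> [|c f g ef eg]; rewrite ?linear0 // linearP /= ef eg scaler0 addr0.
- by move=> i f /(ker (hx i)); rewrite (hact_x _ r_gt0).
- by move=> i f /(ker (hy i)); rewrite (hact_y _ r_gt0).
- move=> s f /(ker (hw (mmx s (fun=> 1)))); rewrite (hact_w _ r_gt0) //; last first.
    by apply: Gr1n_mmx => // k; rewrite expr1n.
  rewrite poly_act_mmx => [|k]; last exact: oner_neq0.
  by rewrite pm_mono (@eq_mono _ _ _ _ (fun=> 1)) // => k; rewrite invr1.
move=> i q f ef.
rewrite cls_poly_act linearZ linear_sum /= big1 ?scaler0 // => m _.
rewrite linearZ /= -(hact_w c0 r_gt0 zeta_prim d_per); last exact: Gr1n_zeta.
by rewrite ker ?scaler0.
Qed.

Lemma ptau_surj v : exists f, ptau f = v.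
Proof.
have [_ surj] := irr_p; have [u <-] := surj v.
by have [f <-] := tau_surj r_gt0 zeta_prim d_per u; exists f.
Qed.

Lemma ptau_one : ptau 1 <> 0.
Proof.
move=> p1; have [[[v v0] _] _] := irr_p; have [f fv] := ptau_surj v.
have := sp_one (stable_sub ptau_stable) (stable_mulX ptau_stable) p1 f.
by rewrite fv => e; rewrite e eqxx in v0.
Qed.

(** The image of [Bad] is a submodule of the irreducible module; if it were
    everything, 1 would be congruent to an element of [Bad] modulo the kernel,
    which lies in [Bad]. *)
Lemma ptau_eq0 f : ptau f = 0 <-> Bad f.
Proof.
have ker_Bad g : ptau g = 0 -> Bad g.
  move=> pg; apply: contrapT => nB; apply: ptau_one.
  exact: (stable_dichotomy r_gt0 l_gt0 co_ln c0E d_per ptau_stable pg nB).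
split=> [|Bf]; first exact: ker_Bad.
have stB := Bad_stable r_gt0 l_gt0 co_ln c0E d_per.
pose U : {pred L} := fun v => `[< exists2 g, Bad g & v = ptau g >].
have clU : submod_closed U.
  split=> [|h u v].
    by apply/asboolP; exists 0; [apply: (stable_sub stB).1|rewrite linear0].
  move=> /asboolP[g Bg ->] /asboolP[g' Bg' ->]; apply/asboolP.
  exists (hact h g + g'); first by apply: (sp_add (stable_sub stB)) => //; apply: (st_eval stB).
  by rewrite linearD /= ptau_hact.
have [_ irr] := irr_p.1; have [U0|UT] := irr U clU.
  have : ptau f \in U by apply/asboolP; exists f.
  by rewrite U0 => /eqP.
have : ptau 1 \in U by rewrite UT.
move=> /asboolP[g Bg e1]; have B1g : Bad (1 - g) by apply: ker_Bad; rewrite linearB /= e1 subrr.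
case: (Bad_one r_gt0 l_gt0 co_ln c0E d_per).
by rewrite -(subrK g 1); apply: (sp_add (stable_sub stB)).
Qed.

Lemma Ltriv_basis (D : nat -> Prop) :
  is_basis [set a | good r l d a /\ D (expo_sum a)]%classic
    (fun a => ptau (F a))
    [set v | exists2 f, forall b, cf b f != 0 -> D (expo_sum b) & ptau f = v]%classic.
Proof. exact: (quotient_basis r_gt0 l_gt0 co_ln c0E d_per _ ptau_eq0). Qed.

Lemma Ltriv_degE (k : nat) : Ltriv_deg p k =
  [set v | exists2 f, forall b, cf b f != 0 -> expo_sum b = k & ptau f = v]%classic.
Proof.
apply: funext => v; apply: propext; split=> [[u /Delta_degP[f fk <-] <-]|[f fk <-]].
  by exists f.
by exists (tau f) => //; apply/Delta_degP; exists f.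
Qed.

End Quotient.

End IrreducibleQuotient.


(** * The root of unity *)

Section RootOfUnity.
Variable R : realType.

Lemma zeta_rootX (r m : nat) : zeta_root R r ^+ m =
  (cos (2 * pi / r%:R *+ m) +i* sin (2 * pi / r%:R *+ m))%C.
Proof.
elim: m => [|m IH]; first by rewrite expr0 !mulr0n cos0 sin0.
rewrite exprS IH /zeta_root; set x : R := _ / _; rewrite [x *+ m.+1]mulrS.
rewrite cosD sinD; move: (cos (x *+ m)) (sin (x *+ m)) (cos x) (sin x) => a' b' a b.
by apply/eqP; rewrite eq_complex /= [b * a' + _]addrC !eqxx.
Qed.

Lemma zeta_root_prim (r : nat) : (0 < r)%N -> r.-primitive_root (zeta_root R r).
Proof.
move=> r_gt0; have r0 : (r%:R : R) != 0 by rewrite pnatr_eq0 -lt0n.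
rewrite /primitive_root_of_unity r_gt0; apply/forallP => i.
rewrite unity_rootE zeta_rootX eq_complex /=; apply/eqP.
have [ir|ir] := eqVneq i.+1 r.
  have -> : 2 * pi / r%:R *+ i.+1 = pi *+ 2 :> R by rewrite ir -[LHS]mulr_natr divfK // [LHS]mulr_natl.
  by rewrite cos2pi sin2pi !eqxx.
have lt : (i.+1 < r)%N by rewrite ltn_neqAle ir ltn_ord.
apply/negbTE/negP => /andP[/eqP c1 _].
pose y : R := pi / r%:R *+ i.+1.
have e : 2 * pi / r%:R *+ i.+1 = y *+ 2 by rewrite /y mulrnAC -[2 * pi / _]mulrA [2 * _]mulr_natl.
have : 0 < sin y.
  apply: sin_gt0_pi; rewrite /y -mulr_natr; have p0 := pi_gt0 R.
  have rp : (0 : R) < r%:R by rewrite ltr0n.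
  rewrite mulr_gt0 ?divr_gt0 ?ltr0n //= mulrAC ltr_pdivrMr // ltr_pM2l //.
  by rewrite ltr_nat.
move: c1; rewrite e cos_mulr2n cos2sin2 => c1.
have : sin y ^+ 2 = 0 by lra.
by move/eqP; rewrite sqrf_eq0 => /eqP ->; rewrite ltxx.
Qed.

End RootOfUnity.


(** * Dunkl operators of a reflection group *)

Section OneReflection.
Variables (K : numFieldType) (N : nat) (s : 'M[K]_N) (u : 'cV[K]_N) (al : 'rV[K]_N).
Variables (i0 j0 : 'I_N).
Hypotheses (sE : s = 1%:M + u *m al) (ss : s *m s = 1%:M).
Hypotheses (al1 : al 0 i0 = 1) (u0 : u j0 0 != 0).
Local Notation P := {mpoly K[N]}.
Implicit Types (f g h : P) (v y : 'cV[K]_N).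

Lemma row_mul_delta (b : 'rV[K]_N) i : (b *m (delta_mx i 0 : 'cV[K]_N)) 0 0 = b 0 i.
Proof.
rewrite mxE (bigD1 i) //= mxE !eqxx mulr1 big1 ?addr0 // => j ji.
by rewrite mxE (negPf ji) mulr0.
Qed.

Lemma refl_fix v : s *m v = v <-> al *m v = 0.
Proof.
rewrite sE mulmxDl mul1mx -mulmxA; split=> [/eqP|->]; last by rewrite mulmx0 addr0.
rewrite -subr_eq0 addrC addKr => /eqP e.
apply/matrixP => x y; rewrite !ord1 [RHS]mxE.
have := congr1 (fun A : 'cV_N => A j0 0) e; rewrite /= mxE big_ord1 [RHS]mxE => /eqP.
by rewrite mulf_eq0 (negPf u0) => /eqP.
Qed.

Lemma refl_rank : \rank (s - 1%:M) = 1%N.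
Proof.
rewrite sE addrC addKr; apply/eqP; rewrite eqn_leq (leq_trans (mxrankM_maxl _ _)) ?rank_leq_col //=.
rewrite lt0n mxrank_eq0; apply/eqP => /(congr1 (fun A : 'M_N => A j0 i0)) /eqP.
by rewrite /= !mxE big_ord1 al1 mulr1 (negPf u0).
Qed.

(** Two linear forms with the same kernel are proportional. *)
Lemma refl_unique (b : 'rV[K]_N) : (forall v, s *m v = v <-> b *m v = 0) ->
  exists2 lam, lam != 0 & b = lam *: al.
Proof.
move=> bP; pose v0 : 'cV[K]_N := delta_mx i0 0.
have e v : (b *m v) 0 0 = (al *m v) 0 0 * b 0 i0.
  suff : b *m (v - (al *m v) 0 0 *: v0) = 0.
    move=> /matrixP/(_ 0 0); rewrite mulmxBr -scalemxAr [LHS]mxE [X in _ + X]mxE [X in _ - X]mxE row_mul_delta [RHS]mxE.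
    by move/eqP; rewrite subr_eq0 => /eqP.
  apply/bP/refl_fix; rewrite mulmxBr -scalemxAr; apply/matrixP => x y.
  by rewrite !ord1 [LHS]mxE [X in _ + X]mxE [X in _ - X]mxE row_mul_delta al1 mulr1 subrr mxE.
exists (b 0 i0).
  apply/eqP => b0; have : s *m v0 = v0.
    by apply/bP/matrixP => x y; rewrite !ord1 e b0 mulr0 mxE.
  move/refl_fix/(congr1 (fun A : 'M_1 => A 0 0)); rewrite row_mul_delta al1 mxE => /eqP.
  by rewrite oner_eq0.
apply/rowP => j; have := e (delta_mx j 0); rewrite !row_mul_delta mxE => ->.
by rewrite mulrC.
Qed.

Lemma alpha_formE : exists2 lam, lam != 0 & alpha_form s = lam *: al.
Proof.
apply: refl_unique; rewrite /alpha_form; case: xgetP => [a -> //|none].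
by case: (none al); apply: refl_fix.
Qed.

Lemma refl_X k : poly_act s 'X_k = 'X_k + u k 0 *: linform al.
Proof.
have -> : poly_act s ('X_k : P) = linform (row k s).
  have inv_s : invmx s = s.
    have [su _] := mulmx1_unit ss.
    by rewrite -[LHS]mulmx1 -ss mulmxA mulVmx // mul1mx.
  by rewrite /poly_act comp_mpolyXU -tnth_nth tnth_mktuple inv_s.
have -> : row k s = delta_mx 0 k + u k 0 *: al.
  by apply/rowP => j; rewrite sE !mxE big_ord1 eqxx /= [j == k]eq_sym.
by rewrite linformD linform_scale linform_delta.
Qed.

Lemma linform_neq0 : linform al != 0 :> P.
Proof.
apply/eqP => /(congr1 (mcoeff U_(i0))) /eqP.
rewrite mcoeff0 /linform linear_sum /= (bigD1 i0) //= linearZ /= mcoeffXU eqxx al1 mulr1.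
rewrite big1 ?addr0 ?oner_eq0 // => j ji.
by rewrite linearZ /= mcoeffXU (negPf ji) mulr0.
Qed.

Lemma refl_div f : exists h, f - poly_act s f = h * linform al.
Proof.
elim/mpoly_mulX_ind: f => [|c f g [h eh] [h' eh']|k f [h eh]].
- by exists 0; rewrite /poly_act comp_mpoly1 subrr mul0r.
- exists (c *: h + h'); rewrite poly_act_is_linear mulrDl -scalerAl -eh -eh'.
  by rewrite -!mul_mpolyC; ring.
exists ('X_k * h - u k 0 *: poly_act s f).
have -> : poly_act s ('X_k * f) = poly_act s 'X_k * poly_act s f by rewrite /poly_act rmorphM.
rewrite refl_X mulrBl -mulrA -eh -!mul_mpolyC; ring.
Qed.

(** The divided difference attached to the reflection. *)
Definition dq f : P := mpoly_quo (f - poly_act s f) (linform al).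

Lemma mpoly_quoE f g h : g != 0 -> f = h * g -> mpoly_quo f g = h.
Proof.
move=> g0 e; rewrite /mpoly_quo; case: xgetP => [h' _ /= e'|none]; last by case: (none h).
by apply: (mulIf g0); rewrite -e -e'.
Qed.

Lemma dqE f : f - poly_act s f = dq f * linform al.
Proof.
by have [h eh] := refl_div f; rewrite /dq (mpoly_quoE linform_neq0 eh).
Qed.

Lemma dq_unique f h : f - poly_act s f = h * linform al -> dq f = h.
Proof. exact: mpoly_quoE linform_neq0. Qed.

Lemma dq_linear : linear dq.
Proof.
move=> c f g; apply: dq_unique; rewrite poly_act_is_linear mulrDl -scalerAl -!dqE.
by rewrite -!mul_mpolyC; ring.
Qed.

Lemma dq1 : dq 1 = 0.
Proof. by apply: dq_unique; rewrite /poly_act comp_mpoly1 subrr mul0r. Qed.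

Lemma dq_mulX k f : dq ('X_k * f) = 'X_k * dq f - u k 0 *: poly_act s f.
Proof.
apply: dq_unique.
have -> : poly_act s ('X_k * f) = poly_act s 'X_k * poly_act s f by rewrite /poly_act rmorphM.
rewrite refl_X mulrBl -mulrA -dqE -!mul_mpolyC; ring.
Qed.

(** The scalar between [alpha_form s] and [al] cancels. *)
Lemma dunkl_term (c : K) y f :
  (c * (alpha_form s *m y) 0 0) *:
    mpoly_quo (f - poly_act s f) (linform (alpha_form s)) =
  (c * (al *m y) 0 0) *: dq f.
Proof.
have [lam lam0 ->] := alpha_formE; rewrite -scalemxAl linform_scale.
rewrite (@mpoly_quoE _ _ (lam^-1 *: dq f)).
- by rewrite mxE scalerA; congr (_ *: _); field.
- by rewrite scaler_eq0 negb_or lam0 linform_neq0.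
- by rewrite dqE -scalerAl -scalerAr scalerA mulVf // scale1r.
Qed.

End OneReflection.

(** ** The reflections of G(2,1,N) and G(2,2,N) *)

Section Classification.
Variables (K : numFieldType) (N : nat).
Implicit Types (i j k : 'I_N) (w : 'S_N) (la : 'I_N -> K) (s : 'M[K]_N).
Local Notation T := ('I_N * 'I_N * 'I_2 + 'I_N)%type.

Lemma two_neq0 : (2 : K) != 0. Proof. by rewrite pnatr_eq0. Qed.

Lemma m1_neq1 : (-1 == 1 :> K) = false.
Proof. by apply/negbTE; rewrite eq_sym -subr_eq0 opprK -(mulr2n 1) pnatr_eq0. Qed.

Lemma m1_prim : 2.-primitive_root (-1 : K).
Proof.
rewrite /primitive_root_of_unity; apply/andP; split=> //; apply/forallP => -[[|[|m]] lem] //=.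
  by rewrite unity_rootE expr1 m1_neq1.
by rewrite unity_rootE sqrrN expr1n !eqxx.
Qed.

Lemma sqr1P (x : K) : x ^+ 2 = 1 -> x = 1 \/ x = -1.
Proof. by move/eqP; rewrite sqrf_eq1 => /orP[]/eqP; [left|right]. Qed.

Lemma signV (m : nat) : ((-1) ^- m : K) = (-1) ^+ m.
Proof. by rewrite -exprVn invrN1. Qed.

Lemma mmx_inj w la w' la' : (forall k, la k != 0) -> mmx w la = mmx w' la' -> w = w' /\ la =1 la'.
Proof.
move=> nz /matrixP e; have ww : w = w'.
  apply/permP => k; have := e (w k) k; rewrite !mxE eqxx.
  by case: eqP => // _ l0; have := nz k; rewrite l0 eqxx.
by split=> // k; have := e (w k) k; rewrite !mxE -ww !eqxx.
Qed.

Lemma rank1_minor s x y x' y' : \rank s = 1%N -> s x y * s x' y' = s x y' * s x' y.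
Proof.
move=> rk1; have := mulmx_base s; move: (col_base s) (row_base s); rewrite rk1 => u v <-.
by rewrite !mxE !big_ord1; ring.
Qed.

(** Index set for the reflections: [inl (i, j, l)] stands for the hyperplane
    [x_i = (-1)^l x_j], [inr k] for the hyperplane [x_k = 0]. *)
Definition rs (t : T) : 'M[K]_N :=
  match t with inl p => refl_mx (-1) p.1.1 p.1.2 p.2 | inr k => zeta_mx (-1) k end.

Definition ral (t : T) : 'rV[K]_N :=
  match t with
  | inl p => delta_mx 0 p.1.1 - (-1) ^+ p.2 *: delta_mx 0 p.1.2
  | inr k => delta_mx 0 k
  end.

Definition ru (t : T) : 'cV[K]_N :=
  match t with
  | inl p => - (delta_mx p.1.1 0 - (-1) ^+ p.2 *: delta_mx p.1.2 0)
  | inr k => (-2) *: delta_mx k 0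
  end.

Definition ordered_idx (t : T) : bool := if t is inl p then (p.1.1 < p.1.2)%N else true.

Definition m1la i j (l : nat) k : K := if (k == i) || (k == j) then (-1) ^+ l else 1.

Lemma refl_m1E i j (l : nat) : i != j -> refl_mx (-1) i j l = mmx (tperm i j) (m1la i j l).
Proof.
move=> ij; rewrite (refl_mxE (ltn0Sn 1) m1_prim) //; apply: eq_mmx => k.
by rewrite /m1la signV; case: eqP => //= _; case: eqP.
Qed.

Lemma lt_ord_neq i j : (i < j)%N -> i != j.
Proof. by move=> ij; rewrite -val_eqE neq_ltn ij. Qed.

Lemma rsE t : ordered_idx t -> rs t = 1%:M + ru t *m ral t.
Proof.
case: t => [[[i j] l] /lt_ord_neq /= ij|k _] /=; apply/matrixP => x y.
  rewrite refl_m1E // !mxE big_ord1 !mxE !eqxx !andbT /= /m1la.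
  have ji : (j == i) = false by rewrite eq_sym (negPf ij).
  have sq : (-1) ^+ l * (-1) ^+ l = 1 :> K by rewrite -exprMn mulrNN mulr1 expr1n.
  case: tpermP => [->|->|/eqP yi /eqP yj]; rewrite ?eqxx ?(negPf ij) ?ji ?orbT /=.
  - have [->|xj] := eqVneq x j; rewrite ?ji /= ?eqxx; first by ring.
    by have [_|_] := eqVneq x i; rewrite /=; ring.
  - have [->|xi] := eqVneq x i; rewrite ?(negPf ij) /= ?eqxx; first by ring.
    have [_|_] := eqVneq x j; last by rewrite /=; ring.
    rewrite /=; transitivity (1 - (-1) ^+ l * (-1) ^+ l : K); last by ring.
    by rewrite sq; ring.
  by rewrite (negPf yi) (negPf yj) /=; have [_|_] := eqVneq x y; rewrite /=; ring.
rewrite zeta_mxE !mxE big_ord1 !mxE !eqxx !andbT /= perm1.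
have [->|xy] := eqVneq x y; last first.
  have [yk|_] := eqVneq y k; last by rewrite /=; ring.
  by rewrite -yk (negPf xy) /=; ring.
by have [_|_] := eqVneq y k; rewrite /=; ring.
Qed.

Lemma rs_sq t : ordered_idx t -> rs t *m rs t = 1%:M.
Proof.
have sq (l : nat) : (-1) ^+ l * (-1) ^+ l = 1 :> K by rewrite -exprMn mulrNN mulr1 expr1n.
case: t => [[[i j] l] /lt_ord_neq /= ij|k _] /=; last first.
  rewrite zeta_mxE mmxM mulg1 -mmx1; apply: eq_mmx => k'; rewrite perm1.
  by case: eqP; rewrite ?mulrNN mulr1.
rewrite refl_m1E // mmxM tperm2 -mmx1; apply: eq_mmx => k; rewrite /m1la.
case: tpermP => [->|->|/eqP ki /eqP kj]; rewrite ?eqxx ?orbT ?sq //.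
by rewrite (negPf ki) (negPf kj) mulr1.
Qed.

Lemma ral_lead t : ordered_idx t -> {i | ral t 0 i = 1 & ru t i 0 != 0}.
Proof.
case: t => [[[i j] l] /lt_ord_neq /= ij|k _] /=.
  exists i; rewrite !mxE !eqxx (negPf ij) ?andbF /= mulr0 subr0 //.
  by rewrite oppr_eq0 oner_eq0.
by exists k; rewrite !mxE !eqxx //= mulr1 oppr_eq0 two_neq0.
Qed.

(** All 2 x 2 minors of s - 1 vanish. If the permutation of [s] moves [i], the
    minors with the column [i] show that [s] fixes every coordinate other than
    [i] and its image. *)
Lemma reflection_idx s : Gr1n 2 s -> \rank (s - 1%:M) = 1%N ->
  exists2 t, ordered_idx t & s = rs t.
Proof.
move=> /Gr1nP[w [la [la2 ->]]] rk1.
have minor x y x' y' := rank1_minor x y x' y' rk1.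
have A x y : (mmx w la - 1%:M) x y = (if x == w y then la y else 0) - (x == y)%:R.
  by rewrite !mxE.
have [[i wi]|fix_w] := pselect (exists i, w i != i); last first.
  have w1 : w = 1%g.
    apply/permP => i; rewrite perm1; apply/eqP; apply: contrapT => /negP wi.
    by apply: fix_w; exists i.
  have Ad x y : (mmx w la - 1%:M) x y = if x == y then la y - 1 else 0.
    by rewrite A w1 perm1; case: eqP => // _; rewrite subr0.
  have [k lak] : exists k, la k != 1.
    apply: contrapT => no; have := rk1; suff -> : mmx w la - 1%:M = 0 by rewrite mxrank0.
    apply/matrixP => x y; rewrite Ad [RHS]mxE; case: eqP => // _.
    by apply/eqP; rewrite subr_eq0; apply: contrapT => /negP ny; apply: no; exists y.
  exists (inr k) => //=; rewrite zeta_mxE w1; apply: eq_mmx => j.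
  have lak1 : la k = -1 by have [e|//] := sqr1P (la2 k); rewrite e eqxx in lak.
  case: eqP => [->//|/eqP jk]; apply/eqP; rewrite -subr_eq0.
  have := minor k k j j; rewrite !Ad !eqxx (negPf jk) mulr0 => /eqP.
  by rewrite mulf_eq0 !subr_eq0 (negPf lak).
pose j := w i; have ji : j != i by [].
have ij : i != j by rewrite eq_sym.
have Aii : (mmx w la - 1%:M) i i = -1 by rewrite A eqxx eq_sym (negPf ji) sub0r.
have far k : k != i -> k != j -> w k = k /\ la k = 1.
  move=> ki kj; have := minor i i k k.
  have -> : (mmx w la - 1%:M) k i = 0 by rewrite A (negPf kj) (negPf ki) subrr.
  rewrite Aii A eqxx mulr0; case: eqP => [<-|_] /eqP.
    by rewrite mulN1r oppr_eq0 subr_eq0 => /eqP.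
  by rewrite sub0r mulrNN mulr1 oner_eq0.
have wj : w j = i.
  apply/eqP; apply: contrapT => /negP wji.
  have wjj : w j != j by rewrite (inj_eq perm_inj).
  by have [/perm_inj e _] := far _ wji wjj; rewrite e eqxx in wjj.
have lij : la i * la j = 1.
  have := minor i i j j; rewrite Aii !A wj !eqxx (negPf ij) (negPf ji) !subr0 !sub0r.
  by rewrite mulrNN mulr1 => ->; rewrite mulrC.
have lji : la j = la i.
  by have [e|e] := sqr1P (la2 i); move: lij; rewrite e ?mul1r // mulN1r => /eqP;
     rewrite eqr_oppLR => /eqP.
have wE : w = tperm i j.
  apply/permP => k; case: tpermP => [->//|->//|/eqP ki /eqP kj].
  by have [] := far k ki kj.
have [l el] : exists l : 'I_2, la i = (-1) ^+ l.
  by have [e|e] := sqr1P (la2 i); [exists ord0|exists ord_max]; rewrite e.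
have sE x y : (x == i) && (y == j) || (x == j) && (y == i) -> x != y ->
    mmx w la = refl_mx (-1) x y l.
  move=> xy nxy; rewrite refl_m1E // wE.
  have -> : tperm i j = tperm x y by case/orP: xy => /andP[/eqP -> /eqP ->] //; apply: tpermC.
  apply: eq_mmx => k; rewrite /m1la.
  have -> : (k == x) || (k == y) = (k == i) || (k == j).
    by case/orP: xy => /andP[/eqP -> /eqP ->] //; apply: orbC.
  have [->|ki] := eqVneq k i; first by [].
  have [->|kj] := eqVneq k j; first by rewrite lji.
  by have [] := far k ki kj.
have [lt|le] := ltnP i j.
  by exists (inl (i, j, l)) => //=; apply: sE; rewrite ?eqxx.
exists (inl (j, i, l)) => /=; first by rewrite ltn_neqAle val_eqE ji.
by apply: sE; rewrite ?eqxx ?orbT.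
Qed.

Lemma rs_inj t t' : ordered_idx t -> ordered_idx t' -> rs t = rs t' -> t = t'.
Proof.
have m0 i j (l : nat) k : m1la i j l k != 0.
  by rewrite /m1la; case: ifP => _; rewrite ?oner_eq0 // signr_eq0.
have z0 (k0 k : 'I_N) : (if k == k0 then -1 else 1 : K) != 0.
  by case: ifP => _; rewrite ?oppr_eq0 oner_eq0.
case: t t' => [[[i j] l]|k] [[[i' j'] l']|k'] /=.
- move=> lt lt'; have ij := lt_ord_neq lt; have ij' := lt_ord_neq lt'.
  rewrite !refl_m1E // => /(mmx_inj (m0 _ _ _))[et el].
  have ei : i' = i /\ j' = j.
    have := congr1 (fun p : 'S_N => p i') et; rewrite tpermL.
    case: tpermP => [-> ->//|ei ej|_ _ e]; last by rewrite e eqxx in ij'.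
    by move: lt'; rewrite ei -ej => /ltnW; rewrite leqNgt lt.
  have [ei' ej'] := ei; rewrite ei' ej' in el *; congr (inl (_, _, _)); apply: val_inj.
  have := el i; rewrite /m1la eqxx /=.
  by case: l l' {el} => [[|[|m]] ?] [[|[|m']] ?] //= /eqP;
    rewrite ?expr0 ?expr1 ?m1_neq1 // eq_sym m1_neq1.
- move=> lt _; have ij := lt_ord_neq lt.
  rewrite refl_m1E // zeta_mxE => /(mmx_inj (m0 _ _ _))[et _].
  have := congr1 (fun p : 'S_N => p i) et; rewrite tpermL perm1 => e.
  by rewrite e eqxx in ij.
- move=> _ lt'; have ij' := lt_ord_neq lt'.
  rewrite refl_m1E // zeta_mxE => /(mmx_inj (z0 _))[et _].
  have := congr1 (fun p : 'S_N => p i') et; rewrite tpermL perm1 => e.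
  by rewrite e eqxx in ij'.
move=> _ _; rewrite !zeta_mxE => /(mmx_inj (z0 _))[_ /(_ k)].
by rewrite eqxx; case: eqP => [->//|_ /eqP]; rewrite m1_neq1.
Qed.

Lemma card_mmx_m1 w la :
  #|[set ij : 'I_N * 'I_N | mmx w la ij.1 ij.2 == -1]%SET| = #|[set k | la k == -1]%SET|.
Proof.
rewrite -(card_imset [set k | la k == -1]%SET (f := fun k => (w k, k))) => [|x y [_ ->] //].
apply: eq_card => -[x y]; rewrite !inE /= mxE; apply/idP/imsetP => [|[k]].
  have [->|_] := eqVneq x (w y); last by rewrite eq_sym oppr_eq0 oner_eq0.
  by move=> e; exists y; rewrite ?inE.
by rewrite inE => e [-> ->]; rewrite eqxx.
Qed.

Lemma G21_rs t : ordered_idx t -> G21 (rs t).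
Proof.
case: t => [[[i j] l] /lt_ord_neq ij|k _] /=; first exact: (Gr1n_refl (ltn0Sn 1) m1_prim).
by rewrite -[zeta_mx _ k]expr1; apply: (Gr1n_zeta (ltn0Sn 1) m1_prim).
Qed.

Lemma G22_rs t : ordered_idx t -> G22 (rs t) <-> (if t is inl _ then true else false).
Proof.
move=> ot; have G1 := G21_rs ot; case: t ot G1 => [[[i j] l] /lt_ord_neq ij|k _] /= G1.
  split=> // _; split=> //; rewrite refl_m1E // card_mmx_m1.
  case: l ij {G1} => [[|[|m]] ?] //= ij.
    rewrite (eq_card0 (A := [set k | _]%SET)) // => k; rewrite !inE /m1la expr0 if_same.
    by rewrite eq_sym m1_neq1.
  rewrite (_ : [set k | _]%SET = [set i; j]%SET) ?cards2 ?ij //.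
  apply/setP => k; rewrite !inE /m1la expr1; case: ifP => _; rewrite ?eqxx //.
  by rewrite eq_sym m1_neq1.
split=> // -[_]; rewrite zeta_mxE card_mmx_m1 (_ : [set k | _]%SET = [set k]%SET) ?cards1 //.
by apply/setP => k'; rewrite !inE; have [_|_] := eqVneq k' k; rewrite ?eqxx // eq_sym m1_neq1.
Qed.

End Classification.

(** ** Dunkl operators as the operators y_i *)

Section DunklPolynomial.
Variables (K : numFieldType) (N : nat) (c : K) (b : bool).
Local Notation P := {mpoly K[N]}.
Implicit Types (i j k : 'I_N) (f g : P).
Local Notation T := ('I_N * 'I_N * 'I_2 + 'I_N)%type.

(** For [b] true the group is G(2,1,N), otherwise G(2,2,N); in [db] the
    parameters are d_0 = -d_1 = c, respectively d = 0. *)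
Definition Wb : set 'M[K]_N := if b then @G21 K N else @G22 K N.
Definition db (j : int) : K := if b then c * (-1) ^ j else 0.
Local Notation Y := (@Y K N 2 c db).
Local Notation Dg := (@Dg K N db).
Local Notation comX := (@comX K N 2 c db).

Definition idxb (t : T) : bool :=
  match t with inl p => (p.1.1 < p.1.2)%N | inr _ => b end.

Lemma idxb_ordered t : idxb t -> ordered_idx t. Proof. by case: t. Qed.

Lemma Wb_rs t : ordered_idx t -> Wb (rs K t) <-> idxb t.
Proof.
move=> ot; rewrite /Wb; case: ifP => eb.
  by split=> _; [case: t ot => // k _; rewrite /= eb|exact: G21_rs].
rewrite G22_rs //; case: t ot => [p|k] //= _; by rewrite eb.
Qed.

Lemma Wb_Gr1n w : Wb w -> Gr1n 2 w.
Proof. by rewrite /Wb; case: ifP => _ // -[]. Qed.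

Lemma uniq_rs_idx : uniq [seq rs K t | t <- enum idxb].
Proof.
rewrite map_inj_in_uniq ?enum_uniq // => t t'; rewrite !mem_enum => it it'.
by apply: rs_inj; apply: idxb_ordered.
Qed.

Lemma reflections_idx : reflections Wb = [set` [seq rs K t | t <- enum idxb]]%classic.
Proof.
apply: funext => s; apply: propext; split=> [[Ws rk1]|].
  have [t ot st] := reflection_idx (Wb_Gr1n Ws) rk1.
  by apply/mapP; exists t => //; rewrite mem_enum; apply/Wb_rs; rewrite // -st.
move=> /mapP[t]; rewrite mem_enum => it ->; have ot := idxb_ordered it.
split; first exact/Wb_rs.
by have [i al1 u0] := ral_lead K ot; apply: refl_rank (rsE K ot) al1 u0.
Qed.

Lemma dunkl_sum (y : 'cV[K]_N) f : dunkl Wb c y f = dir_deriv y f -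
  \sum_(t | idxb t) (c * (ral K t *m y) 0 0) *: dq (rs K t) (ral K t) f.
Proof.
rewrite /dunkl; congr (_ - _); rewrite reflections_idx -fsbig_seq ?uniq_rs_idx //.
rewrite big_map big_enum /=; apply: eq_bigr => t it; have ot := idxb_ordered it.
have [i al1 u0] := ral_lead K ot.
exact: dunkl_term (rsE K ot) (rs_sq K ot) al1 u0 _ _ _.
Qed.

Lemma sum_pairs_at (V : zmodType) (G : 'I_N -> 'I_N -> V) i :
  (forall x y, G x y = G y x) -> (forall x y, x != i -> y != i -> G x y = 0) ->
  \sum_(p : 'I_N * 'I_N | (p.1 < p.2)%N) G p.1 p.2 = \sum_(j | j != i) G i j.
Proof.
move=> Gsym G0; rewrite -(pair_big_dep xpredT (fun x y : 'I_N => (x < y)%N) G) /=.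
rewrite (bigD1 i) //= [RHS](bigID (fun j => (i < j)%N)) /=; congr (_ + _).
  by apply: eq_bigl => j; rewrite -val_eqE neq_ltn; case: (ltngtP j i).
rewrite [RHS]big_mkcond [LHS]big_mkcond; apply: eq_bigr => x _.
have [xi|xi] := eqVneq x i; rewrite //= -leqNgt.
rewrite big_mkcond (bigD1 i) //= big1 ?addr0 => [|j ji]; last first.
  by case: ifP => // _; apply: G0.
rewrite Gsym; suff -> : (x <= i)%N = (x < i)%N by [].
by rewrite [RHS]ltn_neqAle val_eqE xi.
Qed.

Lemma db_sign (m : nat) : db (- m%:Z) = if b then c * (-1) ^+ m else 0.
Proof. by rewrite /db -exprnN signV. Qed.

Lemma db_per (j : int) : db (j + 2%:Z) = db j.
Proof. by rewrite /db expfzDr ?oppr_eq0 ?oner_eq0 // -exprnP sqrrN expr1n mulr1. Qed.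

Lemma Dg_db i f : Dg i f = if b then (2 * c) *: poly_act (zeta_mx (-1) i) f else 0.
Proof.
elim/mpoly_span_ind: f => [|e f g IHf IHg|a].
- by rewrite linear0 /poly_act linear0 scaler0 if_same.
- rewrite linearP /= IHf IHg; case: ifP => _; last by rewrite scaler0 addr0.
  by rewrite poly_act_is_linear -!mul_mpolyC; ring.
rewrite DgX /Dmon !db_sign; case: ifP => eb; last by rewrite subrr scale0r.
rewrite -[zeta_mx _ i]expr1 (poly_act_zeta (ltn0Sn 1) (m1_prim K)) mul1n scalerA signV.
by congr (_ *: _); rewrite exprS; ring.
Qed.

(** The commutator in the form in which it arises for a reflection group. *)
Lemma comX_refl i k f : comX i k f = (k == i)%:R *: f +
  \sum_(t | idxb t) (c * ral K t 0 i * ru K t k 0) *: poly_act (rs K t) f.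
Proof.
pose G x y := \sum_(l < 2) (c * ((x == i)%:R - (-1) ^+ l * (y == i)%:R) *
   - ((x == k)%:R - (-1) ^+ l * (y == k)%:R)) *: poly_act (refl_mx (-1) x y l) f.
have -> : \sum_(t | idxb t) (c * ral K t 0 i * ru K t k 0) *: poly_act (rs K t) f =
    \sum_(j | j != i) G i j - (k == i)%:R *: Dg i f.
  rewrite big_sumType /=; congr (_ + _); last first.
    rewrite Dg_db; case: ifP => _; last by rewrite big_pred0_eq scaler0 oppr0.
    rewrite (bigD1 i) //= big1 ?addr0 => [|j ji].
      rewrite !mxE !eqxx /= scalerA -scaleNr eq_sym; congr (_ *: _).
      by case: (i == k); rewrite /=; ring.
    by rewrite !mxE eq_sym (negPf ji) andbF mulr0 mul0r scale0r.
  rewrite -(sum_pairs_at (G := G)).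
  - rewrite (pair_big_dep (fun p : 'I_N * 'I_N => (p.1 < p.2)%N) (fun _ => xpredT)
      (fun p (l : 'I_2) => (c * ((p.1 == i)%:R - (-1) ^+ l * (p.2 == i)%:R) *
       - ((p.1 == k)%:R - (-1) ^+ l * (p.2 == k)%:R)) *: poly_act (refl_mx (-1) p.1 p.2 l) f)) /=.
    apply: eq_big => [p|p _]; first by rewrite andbT.
    by rewrite !mxE !eqxx /= ![i == _]eq_sym ![k == _]eq_sym ?andbT.
  - move=> x y; have [->//|xy] := eqVneq x y.
    apply: eq_bigr => l _; have yx : y != x by rewrite eq_sym.
    have -> : refl_mx (-1) x y l = refl_mx (-1) y x l :> 'M[K]_N.
      by rewrite !refl_m1E // tpermC; apply: eq_mmx => z; rewrite /m1la orbC.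
    congr (_ *: _); have sq : (-1) ^+ l * (-1) ^+ l = 1 :> K.
      by rewrite -exprMn mulrNN mulr1 expr1n.
    set e := (-1) ^+ l in sq *; set A := (x == i)%:R; set B := (y == i)%:R.
    set A' := (x == k)%:R; set B' := (y == k)%:R.
    transitivity (- (c * (A * A' + (e * e) * (B * B') - e * (A * B' + B * A')))); first by ring.
    transitivity (- (c * (B * B' + (e * e) * (A * A') - e * (A * B' + B * A')))); last by ring.
    by rewrite sq; ring.
  move=> x y /negPf xi /negPf yi; apply: big1 => l _.
  by rewrite xi yi mulr0 subr0 mulr0 mul0r scale0r.
have [eki|ki] := eqVneq k i; last first.
  rewrite comX_neq // !scale0r subr0 add0r (bigD1 k) //= big1 ?addr0 => [|j /andP[ji jk]].
    rewrite -(sum_refl_twist (ltn0Sn 1) (m1_prim K)) 1?eq_sym // scaler_sumr.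
    apply: eq_bigr => l _; rewrite scalerA signV !eqxx (negPf ki) [i == k]eq_sym (negPf ki).
    by congr (_ *: _); rewrite /=; ring.
  apply: big1 => l _; rewrite [i == k]eq_sym (negPf ki) (negPf jk).
  by rewrite mulr0 subr0 oppr0 mulr0 scale0r.
rewrite {1}eki comX_eq !scale1r -!addrA; congr (_ + _); rewrite addrC; congr (_ - _).
rewrite scaler_sumr -sumrN; apply: eq_bigr => j ji; have ij : i != j by rewrite eq_sym.
rewrite -(sum_refl (ltn0Sn 1) (m1_prim K)) // scaler_sumr -sumrN; apply: eq_bigr => l _.
by rewrite eki eqxx (negPf ji) -scaleNr; congr (_ *: _); rewrite /=; ring.
Qed.


Definition refl_part i f : P :=
  \sum_(t | idxb t) (c * ral K t 0 i) *: dq (rs K t) (ral K t) f.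

Lemma dunkl_refl_part (v : 'cV[K]_N) f :
  dunkl Wb c v f = \sum_i v i 0 *: (f^`M(i) - refl_part i f).
Proof.
rewrite dunkl_sum /dir_deriv.
under [RHS]eq_bigr do rewrite scalerBr.
rewrite sumrB; congr (_ - _).
under [RHS]eq_bigr do rewrite scaler_sumr.
rewrite exchange_big /=; apply: eq_bigr => t _; rewrite mxE mulr_sumr scaler_suml.
by apply: eq_bigr => i _; rewrite scalerA; congr (_ *: _); ring.
Qed.

Lemma refl_part_linear i : linear (refl_part i).
Proof.
move=> e f g; rewrite /refl_part scaler_sumr -big_split; apply: eq_bigr => t /idxb_ordered ot.
have [j al1 u0] := ral_lead K ot.
by rewrite (dq_linear (rsE K ot) (rs_sq K ot) al1) scalerDr !scalerA [_ * e]mulrC.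
Qed.

Lemma refl_part1 i : refl_part i 1 = 0.
Proof.
apply: big1 => t /idxb_ordered ot; have [j al1 u0] := ral_lead K ot.
by rewrite (dq1 (rs K t) al1) scaler0.
Qed.

Lemma refl_part_mulX i k f : refl_part i ('X_k * f) = 'X_k * refl_part i f -
  \sum_(t | idxb t) (c * ral K t 0 i * ru K t k 0) *: poly_act (rs K t) f.
Proof.
rewrite mulr_sumr -sumrB; apply: eq_bigr => t /idxb_ordered ot.
have [j al1 u0] := ral_lead K ot.
by rewrite (dq_mulX (rsE K ot) (rs_sq K ot) al1) scalerBr scalerA scalerAr.
Qed.

Lemma deriv_mulX i k f : ('X_k * f)^`M(i) = (k == i)%:R *: f + 'X_k * f^`M(i).
Proof.
rewrite mderivM mderivX mnm1E; have [->|_] := eqVneq k i; last by rewrite !scale0r mul0r.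
have -> : (U_(i) - U_(i) = 0)%MM by apply/mnmP => j; rewrite mnmBE subnn mnm0E.
by rewrite mpolyX0 !scale1r mul1r.
Qed.

(** Both sides kill 1 and have the same commutators with the variables. *)
Lemma refl_partE i f : f^`M(i) - refl_part i f = Y i f.
Proof.
elim/mpoly_mulX_ind: f => [|e f g IHf IHg|k f IH].
- by rewrite Y_one refl_part1 subr0 -mpolyC1 mderivC.
- by rewrite (linearP (Y i)) /= -IHf -IHg refl_part_linear linearP /= scalerBr opprD addrACA.
have -> : Y i ('X_k * f) = 'X_k * Y i f + comX i k f by rewrite /comX addrC subrK.
by rewrite -IH comX_refl deriv_mulX refl_part_mulX; ring.
Qed.

Lemma dunklE (v : 'cV[K]_N) f : dunkl Wb c v f = \sum_i v i 0 *: Y i f.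
Proof. by rewrite dunkl_refl_part; apply: eq_bigr => i _; rewrite refl_partE. Qed.

End DunklPolynomial.


(** * The irreducible quotients for the Dunkl operators *)

Section DunklQuotient.
Variables (K : numFieldType) (n' : nat) (c : K) (b : bool).
Local Notation n := n'.+1.
Hypothesis cE : c = 1%:R / n%:R.
Local Notation P := {mpoly K[n]}.
Implicit Types (i j k : 'I_n) (f g h : P) (la : 'I_n -> K) (s : 'S_n).
Local Notation d := (@db K c b).
Local Notation Y := (@Y K n 2 c d).
Local Notation Z := (@Z K n 2 c d).
Local Notation W := (@Wb K n b).
Local Notation stable := (@stable K n' 2 c d).
Local Notation Bad := (@Bad K n' 2 1 c d).
Local Notation F := (@F K n' 2 c d).
Local Notation lt02 := (ltn0Sn 1).
Local Notation prm1 := (m1_prim K).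
Local Notation co1 := (coprime1n n).
Local Notation dper := (@db_per K c b).

Lemma stable_of_mono (U : P -> Prop) : subspace U ->
  (forall i f, U f -> U ('X_i * f)) -> (forall i f, U f -> U (Y i f)) ->
  (forall s la f, (forall k, la k ^+ 2 = 1) -> U f -> U (mono s la f)) -> stable U.
Proof.
move=> subU UX UY Um; split=> // [s f Uf|i q f Uf].
  by rewrite pm_mono; apply: Um => // k; rewrite expr1n.
rewrite (cls_poly_act lt02 prm1); apply: sp_scale => //; apply: sp_sum => // m _; apply: sp_scale => //.
rewrite zeta_mxX poly_act_mmx => [|k]; last first.
  by case: ifP => _; rewrite ?oner_neq0 // signr_eq0.
apply: Um => // k; case: ifP => _; last by rewrite invr1 expr1n.
by rewrite signV -exprM mulnC exprM sqrrN !expr1n.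
Qed.

Lemma stable_dunkl (U : P -> Prop) : stable U ->
  dunkl_submodule W c (fun f => `[< U f >]).
Proof.
move=> stU; have subU := stable_sub stU; split.
  split=> [|a f g /asboolP Uf /asboolP Ug]; first by apply/asboolP; exact: subU.1.
  by apply/asboolP; apply: subU.2.
move=> h dh f /asboolP Uf; apply/asboolP.
elim: dh f Uf => {h} [w Ww|g|v|a h _ IH|h k _ IH _ IH'|h k _ IH _ IH'] f Uf.
- have [s [la [la2 ->]]] := Gr1nP (Wb_Gr1n Ww).
  rewrite poly_act_mmx => [|k]; last exact: root_neq0 (la2 k).
  by apply: (st_mono lt02 stU) => // k; rewrite exprVn la2 invr1.
- elim/mpoly_mulX_ind: g => [|a g g' IHg IHg'|k g IHg]; first by rewrite mul1r.
    by rewrite mulrDl -scalerAl; apply: subU.2.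
  by rewrite -mulrA; apply: (stable_mulX stU).
- by rewrite dunklE; apply: sp_sum => // i _; apply: sp_scale => //; apply: (stable_Y stU).
- by apply: sp_scale => //; apply: IH.
- by apply: sp_add => //; [apply: IH|apply: IH'].
- by apply: IH; apply: IH'.
Qed.

Lemma prod_sign la : (forall k, la k ^+ 2 = 1) ->
  \prod_k la k = (-1) ^+ #|[set k | la k == -1]%SET|.
Proof.
move=> la2; rewrite (bigID (fun k => la k == -1)) /= [X in _ * X]big1 ?mulr1 => [|k nk].
  rewrite (eq_bigr (fun=> -1)) => [|k /eqP //]; rewrite prodr_const; congr (_ ^+ _).
  by apply: eq_card => k; rewrite inE.
by have [//|e] := sqr1P (la2 k); rewrite e eqxx in nk.
Qed.

Lemma Wb_mmx s la : (forall k, la k ^+ 2 = 1) -> b \/ \prod_k la k = 1 -> W (mmx s la).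
Proof.
move=> la2 bla; have G1 : Gr1n 2 (mmx s la) by apply: Gr1n_mmx.
rewrite /Wb; case: ifP bla => // _ [//|p1]; split=> //; rewrite card_mmx_m1.
move: p1; rewrite prod_sign // -signr_odd; case: (odd _) => //.
by rewrite expr1 => /eqP; rewrite m1_neq1.
Qed.

Variables (L : lmodType K) (p : {linear P -> L}).
Hypothesis irr_p : is_dunkl_Ltriv W c p.
Local Notation N := (fun f => p f = 0).

Lemma N_algebra (h : P -> P) f : dunkl_algebra W c h -> N f -> N (h f).
Proof.
case: irr_p => _ [_ Nh] _ _ dh /eqP Nf; apply/eqP; exact: (Nh h dh f Nf).
Qed.

Lemma N_sub : subspace N.
Proof. by split=> [|a f g ef eg]; rewrite ?linear0 // linearP /= ef eg scaler0 addr0. Qed.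

Lemma N_mulX i f : N f -> N ('X_i * f).
Proof. exact: (N_algebra (DA_mul _ _ 'X_i)). Qed.

Lemma N_Y i f : N f -> N (Y i f).
Proof.
move=> Nf; have := N_algebra (DA_dunkl W c (delta_mx i 0)) Nf.
by rewrite dunklE; have := @YV_delta K n 2 c d i f; rewrite /YV => ->.
Qed.

Lemma N_mono s la f : (forall k, la k ^+ 2 = 1) -> b \/ \prod_k la k = 1 ->
  N f -> N (mono s la f).
Proof.
move=> la2 bla Nf; have := N_algebra (DA_W c (Wb_mmx s la2 bla)) Nf.
rewrite poly_act_mmx => [|k]; last exact: root_neq0 (la2 k).
suff /funext -> : (fun k => (la k)^-1) =1 la by [].
by move=> k; have [->|->] := sqr1P (la2 k); rewrite ?invr1 ?invrN1.
Qed.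

Lemma N_one : ~ N 1.
Proof.
move=> N1; have [_ _ [f /eqP nf] _] := irr_p; apply: nf.
exact: (sp_one N_sub N_mulX N1).
Qed.

Lemma N_Z i f : N f -> N (Z i f).
Proof.
move=> Nf; rewrite /Z; apply: (sp_add N_sub); first by apply/N_Y/N_mulX.
apply: (sp_scale N_sub); apply: (sp_sum N_sub) => j ji; rewrite S_sym.
rewrite -(sum_refl lt02 prm1); last by rewrite -val_eqE neq_ltn ji.
apply: (sp_sum N_sub) => l _; apply: (N_algebra (DA_W _ _)) Nf.
exact: ((@Wb_rs K n b (inl (j, i, l)) ji).2 ji).
Qed.

(** Sign change of the variable [x_0], which extends G(2,2,n) to G(2,1,n). *)
Definition eps0 k : K := if k == ord0 then -1 else 1.
Local Notation tau0 := (mono 1%g eps0 : P -> P).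
Definition Nplus f : Prop := exists g h, [/\ N g, N h & f = g + tau0 h].

Lemma eps0_sq k : eps0 k ^+ 2 = 1.
Proof. by rewrite /eps0; case: ifP => _; rewrite ?sqrrN expr1n. Qed.

Lemma eps0M k : eps0 k * eps0 k = 1. Proof. by rewrite -expr2 eps0_sq. Qed.

Lemma eps0V k : (eps0 k)^-1 = eps0 k.
Proof. by have [->|->] := sqr1P (eps0_sq k); rewrite ?invr1 ?invrN1. Qed.

Lemma prod_eps0 s : \prod_k eps0 (s k) = -1.
Proof.
rewrite [LHS](_ : _ = \prod_k eps0 k); last by rewrite [RHS](reindex_inj (@perm_inj _ s)).
rewrite (bigD1 ord0) //= /eps0 eqxx big1 ?mulr1 // => k k0.
by rewrite (negPf k0).
Qed.

(** An element of G(2,1,n) with an even number of signs preserves both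
    summands; after composition with [tau0], any other one is of this kind, so
    it exchanges them. *)
Lemma Nplus_stable : stable Nplus.
Proof.
apply: stable_of_mono.
- split; first by exists 0, 0; rewrite !linear0 addr0.
  move=> a f f' [g [h [Ng Nh ->]]] [g' [h' [Ng' Nh' ->]]].
  exists (a *: g + g'), (a *: h + h'); split; [exact: N_sub.2|exact: N_sub.2|].
  by rewrite (linearP (mono 1%g eps0)) /= scalerDr addrACA.
- move=> i f [g [h [Ng Nh ->]]]; exists ('X_i * g), (eps0 i *: ('X_i * h)).
  split; [exact: N_mulX|by apply: (sp_scale N_sub); apply: N_mulX|].
  by rewrite linearZ /= mono_mulX perm1 scalerA eps0M scale1r mulrDr.
- move=> i f [g [h [Ng Nh ->]]]; exists (Y i g), (eps0 i *: Y i h).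
  split; [exact: N_Y|by apply: (sp_scale N_sub); apply: N_Y|].
  rewrite [in RHS]linearZ /= (mono_Y _ _ _ _ _ lt02 eps0_sq) perm1 scalerA eps0V eps0M scale1r.
  exact: linearD.
move=> s la f la2 [g [h [Ng Nh ->]]]; rewrite linearD /= mono_comp mul1g.
have e1 : (fun j => la ((1%g : 'S_n) j) * eps0 j) =1 (fun j => la j * eps0 j) by move=> k; rewrite perm1.
rewrite (eq_mono _ _ e1).
have sq2 la' la'' : (forall k, la' k ^+ 2 = 1) -> (forall k, la'' k ^+ 2 = 1) ->
  forall k, (la' k * la'' k) ^+ 2 = 1 by move=> e e' k; rewrite exprMn e e' mulr1.
have epss k : eps0 (s k) ^+ 2 = 1 by exact: eps0_sq.
have back mu f' : mono s mu f' = tau0 (mono s (fun k => eps0 (s k) * mu k) f').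
  rewrite [RHS]mono_comp mulg1; apply: eq_mono => k.
  by rewrite mulrA eps0M mul1r.
have pp : (\prod_k la k) ^+ 2 = 1 by rewrite -prodrXl big1.
have [p1|pm1] := sqr1P pp.
  exists (mono s la g), (mono s (fun k => eps0 (s k) * (la k * eps0 k)) h).
  split; last by rewrite -back.
    by apply: N_mono => //; right.
  apply: N_mono => //; first by apply: (sq2) => //; apply: sq2 => //; apply: eps0_sq.
  right; rewrite big_split /= big_split /= p1 prod_eps0 mul1r.
  have := prod_eps0 1%g; under eq_bigr do rewrite perm1.
  by move=> ->; rewrite mulrNN mulr1.
exists (mono s (fun k => la k * eps0 k) h), (mono s (fun k => eps0 (s k) * la k) g).
split; last by rewrite -back addrC.
  apply: N_mono => //; first by apply: sq2 => //; apply: eps0_sq.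
  right; rewrite big_split /= pm1; have := prod_eps0 1%g; under eq_bigr do rewrite perm1.
  by move=> ->; rewrite mulrNN mulr1.
apply: N_mono => //; first exact: sq2.
by right; rewrite big_split /= pm1 prod_eps0 mulrNN mulr1.
Qed.

(** Otherwise the Euler operator would produce 1 in the proper submodule [N]. *)
Lemma N_expo0 f : b = false -> N f -> cf (expo0 n') f = 0.
Proof.
move=> bF Nf; apply/eqP; apply: contraT => nz; case: N_one.
apply: (euler_const lt02 (isT : (0 < 1)%N) co1 cE dper _ N_sub N_Z Nf nz).
by move=> j; rewrite /db bF.
Qed.

Lemma N_stable : b -> stable N.
Proof.
move=> bT; apply: stable_of_mono => //; [exact: N_sub|exact: N_mulX|exact: N_Y|].
by move=> s la f la2; apply: N_mono => //; left.
Qed.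

(** In the case of G(2,2,n), 1 in [Nplus] would be a sum of two polynomials
    without constant term. *)
Lemma N_Bad f : N f -> Bad f.
Proof.
move=> Nf; apply: contrapT => nB.
have dich U := @stable_dichotomy _ _ _ _ _ _ lt02 (isT : (0 < 1)%N) co1 cE dper U.
have [bT|bF] := boolP b; first by apply: N_one; apply: (dich _ (N_stable bT)) Nf nB.
have [|g [h [Ng Nh e1]]] := dich _ Nplus_stable _ _ nB.
  by exists f, 0; split=> //; [exact: linear0|rewrite linear0 addr0].
have {bF} bF : b = false by exact/negbTE.
have := congr1 (cf (expo0 n')) e1; rewrite linearD /= cf_mono1 (N_expo0 bF Ng) (N_expo0 bF Nh) mulr0 addr0.
by rewrite -(Xm0 K n') cfX eqxx => /eqP; rewrite oner_eq0.
Qed.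

Lemma N_eqBad f : N f <-> Bad f.
Proof.
split=> [|Bf]; first exact: N_Bad.
have stB := Bad_stable lt02 (isT : (0 < 1)%N) co1 cE dper.
have [_ _ _ maxN] := irr_p; have [|h|h] := maxN _ (stable_dunkl stB).
- by move=> g /N_Bad Bg; apply/asboolP.
- by apply: h; apply/asboolP.
by case: (Bad_one lt02 (isT : (0 < 1)%N) co1 cE dper); apply/asboolP/h.
Qed.

Lemma dunkl_basis (D : nat -> Prop) :
  is_basis [set a | good 2 1 d a /\ D (expo_sum a)]%classic (fun a => p (F a))
    [set v | exists2 f, forall b, cf b f != 0 -> D (expo_sum b) & p f = v]%classic.
Proof. exact: (quotient_basis lt02 (isT : (0 < 1)%N) co1 cE dper _ N_eqBad). Qed.

Lemma dunkl_Ltriv_degE (k : nat) : dunkl_Ltriv_deg p k =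
  [set v | exists2 f, forall b, cf b f != 0 -> expo_sum b = k & p f = v]%classic.
Proof.
apply: funext => v; apply: propext; split=> [[f /dhomogP fk <-]|[f fk <-]].
  exists f => // a nz; rewrite -mdeg_mn; apply: fk.
  by rewrite mcoeff_msupp.
exists f => //; apply/dhomogP => m; rewrite mcoeff_msupp => nz.
by apply: (etrans (esym (expo_sum_ex m))); apply: fk; rewrite /cf exK.
Qed.

End DunklQuotient.


(** * Graded dimensions *)

Section GradedDimensions.
Variable K : numFieldType.

(** The largest number of nonzero entries in a good exponent. *)
Definition support_bound (b : bool) (n : nat) : nat := if b then n else n.-1.

Lemma good_b_db (n N' : nat) (b : bool) (a : {ffun 'I_N'.+1 -> nat}) : N'.+1 = (2 * n)%N ->
  good_b 2 1 (db (1 / N'.+1%:R : K) b) a <->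
  (N'.+1 <= #|[set j | (a j < 1)%N]%SET| + support_bound b n)%N.
Proof. by case: b => NE; [apply: good_b_B|apply: good_b_D]. Qed.

Lemma support_bound_lt (n N' : nat) (b : bool) : N'.+1 = (2 * n)%N -> (support_bound b n < N'.+1)%N.
Proof. by case: b => /=; lia. Qed.

Lemma dunkl_Ltriv_dim (n N : nat) (b : bool) (L : lmodType K) (p : {linear {mpoly K[N]} -> L}) :
  (0 < n)%N -> N = (2 * n)%N -> is_dunkl_Ltriv (@Wb K N b) (1 / N%:R) p ->
  forall k, has_dim (dunkl_Ltriv_deg p k) (count_sum N (support_bound b n) k).
Proof.
case: N p => [|N'] p n0 NE irr_p k; first by lia.
have good_bE a := good_b_db b a NE; have hN := support_bound_lt b NE.
rewrite dunkl_Ltriv_degE -(size_good hN k).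
apply: (has_dim_basis (dunkl_basis (erefl _) irr_p (fun j => j = k))); first exact: uniq_good.
by move=> a; apply: good_ex3P.
Qed.

Lemma Ltriv_dim (n N : nat) (zeta : K) (d : int -> K) (c : K)
    (L : lmodType (@Hc K zeta 2 N c d)) (p : {linear Delta_triv zeta 2 N c d -> L}) :
  (0 < n)%N -> N = (2 * n)%N -> c = 1 / N%:R -> d = db c true ->
  2.-primitive_root zeta -> is_Ltriv p ->
  forall k, has_dim (Ltriv_deg p k) (count_sum N n k).
Proof.
case: N L p => [|N'] L p n0 NE cE dE zeta_prim irr_p k; first by lia.
have good_bE (a : {ffun 'I_N'.+1 -> nat}) : good_b 2 1 d a <-> (N'.+1 <= #|[set j | (a j < 1)%N]%SET| + n)%N.
  by rewrite dE cE; exact: (good_b_db true a NE).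
have hN : (n < N'.+1)%N by exact: (support_bound_lt true NE).
have d_per (j : int) : d (j + 2%:Z) = d j by rewrite dE db_per.
rewrite (Ltriv_degE p) -(size_good hN k).
apply: (has_dim_basis (Ltriv_basis (ltn0Sn 1) (isT : (0 < 1)%N) (coprime1n _) cE d_per
  zeta_prim irr_p (fun j => j = k))); first exact: uniq_good.
by move=> a; apply: good_ex3P.
Qed.

End GradedDimensions.

Theorem corollary4p7 (R : realType) :
  (forall (r n l : nat) (c0 : R[i]) (d : int -> R[i]),
     (0 < r)%N -> (0 < n)%N -> (0 < l)%N -> coprime l n ->
     c0 = l%:R / n%:R ->
     (forall j, d (j + r%:Z) = d j) ->
     let zeta := zeta_root R r in
     let good := fun a : {ffun 'I_n -> nat} =>
       condition_a r l a /\ condition_b r l d a in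
     forall (L : lmodType (Hc zeta r n c0 d))
       (p : {linear Delta_triv zeta r n c0 d -> L}),
       is_Ltriv p ->
       is_basis good (fun a => p (f_alpha zeta r c0 d a) : over_scalars L) setT /\
       (forall a, good a -> exists k, Ltriv_deg p k (p (f_alpha zeta r c0 d a))))
  /\
  (forall n : nat, (0 < n)%N ->
     let c : R[i] := 1 / (2 * n)%:R in
     let D_series : {poly nat} :=
       (parity_binsum n n.-1)%:P * 'X^(n.-1)
       + \sum_(0 <= k < n.-1)
           (parity_binsum n k)%:P * ('X^k + 'X^(2 * n.-1 - k)) in
     let B_series : {poly nat} :=
       (parity_binsum n n)%:P * 'X^n
       + \sum_(0 <= k < n)
           (parity_binsum n k)%:P * ('X^k + 'X^(2 * n - k)) in
     [/\ forall (L : lmodType R[i]) (p : {linear {mpoly R[i][2 * n]} -> L}),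
           is_dunkl_Ltriv (@G22 R[i] (2 * n)) c p ->
           forall k, has_dim (dunkl_Ltriv_deg p k) (D_series`_k)%R,
         forall (L : lmodType R[i]) (p : {linear {mpoly R[i][2 * n]} -> L}),
           is_dunkl_Ltriv (@G21 R[i] (2 * n)) c p ->
           forall k, has_dim (dunkl_Ltriv_deg p k) (B_series`_k)%R
       & forall (L : lmodType (Hc (zeta_root R 2) 2 (2 * n) c (fun j => c * (-1) ^ j)))
           (p : {linear Delta_triv (zeta_root R 2) 2 (2 * n) c (fun j => c * (-1) ^ j) -> L}),
           is_Ltriv p ->
           forall k, has_dim (Ltriv_deg p k) (B_series`_k)%R]).
Proof.
split=> [r [//|n'] l c0 d r_gt0 _ l_gt0 co_ln c0E d_per zeta good L p irr_p|n n_gt0 c D_series B_series].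
  have zeta_prim : r.-primitive_root zeta by apply: zeta_root_prim.
  have fE (a : {ffun 'I_n'.+1 -> nat}) : f_alpha zeta r c0 d a = tau r c0 d zeta (F r c0 d a).
    exact: f_alphaE r_gt0 l_gt0 co_ln c0E d_per zeta_prim a.
  split.
    have := Ltriv_basis r_gt0 l_gt0 co_ln c0E d_per zeta_prim irr_p (fun=> True).
    congr is_basis.
    - apply: funext => a; apply: propext; rewrite /good condition_aP // condition_bP //.
      by split=> [[]|].
    - by apply: funext => a; rewrite /ptau fE.
    apply: funext => v; apply: propext; split=> // _.
    by have [f fv] := ptau_surj r_gt0 d_per zeta_prim irr_p v; exists f.
  move=> a _; exists (expo_sum a); exists (f_alpha zeta r c0 d a) => //.
  rewrite fE; apply/Delta_degP; exists (F r c0 d a) => // b.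
  exact: (F_sum r_gt0 l_gt0 co_ln c0E d_per).
split=> L p irr_p k.
- by rewrite series_coef ?leq_pred //; apply: (dunkl_Ltriv_dim (b := false)).
- by rewrite series_coef //; apply: (dunkl_Ltriv_dim (b := true)).
rewrite series_coef //; apply: Ltriv_dim irr_p k => //.
exact: zeta_root_prim.
Qed.
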